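(* Let $(\phi, {}_A X_A)$ be a nondegenerate countably generated correspondence over a $\sigma$-unital $C^*$-algebra $A$, let $(\alpha, B, \psi)$ be an in-split of it, and let $(\psi \otimes \mathrm{Id}_B, X\otimes_{\alpha} B)$ be the in-split correspondence over $B$. Let $\beta\colon X\to X\otimes_\alpha B$ be the (well-defined, injective, linear) map satisfying $\beta(x\cdot a)=x\otimes\alpha(a)$ for all $x\in X$ and $a\in A$. Then the pair $(\alpha,\beta)\colon (\phi, {}_AX_A) \to (\psi \otimes \mathrm{Id}_B, X\otimes_\alpha B)$ is a covariant correspondence morphism, and the induced $*$-homomorphism $\alpha\times \beta\colon \mathcal{O}_X \to \mathcal{O}_{X\otimes_\alpha B}$ is a gauge-equivariant $*$-isomorphism.
   Context: For a right Hilbert $A$-module $X$, $\mathrm{End}_A(X)$ denotes the adjointable operators and $\mathrm{End}^0_A(X)$ the generalised compact operators, i.e. the closed span of $\Theta_{x,y}(z)=x\cdot (y\mid z)_A$. A correspondence $(\phi,{}_AX_A)$ over $A$ is a right Hilbert $A$-module $X$ with a $*$-homomorphism $\phi\colon A\to \mathrm{End}_A(X)$; it is nondegenerate if $\overline{\phi(A)X}=X$. Its covariance ideal is $J_\phi=\phi^{-1}(\mathrm{End}^0_A(X))\cap\ker(\phi)^\perp$. In-split: an in-split of a nondegenerate correspondence $(\phi,{}_AX_A)$ is a triple $(\alpha,B,\psi)$ consisting of a $C^*$-algebra $B$, a nondegenerate injective $*$-homomorphism $\alpha\colon A\to B$, and a left action ($*$-homomorphism) $\psi\colon B\to\mathrm{End}_A(X)$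 with $\psi\circ\alpha=\phi$ such that, with $J_\psi=\psi^{-1}(\mathrm{End}^0_A(X))\cap\ker(\psi)^\perp$: (i) $\alpha(J_\phi)\subseteq J_\psi$, and (ii) the induced $*$-homomorphism $\overline{\alpha}\colon A/J_\phi\to B/J_\psi$ is an isomorphism. The in-split correspondence is the correspondence $(\psi\otimes\mathrm{Id}_B, X\otimes_\alpha B)$ over $B$ with left action $(\psi\otimes\mathrm{Id}_B)(b')(x\otimes b)=\psi(b')x\otimes b$. A correspondence morphism $(\alpha,\beta)\colon(\phi_X,{}_AX_A)\to(\phi_Y,{}_BY_B)$ is a $*$-homomorphism $\alpha\colon A\to B$ and a linear map $\beta\colon X\to Y$ with $(\beta(x)\mid\beta(y))_B=\alpha((x\mid y)_A)$, $\beta(x\cdot a)=\beta(x)\cdot\alpha(a)$, and $\beta(\phi_X(a)x)=\phi_Y(\alpha(a))\beta(x)$. It induces $\beta^{(1)}\colon\mathrm{End}_A^0(X)\to\mathrm{End}_B^0(Y)$, $\beta^{(1)}(\Theta_{x,y})=\Theta_{\beta(x),\beta(y)}$, and is covariant if $\beta^{(1)}(\phi_X(c))=\phi_Y(\alpha(c))$ for all $c\in J_{\phi_X}$. A (covariant) representation of $(\phi_X,{}_AX_A)$ in a $C^*$-algebra $C$ is a (covariant) morphism to the identity correspondence $(\mathrm{Id}_C,{}_CC_C)$. The Cuntz--Pimsner algebra $\mathcal{O}_X$ is the universal $C^*$-algebra for covariant representations, generated by the universal one $(\iota_A,\iota_X)$; its gauge action is $\gamma^X_z(\iota_A(a))=\iota_A(a)$,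 $\gamma^X_z(\iota_X(x))=z\iota_X(x)$, $z\in\mathbb{T}$. A covariant morphism $(\alpha,\beta)$ induces a $*$-homomorphism $\alpha\times\beta\colon\mathcal{O}_X\to\mathcal{O}_Y$ determined by $(\alpha\times\beta)\circ\iota_A=\iota_B\circ\alpha$ and $(\alpha\times\beta)\circ\iota_X=\iota_Y\circ\beta$. *)

(* Defs.v *)
From HB Require Import structures.
From mathcomp Require Import all_boot all_order all_algebra.
From mathcomp Require Import complex.
From mathcomp Require Import all_classical all_reals all_analysis.

Set Implicit Arguments.
Unset Strict Implicit.
Unset Printing Implicit Defensive.

Import Order.TTheory GRing.Theory Num.Theory.
Import numFieldNormedType.Exports.
Local Open Scope classical_set_scope.
Local Open Scope ring_scope.
Local Open Scope complex_scope.

Reserved Notation "a ** b" (at level 40, left associativity).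
Reserved Notation "x *< a" (at level 40, left associativity).

(* The complex numbers are R[i] for R : realType; norms take values in R[i]. *)

HB.mixin Record isCStarAlgebra (R : realType) A
    & CompleteNormedModule R[i] A := {
  cmul : A -> A -> A;
  star : A -> A;
  cmulA : forall a b c, cmul a (cmul b c) = cmul (cmul a b) c;
  cmul_linearl : forall b, linear (fun a => cmul a b);
  cmul_linearr : forall a, linear (cmul a);
  starK : forall a, star (star a) = a;
  starD : forall a b, star (a + b) = star a + star b;
  starZ : forall (k : R[i]) a, star (k *: a) = k^* *: star a;
  starM : forall a b, star (cmul a b) = cmul (star b) (star a);
  normM_le : forall a b, `|cmul a b| <= `|a| * `|b|;
  norm_star_mul : forall a, `|cmul (star a) a| = `|a| ^+ 2
}.

#[short(type="cstarAlgType")]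
HB.structure Definition CStarAlgebra (R : realType) :=
  {A of CompleteNormedModule R[i] A & isCStarAlgebra R A}.

Notation "a ** b" := (cmul a b) : ring_scope.

Definition cstar_pos (R : realType) (A : cstarAlgType R) (a : A) : Prop :=
  exists c : A, a = star c ** c.

(* Definiteness of the inner product is a consequence of norm_inner. *)
HB.mixin Record isHilbertModule (R : realType) (A : cstarAlgType R) X
    & CompleteNormedModule R[i] X := {
  ract : X -> A -> X;
  inner : X -> X -> A;
  ract_linearl : forall a, linear (fun x => ract x a);
  ract_linearr : forall x, linear (ract x);
  ractM : forall x a b, ract x (a ** b) = ract (ract x a) b;
  inner_linear : forall x, linear (inner x);
  inner_star : forall x y, star (inner x y) = inner y x;
  inner_ract : forall x y a, inner x (ract y a) = inner x y ** a;
  inner_pos : forall x, cstar_pos (inner x x);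
  norm_inner : forall x, `|x| ^+ 2 = `|inner x x|
}.

#[short(type="hilbertModType")]
HB.structure Definition HilbertModule (R : realType) (A : cstarAlgType R) :=
  {X of CompleteNormedModule R[i] X & isHilbertModule R A X}.

Notation "x *< a" := (ract x a) : ring_scope.

Definition self_module (R : realType) (A : cstarAlgType R) : Type := A.

Section SelfModule.
Variables (R : realType) (A : cstarAlgType R).

HB.instance Definition _ := CompleteNormedModule.on (self_module A).

Let self_inner (a b : A) : A := star a ** b.

Let self_inner_star (a b : A) : star (self_inner a b) = self_inner b a.
Proof. by rewrite /self_inner starM starK. Qed.

Let self_inner_ract (a b c : A) : self_inner a (b ** c) = self_inner a b ** c.
Proof. by rewrite /self_inner cmulA. Qed.

Let self_inner_pos (a : A) : cstar_pos (self_inner a a).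
Proof. by exists a. Qed.

Let self_norm (a : A) : `|a| ^+ 2 = `|self_inner a a|.
Proof. by rewrite /self_inner norm_star_mul. Qed.

HB.instance Definition _ := isHilbertModule.Build R A (self_module A)
  (@cmul_linearl R A) (@cmul_linearr R A) (@cmulA R A)
  (fun a => @cmul_linearr R A (star a))
  self_inner_star self_inner_ract self_inner_pos self_norm.

End SelfModule.

Section Span.
Variables (R : realType).

Definition span (V : lmodType R[i]) (S : set V) : set V :=
  [set v | exists n (c : 'I_n -> R[i]) (s : 'I_n -> V),
     (forall i, S (s i)) /\ v = \sum_i c i *: s i].

Definition closed_span (V : normedModType R[i]) (S : set V) : set V :=
  closure (span S).

End Span.

Section CStar.
Variables (R : realType).

Record star_hom (A B : cstarAlgType R) (f : A -> B) : Prop := StarHom {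
  star_hom_linear : linear f;
  star_hom_mul : forall a b, f (a ** b) = f a ** f b;
  star_hom_star : forall a, f (star a) = star (f a)
}.

Definition star_iso (A B : cstarAlgType R) (f : A -> B) : Prop :=
  star_hom f /\ bijective f.

Definition nondegenerate_hom (A B : cstarAlgType R) (f : A -> B) : Prop :=
  closed_span [set f a ** b | a in setT & b in setT] = setT.

Record star_subalgebra (A : cstarAlgType R) (D : set A) : Prop :=
  StarSubalgebra {
  star_subalgebra0 : D 0;
  star_subalgebraP : forall (k : R[i]) a b, D a -> D b -> D (k *: a + b);
  star_subalgebraM : forall a b, D a -> D b -> D (a ** b);
  star_subalgebra_star : forall a, D a -> D (star a)
}.

Definition cstar_generated (A : cstarAlgType R) (S : set A) : Prop :=
  forall D : set A, star_subalgebra D -> closed D -> S `<=` D -> D = setT.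

Definition sigma_unital (A : cstarAlgType R) : Prop :=
  exists e : nat -> A,
    [/\ forall n, cstar_pos (e n) /\ `|e n| <= 1,
        forall n, cstar_pos (e n.+1 - e n),
        forall a, (fun n => e n ** a) @ \oo --> a
      & forall a, (fun n => a ** e n) @ \oo --> a].

(* A / J as a set of cosets, and the map A / I -> B / J induced by f, sending
   a + I to f a + J when f maps I into J. *)
Definition coset (A : cstarAlgType R) (J : set A) (a : A) : set A :=
  [set a' | J (a' - a)].

Definition quotient (A : cstarAlgType R) (J : set A) : set (set A) :=
  [set coset J a | a in setT].

Definition quotient_map (A B : cstarAlgType R) (J : set B) (f : A -> B)
    (K : set A) : set B :=
  [set b | exists2 a, K a & coset J (f a) b].

End CStar.

Section Operators.
Variables (R : realType) (A : cstarAlgType R).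
Implicit Types X Y : hilbertModType A.

Definition adjoint_pair X (T T' : X -> X) : Prop :=
  forall x y, inner (T x) y = inner x (T' y).

Definition theta X (x y : X) : X -> X := fun z => x *< inner y z.

Definition op_bounded X (T : X -> X) (k : R[i]) : Prop :=
  forall x, `|T x| <= k * `|x|.

(* End^0_A(X): the operator-norm closure of the span of the theta x y. *)
Definition compact_op X : set (X -> X) :=
  [set T | forall e : R[i], 0 < e ->
     exists2 S, span [set theta x y | x in setT & y in setT] S
              & op_bounded (T - S) e].

Definition countably_generated X : Prop :=
  exists x : nat -> X,
    closed_span [set x n *< a | n in setT & a in setT] = setT.

(* A *-homomorphism B -> End_A(X); left_action_adj says that psi b is adjointable
   with adjoint psi (star b). *)
Record left_action (B : cstarAlgType R) X (psi : B -> X -> X) : Prop :=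
  LeftAction {
  left_action_linear : forall (k : R[i]) b c,
    psi (k *: b + c) = k *: psi b + psi c;
  left_action_mul : forall b c, psi (b ** c) = psi b \o psi c;
  left_action_adj : forall b, adjoint_pair (psi b) (psi (star b))
}.

Definition nondegenerate_action (B : cstarAlgType R) X (psi : B -> X -> X) :
    Prop :=
  closed_span [set psi b x | b in setT & x in setT] = setT.

(* psi^-1(End^0_A(X)) intersected with the annihilator of ker psi *)
Definition covariance_ideal (B : cstarAlgType R) X (psi : B -> X -> X) : set B :=
  [set b | compact_op (psi b) /\ forall c, psi c = 0 -> b ** c = 0].

End Operators.

(* A correspondence over A is a Hilbert module X : hilbertModType A with
   phi : A -> X -> X such that left_action phi. *)

Section Morphisms.
Variables (R : realType).

Record corr_morphism (A B : cstarAlgType R)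
    (X : hilbertModType A) (phiX : A -> X -> X)
    (Y : hilbertModType B) (phiY : B -> Y -> Y)
    (alpha : A -> B) (beta : X -> Y) : Prop := CorrMorphism {
  corr_morphism_hom : star_hom alpha;
  corr_morphism_linear : linear beta;
  corr_morphism_inner : forall x y,
    inner (beta x) (beta y) = alpha (inner x y);
  corr_morphism_right : forall x a, beta (x *< a) = beta x *< alpha a;
  corr_morphism_left : forall a x, beta (phiX a x) = phiY (alpha a) (beta x)
}.

(* b1 restricts on End^0_A(X) to the *-homomorphism beta^(1), which these
   conditions determine there; its values elsewhere are irrelevant. *)
Record induced_on_compacts (A B : cstarAlgType R)
    (X : hilbertModType A) (Y : hilbertModType B) (beta : X -> Y)
    (b1 : (X -> X) -> (Y -> Y)) : Prop := InducedOnCompacts {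
  induced_compact : forall T, compact_op T -> compact_op (b1 T);
  induced_linear : forall (k : R[i]) S T, compact_op S -> compact_op T ->
    b1 (k *: S + T) = k *: b1 S + b1 T;
  induced_mul : forall S T, compact_op S -> compact_op T ->
    b1 (S \o T) = b1 S \o b1 T;
  induced_adj : forall T T', compact_op T -> compact_op T' ->
    adjoint_pair T T' -> adjoint_pair (b1 T) (b1 T');
  induced_bounded : forall T (k : R[i]), compact_op T -> 0 <= k ->
    op_bounded T k -> op_bounded (b1 T) k;
  induced_theta : forall x y, b1 (theta x y) = theta (beta x) (beta y)
}.

Definition covariant_morphism (A B : cstarAlgType R)
    (X : hilbertModType A) (phiX : A -> X -> X)
    (Y : hilbertModType B) (phiY : B -> Y -> Y)
    (alpha : A -> B) (beta : X -> Y) : Prop :=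
  corr_morphism phiX phiY alpha beta /\
  exists2 b1, induced_on_compacts beta b1
            & forall c, covariance_ideal phiX c ->
                b1 (phiX c) = phiY (alpha c).

Definition id_action (C : cstarAlgType R) :
    C -> self_module C -> self_module C :=
  fun c d => (c ** d : C).

Definition covariant_rep (A : cstarAlgType R) (X : hilbertModType A)
    (phi : A -> X -> X) (C : cstarAlgType R)
    (pi : A -> C) (t : X -> self_module C) : Prop :=
  covariant_morphism phi (@id_action C) pi t.

(* (O, iA, iX) is a model of the Cuntz-Pimsner algebra of (phi, X), which is
   determined up to isomorphism by this universal property. *)
Record cuntz_pimsner (A : cstarAlgType R) (X : hilbertModType A)
    (phi : A -> X -> X) (O : cstarAlgType R)
    (iA : A -> O) (iX : X -> self_module O) : Prop := CuntzPimsner {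
  cp_rep : covariant_rep phi iA iX;
  cp_generated : cstar_generated (range iA `|` (range iX : set O));
  cp_universal : forall (C : cstarAlgType R)
      (pi : A -> C) (t : X -> self_module C),
    covariant_rep phi pi t ->
    exists h : O -> C,
      [/\ star_hom h, forall a, h (iA a) = pi a & forall x, h (iX x) = t x]
}.

Definition gauge_action (A : cstarAlgType R) (X : hilbertModType A)
    (O : cstarAlgType R) (iA : A -> O) (iX : X -> self_module O)
    (g : R[i] -> O -> O) : Prop :=
  forall z : R[i], `|z| = 1 ->
    [/\ star_iso (g z), forall a, g z (iA a) = iA a
      & forall x, g z (iX x) = z *: iX x].

(* alpha x beta : O_X -> O_Y *)
Definition induced_hom (A B : cstarAlgType R)
    (X : hilbertModType A) (Y : hilbertModType B)
    (alpha : A -> B) (beta : X -> Y)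
    (OX : cstarAlgType R) (iA : A -> OX) (iX : X -> self_module OX)
    (OY : cstarAlgType R) (iB : B -> OY) (iY : Y -> self_module OY)
    (h : OX -> OY) : Prop :=
  [/\ star_hom h, forall a, h (iA a) = iB (alpha a)
    & forall x, h (iX x) = iY (beta x)].

End Morphisms.

Section InSplit.
Variables (R : realType) (A B : cstarAlgType R) (X : hilbertModType A).

Record in_split (phi : A -> X -> X) (alpha : A -> B) (psi : B -> X -> X) :
    Prop := InSplit {
  in_split_hom : star_hom alpha;
  in_split_nondegenerate : nondegenerate_hom alpha;
  in_split_inj : injective alpha;
  in_split_action : left_action psi;
  in_split_comp : forall a, psi (alpha a) = phi a;
  in_split_ideal :
    alpha @` covariance_ideal phi `<=` covariance_ideal psi;
  in_split_quotient :
    set_bij (quotient (covariance_ideal phi)) (quotient (covariance_ideal psi))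
      (quotient_map (covariance_ideal psi) alpha)
}.

(* (Y, tens) is a model of the completed tensor product of X and B over alpha,
   with tens x b the elementary tensor. *)
Record tensor_product (alpha : A -> B) (Y : hilbertModType B)
    (tens : X -> B -> Y) : Prop := TensorProduct {
  tensor_linearl : forall b, linear (tens^~ b);
  tensor_linearr : forall x, linear (tens x);
  tensor_balanced : forall x a b, tens (x *< a) b = tens x (alpha a ** b);
  tensor_right : forall x b c, tens x b *< c = tens x (b ** c);
  tensor_inner : forall x b y c,
    inner (tens x b) (tens y c) = star b ** alpha (inner x y) ** c;
  tensor_dense : closed_span [set tens x b | x in setT & b in setT] = setT
}.

(* rho is the left action psi (x) Id_B on the tensor product. *)
Definition in_split_action_on (psi : B -> X -> X) (Y : hilbertModType B)
    (tens : X -> B -> Y) (rho : B -> Y -> Y) : Prop :=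
  left_action rho /\ forall c x b, rho c (tens x b) = tens (psi c x) b.

End InSplit.

(* Main.v *)
(* Idea. As X = X A (Cohen factorisation), beta (x a) = x (x) alpha(a) determines
   an isometric morphism, and beta^(1) is T |-> T (x) 1. Finitely many vectors of
   X (x) B are almost fixed by E (x) 1 for a suitable finite-rank E on X, so
   psi(b) (x) 1 is compact only if psi(b) is, and the covariance ideals of psi and
   of psi (x) 1 agree. Covariance of (alpha, beta) and the homomorphism
   h = alpha x beta follow.

   For the inverse, condition (ii) of an in-split gives B = alpha(A) + J_psi with
   alpha^-1(J_psi) = J_phi. Hence pi(alpha(a) + j) = i_A(a) + i_X^(1)(psi(j)) is
   a well-defined homomorphism from B to O_X, and x (x) b |-> i_X(x) pi(b) makes
   it a covariant representation of X (x) B. The homomorphism this induces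
   inverts h on generators; gauge equivariance is checked on generators too.

   The C*-algebra facts needed are obtained without spectral theory, from the
   square root of 1 - w as limit of the iteration k |-> (w + k^2)/2, and from the
   remark that commuting self-adjoint T, V with T^2 + V^2 = 1 make T + iV
   unitary. *)

From HB Require Import structures.
Require Import Defs.
From mathcomp Require Import all_boot all_order all_algebra complex.
From mathcomp Require Import all_classical all_reals all_analysis.
From mathcomp Require Import ring lra.

Set Implicit Arguments.
Unset Strict Implicit.
Unset Printing Implicit Defensive.

Import Order.TTheory GRing.Theory Num.Theory numFieldNormedType.Exports.
Local Open Scope classical_set_scope.
Local Open Scope ring_scope.
Local Open Scope complex_scope.

(** * Identities in abelian groups *)

(** The obstacle is analytic: the algebra rests on norm bounds that are not part of the data. Left
    actions, homomorphisms and adjoints come as bare functions, so their contractivity has to be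
    derived, and the isometry of injective homomorphisms as well. For this, elements of A are
    treated as operators on A itself, where a unit is available. A recurring device is that a
    self-adjoint operator with bounded powers is a contraction. It yields the positivity of adjoint
    products, and it yields the contractivity of beta^(1) on finite-rank operators: an operator
    induced on Y also acts on vectors outside beta(X), but its powers are controlled by what happens
    on beta(X). The map beta^(1) is handled as a closed relation between operators on X and
    operators on Y. Uniqueness, products, adjoints and composition of morphisms then become
    statements about finite-rank approximants, and covariance becomes membership in this relation.
    Isometry of beta, which comes from injectivity of alpha, is what brings estimates made in Y back
    to X. *)

Inductive zexpr := ZZero | ZAtom of nat | ZAdd of zexpr & zexpr | ZOpp of zexpr.

Fixpoint zcoef (e : zexpr) : seq int :=
  match e with
  | ZZero => [::]
  | ZAtom n => rcons (nseq n 0) 1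
  | ZAdd e f => let fix add s t := match s, t with
      | x :: s', y :: t' => (x + y) :: add s' t'
      | [::], _ => t
      | _, [::] => s end in add (zcoef e) (zcoef f)
  | ZOpp e => map -%R (zcoef e)
  end.

Section Eval.
Variable V : zmodType.
Implicit Types (env : seq V) (s t : seq int).

Fixpoint zeval env (e : zexpr) : V :=
  match e with
  | ZZero => 0
  | ZAtom n => nth 0 env n
  | ZAdd e f => zeval env e + zeval env f
  | ZOpp e => - zeval env e
  end.

Fixpoint zsum env s : V :=
  match env, s with v :: env', c :: s' => v *~ c + zsum env' s' | _, _ => 0 end.

Lemma zsum_nil env : zsum env [::] = 0. Proof. by case: env. Qed.

Lemma zevalE env e : zeval env e = zsum env (zcoef e).
Proof.
elim: e => /= [|n|e -> f ->|e ->].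
- by rewrite zsum_nil.
- by elim: env n => [|v env IH] [|n] //=; rewrite ?zsum_nil ?addr0 // add0r IH.
- move: (zcoef e) (zcoef f) => s t.
  elim: env s t => [|v env IH] [|c s] [|d t] //=; rewrite ?addr0 ?add0r //.
  by rewrite mulrzDr -IH addrACA.
- elim: env (zcoef e) => [|v env IH] [|c s] /=; rewrite ?oppr0 //.
  by rewrite mulrNz -IH opprD.
Qed.

(** Testing the coefficients of the difference for zero, rather than comparing two coefficient
    lists, makes trailing zeros harmless. *)
Lemma zmod_refl env e f :
  all (fun x => x == 0) (zcoef (ZAdd e (ZOpp f))) -> zeval env e = zeval env f.
Proof.
move=> h; apply/eqP; rewrite -subr_eq0.
rewrite -[_ - _]/(zeval env (ZAdd e (ZOpp f))) zevalE.
elim: env (zcoef _) h => [|v env IH] [|c s] //= /andP[/eqP-> hs].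
by rewrite mulr0z add0r IH.
Qed.
End Eval.

(* Atoms are compared up to unification, because the same term may carry
   different inheritance paths to its algebraic structure. *)
Ltac zindex x env :=
  match env with
  | ?y :: _ => let _ := match goal with _ => unify x y end in constr:(O)
  | _ :: ?e => let n := zindex x e in constr:(S n)
  end.
Ltac zmem x env :=
  match env with
  | ?y :: _ => let _ := match goal with _ => unify x y end in constr:(true)
  | _ :: ?e => zmem x e
  | _ => constr:(false)
  end.
Ltac zatoms t env :=
  lazymatch t with
  | ?a + ?b => let e := zatoms a env in zatoms b e
  | - ?a => zatoms a env
  | 0 => env
  | _ => lazymatch zmem t env with true => env | false => constr:(t :: env) end
  end.
Ltac zreify t env :=
  lazymatch t with
  | ?a + ?b => let x := zreify a env in let y := zreify b env in constr:(ZAdd x y)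
  | - ?a => let x := zreify a env in constr:(ZOpp x)
  | 0 => constr:(ZZero)
  | _ => let n := zindex t env in constr:(ZAtom n)
  end.
Ltac zmod_eq :=
  lazymatch goal with |- @eq ?V ?l ?r =>
    let e := zatoms l (@nil V) in
    let e := zatoms r e in
    let a := zreify l e in let b := zreify r e in
    refine (@zmod_refl _ e a b _); vm_compute; reflexivity
  end.

(** * Norms and limits *)

Section RealNorm.
Variables (R : realType).

(** Norms take values in R[i]; the real-valued version is open to [lra], [nra] and suprema. *)
Definition nrm (V : normedModType R[i]) (x : V) : R := complex.Re `|x|.

Section Lemmas.
Variables (V : normedModType R[i]).
Implicit Types x y : V.

Lemma nrmE x : `|x| = (nrm x)%:C.
Proof. by rewrite /nrm RRe_real ?normr_real. Qed.

Lemma nrm_ge0 x : 0 <= nrm x.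
Proof. by rewrite -(@lecR R) -nrmE; exact: normr_ge0. Qed.

Lemma nrm0 : nrm (0 : V) = 0.
Proof. by rewrite /nrm normr0. Qed.

Lemma nrm_eq0 x : nrm x = 0 -> x = 0.
Proof. by move=> h; apply/normr0_eq0; rewrite nrmE h. Qed.

Lemma nrmD x y : nrm (x + y) <= nrm x + nrm y.
Proof. by rewrite -(@lecR R) rmorphD /= -!nrmE ler_normD. Qed.

Lemma nrmN x : nrm (- x) = nrm x.
Proof. by rewrite /nrm normrN. Qed.

Lemma nrmB x y : nrm (x - y) <= nrm x + nrm y.
Proof. by rewrite -(nrmN y) nrmD. Qed.

Lemma nrmBC x y : nrm (x - y) = nrm (y - x).
Proof. by rewrite -nrmN opprB. Qed.

Lemma nrmZ (k : R[i]) x : nrm (k *: x) = complex.Re `|k| * nrm x.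
Proof.
rewrite /nrm normrZ -(@RRe_real _ `|k|) ?normr_real// nrmE /=.
by rewrite mul0r subr0.
Qed.

Lemma nrmZr (k : R) x : nrm (k%:C *: x) = `|k| * nrm x.
Proof. by rewrite nrmZ normc_def /= expr0n addr0 sqrtr_sqr. Qed.

Lemma nrm_dist x y z : nrm (x - z) <= nrm (x - y) + nrm (y - z).
Proof. by rewrite (le_trans _ (nrmD _ _))// addrA subrK. Qed.

Lemma nrm_small x : (forall e : R, 0 < e -> nrm x <= e) -> x = 0.
Proof.
move=> h; apply: nrm_eq0; apply/eqP; rewrite eq_le nrm_ge0 andbT.
by apply/ler_addgt0Pl => e e0; rewrite addr0; apply: h.
Qed.

(** The form in which most limit identities below are proved: the error is a constant times [e], and
    the sign of the constant need not be tracked. *)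
Lemma nrm_smallM x (C : R) : (forall e : R, 0 < e -> nrm x <= C * e) -> x = 0.
Proof.
move=> h; apply: nrm_small => e e0.
have C0 : 0 < `|C| + 1 by rewrite ltr_wpDl.
have /le_trans -> // := h (e / (`|C| + 1)) (divr_gt0 e0 C0).
rewrite mulrA ler_pdivrMr// mulrC ler_pM2l//.
by have := ler_norm C; lra.
Qed.

Lemma closureP (S : set V) x :
  closure S x <-> forall e : R, 0 < e -> exists2 s, S s & nrm (x - s) <= e.
Proof.
split=> [cx e e0|h].
  have e0' : 0 < e%:C by rewrite (@ltcR R 0).
  have [s [Ss]] := cx _ (nbhsx_ballx x _ e0').
  rewrite -ball_normE /ball_ /= nrmE ltcR => /ltW ?; by exists s.
move=> U /nbhs_ballP[e /= e0 sU].
have [_ re0] : complex.Im e = 0 /\ 0 < complex.Re e.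
  by move: e0; rewrite ltcE /= => /andP[/eqP].
have e2 : 0 < complex.Re e / 2 by rewrite divr_gt0.
have [s Ss xs] := h _ e2; exists s; split => //; apply: sU.
rewrite -ball_normE /ball_ /= nrmE -(RRe_real (gtr0_real e0)) ltcR.
by rewrite (le_lt_trans xs)// ltr_pdivrMr// mulr2n; lra.
Qed.

End Lemmas.

Lemma pos_half (e : R) : 0 < e -> 0 < e / 2.
Proof. by move=> e0; rewrite divr_gt0. Qed.

Lemma invS_gt0 n : 0 < n.+1%:R^-1 :> R.
Proof. by rewrite invr_gt0. Qed.

Lemma invS_le n m : (n <= m)%N -> m.+1%:R^-1 <= n.+1%:R^-1 :> R.
Proof. by move=> nm; rewrite lef_pV2 ?posrE ?ler_nat. Qed.

Lemma invS_small (e : R) : 0 < e -> exists n, n.+1%:R^-1 <= e.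
Proof.
move=> e0; exists (Num.truncn e^-1).
by rewrite -[leRHS]invrK lef_pV2 ?posrE ?invr_gt0// ltW// truncnS_gt.
Qed.

(** The Cauchy rate [d] is kept as a rate of convergence, so that bounds pass to the limit with
    explicit constants. *)
Lemma lim_exists (V : completeNormedModType R[i]) (u : nat -> V) (d : nat -> R) :
  (forall n m, (n <= m)%N -> nrm (u m - u n) <= d n) ->
  (forall e, 0 < e -> exists N, d N <= e) ->
  exists l, forall n, nrm (l - u n) <= d n.
Proof.
move=> ud d0.
have cu : cvg (u @ \oo).
  apply/cauchy_cvgP; apply/cauchy_exP => e e0.
  have [_ re0] : complex.Im e = 0 /\ 0 < complex.Re e.
    by move: e0; rewrite ltcE /= => /andP[/eqP].
  have [N dN] := d0 (complex.Re e / 2) ltac:(lra).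
  exists (u N); exists N => //= n /= Nn.
  rewrite -ball_normE /ball_ /= nrmE -(RRe_real (gtr0_real e0)) ltcR nrmBC.
  by rewrite (le_lt_trans (ud _ _ Nn))//; lra.
exists (lim (u @ \oo)) => n; apply/ler_addgt0Pr => e e0.
have e0' : 0 < e%:C by rewrite (@ltcR R 0).
have /cvgrPdist_lt /(_ _ e0')[N _ hN] := cu.
have := hN (maxn N n) (leq_maxl _ _); rewrite nrmE ltcR => h1.
have h2 := ud n (maxn N n) (leq_maxr _ _).
rewrite (le_trans (nrm_dist _ (u (maxn N n)) _))//; lra.
Qed.

Lemma cvg_nrm (V : normedModType R[i]) (u : nat -> V) (l : V) :
  u @ \oo --> l -> forall e : R, 0 < e ->
  exists N, forall n, (N <= n)%N -> nrm (u n - l) <= e.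
Proof.
move=> ul e e0.
have e0' : 0 < e%:C by rewrite (@ltcR R 0).
have /cvgrPdist_lt /(_ _ e0')[N _ hN] := ul.
by exists N => n /hN; rewrite nrmE ltcR nrmBC => /ltW.
Qed.

(** One vector is added at a time, so that facts about spans are proved by induction; [spanP] links
    it to the span of the definitions. *)
Inductive ispan (V : lmodType R[i]) (S : set V) : V -> Prop :=
| ispan0 : ispan S 0
| ispanD k s v : S s -> ispan S v -> ispan S (k *: s + v).

Section Span.
Variables (V : lmodType R[i]) (S : set V).

Lemma ispan_lin k v w : ispan S v -> ispan S w -> ispan S (k *: v + w).
Proof.
move=> + Sw; elim=> [|c s u Ss _ IH]; first by rewrite scaler0 add0r.
by rewrite scalerDr scalerA -addrA; apply: ispanD.
Qed.

Lemma ispan_add v w : ispan S v -> ispan S w -> ispan S (v + w).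
Proof. by move=> Sv Sw; rewrite -(scale1r v); apply: ispan_lin. Qed.

Lemma ispan_scale k v : ispan S v -> ispan S (k *: v).
Proof. by move=> Sv; rewrite -(addr0 (k *: v)); apply: ispan_lin => //; left. Qed.

Lemma ispan_mem v : S v -> ispan S v.
Proof. by move=> Sv; rewrite -(addr0 v) -(scale1r v); right => //; left. Qed.

Lemma spanP v : Defs.span S v <-> ispan S v.
Proof.
split=> [[n [c [s [Ss ->]]]]|].
  by elim/big_ind: _ => [|? ?|i _]; [left|exact: ispan_add|apply/ispan_scale/ispan_mem].
elim=> [|k s w Ss _ [n [c [f [Sf ->]]]]].
  by exists 0%N, (fun=> 0), (fun=> 0); split=> [[]//|]; rewrite big_ord0.
exists n.+1, (fun i => if unlift ord0 i is Some j then c j else k),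
  (fun i => if unlift ord0 i is Some j then f j else s); split.
  by move=> i; case: unlift.
rewrite big_ord_recl unlift_none; congr (_ + _).
by apply: eq_bigr => i _; rewrite liftK.
Qed.

End Span.
End RealNorm.

Section LinearPred.
Variables (K : pzRingType) (U V : lmodType K) (f : U -> V) (lf : linear f).
Lemma lin0 : f 0 = 0.
Proof. by have := lf (-1) 0 0; rewrite scaler0 add0r scaleN1r addNr. Qed.
Lemma linD x y : f (x + y) = f x + f y.
Proof. by have := lf 1 x y; rewrite !scale1r. Qed.
Lemma linZ k x : f (k *: x) = k *: f x.
Proof. by have := lf k x 0; rewrite !addr0 lin0 addr0. Qed.
Lemma linN x : f (- x) = - f x.
Proof. by rewrite -!scaleN1r linZ. Qed.
Lemma linB x y : f (x - y) = f x - f y.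
Proof. by rewrite linD linN. Qed.
End LinearPred.

(** * C*-algebras and Hilbert modules *)

Section Scalars.
Variables (R : realType).
Lemma scale2 (V : lmodType R[i]) (x : V) : 2%:C *: x = x + x.
Proof. by rewrite rmorph_nat scaler_nat mulr2n. Qed.
Lemma nrmZi (V : normedModType R[i]) (x : V) : nrm ('i *: x) = nrm x.
Proof. by rewrite nrmZ normc_def /= expr0n expr1n add0r sqrtr1 mul1r. Qed.
Lemma conjci : ('i : R[i])^* = - 'i.
Proof. by apply/eqP; rewrite eq_complex /= oppr0 !eqxx. Qed.
End Scalars.

Section CStarBasics.
Variables (R : realType) (A : cstarAlgType R).
Implicit Types a b c : A.

Lemma cmulDl a b c : (a + b) ** c = a ** c + b ** c.
Proof. exact: linD (@cmul_linearl R A c) a b. Qed.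
Lemma cmulDr a b c : a ** (b + c) = a ** b + a ** c.
Proof. exact: linD (@cmul_linearr R A a) b c. Qed.
Lemma cmulZl k a c : (k *: a) ** c = k *: (a ** c).
Proof. exact: linZ (@cmul_linearl R A c) k a. Qed.
Lemma cmulZr k a c : a ** (k *: c) = k *: (a ** c).
Proof. exact: linZ (@cmul_linearr R A a) k c. Qed.
Lemma cmulNl a c : (- a) ** c = - (a ** c).
Proof. exact: linN (@cmul_linearl R A c) a. Qed.
Lemma cmulNr a c : a ** (- c) = - (a ** c).
Proof. exact: linN (@cmul_linearr R A a) c. Qed.
Lemma cmulBl a b c : (a - b) ** c = a ** c - b ** c.
Proof. by rewrite cmulDl cmulNl. Qed.
Lemma cmulBr a b c : a ** (b - c) = a ** b - a ** c.
Proof. by rewrite cmulDr cmulNr. Qed.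
Lemma cmul0l c : 0 ** c = 0.
Proof. exact: lin0 (@cmul_linearl R A c). Qed.
Lemma cmul0r a : a ** 0 = 0.
Proof. exact: lin0 (@cmul_linearr R A a). Qed.

Lemma star0 : star (0 : A) = 0.
Proof. by apply: (addrI (star 0)); rewrite -starD !addr0. Qed.
Lemma starN a : star (- a) = - star a.
Proof. by apply: (addrI (star a)); rewrite -starD !subrr star0. Qed.
Lemma starB a b : star (a - b) = star a - star b.
Proof. by rewrite starD starN. Qed.
Lemma starZr (k : R) a : star (k%:C *: a) = k%:C *: star a.
Proof. by rewrite starZ; congr (_ *: _); exact: conjc_real. Qed.

Lemma nrm_cmul a b : nrm (a ** b) <= nrm a * nrm b.
Proof. by rewrite -(@lecR R) rmorphM /= -!nrmE; exact: normM_le. Qed.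

Lemma nrm_star_mul a : nrm (star a ** a) = nrm a ^+ 2.
Proof. by apply: complexI; rewrite rmorphXn /= -!nrmE; exact: norm_star_mul. Qed.

Lemma nrm_star a : nrm (star a) = nrm a.
Proof.
have le b : nrm b <= nrm (star b).
  have [b0|b0] := eqVneq (nrm b) 0; first by rewrite b0 nrm_ge0.
  have bp : 0 < nrm b by rewrite lt_def b0 nrm_ge0.
  by rewrite -(ler_pM2r bp) -expr2 -nrm_star_mul nrm_cmul.
by apply/eqP; rewrite eq_le le andbT; have := le (star a); rewrite starK.
Qed.

Lemma nrm_mul_star a : nrm (a ** star a) = nrm a ^+ 2.
Proof. by have := nrm_star_mul (star a); rewrite starK nrm_star. Qed.

End CStarBasics.

Section ModBasics.
Variables (R : realType) (A : cstarAlgType R) (X : hilbertModType A).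
Implicit Types (x y z : X) (a b : A).

Lemma innerDr x y z : inner x (y + z) = inner x y + inner x z.
Proof. exact: linD (inner_linear x) y z. Qed.
Lemma innerZr k x y : inner x (k *: y) = k *: inner x y.
Proof. exact: linZ (inner_linear x) k y. Qed.
Lemma innerNr x y : inner x (- y) = - inner x y.
Proof. exact: linN (inner_linear x) y. Qed.
Lemma innerBr x y z : inner x (y - z) = inner x y - inner x z.
Proof. by rewrite innerDr innerNr. Qed.
Lemma inner0r x : inner x 0 = 0.
Proof. exact: lin0 (inner_linear x). Qed.
Lemma innerDl x y z : inner (x + y) z = inner x z + inner y z.
Proof. by rewrite -inner_star innerDr starD !inner_star. Qed.
Lemma innerNl x z : inner (- x) z = - inner x z.
Proof. by rewrite -inner_star innerNr starN !inner_star. Qed.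
Lemma innerBl x y z : inner (x - y) z = inner x z - inner y z.
Proof. by rewrite innerDl innerNl. Qed.
Lemma inner0l x : inner 0 x = 0.
Proof. by rewrite -inner_star inner0r star0. Qed.
Lemma innerZl k x y : inner (k *: x) y = k^* *: inner x y.
Proof. by rewrite -inner_star innerZr starZ inner_star. Qed.
Lemma innerZlr (k : R) x y : inner (k%:C *: x) y = k%:C *: inner x y.
Proof. by rewrite -inner_star innerZr starZr inner_star. Qed.
Lemma inner_ractl x y a : inner (x *< a) y = star a ** inner x y.
Proof. by rewrite -inner_star inner_ract starM inner_star. Qed.

Lemma nrm_inner x : nrm (inner x x) = nrm x ^+ 2.
Proof. by apply: complexI; rewrite rmorphXn /= -!nrmE -norm_inner. Qed.

Lemma inner_eq0 x : inner x x = 0 -> x = 0.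
Proof.
move=> h; apply: nrm_eq0; have := nrm_inner x; rewrite h nrm0.
by move/esym/eqP; rewrite sqrf_eq0 => /eqP.
Qed.

Lemma inner_inj x y : (forall z, inner z x = inner z y) -> x = y.
Proof.
move=> h; apply/eqP; rewrite -subr_eq0; apply/eqP/inner_eq0.
by rewrite innerBr h subrr.
Qed.

Lemma ractDl x y a : (x + y) *< a = x *< a + y *< a.
Proof. exact: linD (@ract_linearl R A X a) x y. Qed.
Lemma ractDr x a b : x *< (a + b) = x *< a + x *< b.
Proof. exact: linD (@ract_linearr R A X x) a b. Qed.
Lemma ractZl k x a : (k *: x) *< a = k *: (x *< a).
Proof. exact: linZ (@ract_linearl R A X a) k x. Qed.
Lemma ractZr k x a : x *< (k *: a) = k *: (x *< a).
Proof. exact: linZ (@ract_linearr R A X x) k a. Qed.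
Lemma ractNl x a : (- x) *< a = - (x *< a).
Proof. exact: linN (@ract_linearl R A X a) x. Qed.
Lemma ractNr x a : x *< (- a) = - (x *< a).
Proof. exact: linN (@ract_linearr R A X x) a. Qed.
Lemma ractBl x y a : (x - y) *< a = x *< a - y *< a.
Proof. by rewrite ractDl ractNl. Qed.
Lemma ractBr x a b : x *< (a - b) = x *< a - x *< b.
Proof. by rewrite ractDr ractNr. Qed.
Lemma ract0l a : (0 : X) *< a = 0.
Proof. exact: lin0 (@ract_linearl R A X a). Qed.
Lemma ract0r x : x *< 0 = 0.
Proof. exact: lin0 (@ract_linearr R A X x). Qed.

Lemma nrm_ract x a : nrm (x *< a) <= nrm x * nrm a.
Proof.
rewrite -(@ler_pXn2r _ 2)// ?nnegrE ?mulr_ge0 ?nrm_ge0//.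
rewrite -nrm_inner inner_ract inner_ractl (le_trans (nrm_cmul _ _))//.
rewrite exprMn mulrC expr2 -mulrA mulrC mulrA.
rewrite (le_trans (ler_wpM2r (nrm_ge0 _) (nrm_cmul _ _)))// nrm_star nrm_inner.
by rewrite mulrC mulrA [nrm a * nrm a * _]mulrC mulrA.
Qed.

(* The constant 4 comes from polarisation; the sharp inequality
   [cauchy_schwarz] below needs the positivity theory. *)
Lemma weak_cauchy_schwarz x y : nrm (inner x y) <= 4 * (nrm x * nrm y).
Proof.
have sumsq (u v : X) : nrm (inner u v + inner v u) <= (nrm u + nrm v) ^+ 2.
  have e : inner u v + inner v u + (inner u v + inner v u) =
      inner (u + v) (u + v) - inner (u - v) (u - v).
    by rewrite !(innerDl, innerDr, innerNl, innerNr); zmod_eq.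
  have := nrmB (inner (u + v) (u + v)) (inner (u - v) (u - v)).
  rewrite -e -scale2 nrmZr !nrm_inner ger0_norm// => h.
  have h1 := nrmD u v; have h2 := nrmB u v.
  have := nrm_ge0 (u + v); have := nrm_ge0 (u - v).
  by have := nrm_ge0 u; have := nrm_ge0 v; nra.
have sq (u v : X) : nrm (inner u v) <= (nrm u + nrm v) ^+ 2.
  have e : 2%:C *: inner u v = (inner u v + inner v u)
      - 'i *: (inner u ('i *: v) + inner ('i *: v) u).
    rewrite innerZr innerZl -[Num.conj _]/('i^*)%C conjci scaleNr scalerBr !scalerA.
    by rewrite -expr2 sqr_i !scaleN1r scale2; zmod_eq.
  have := nrmB (inner u v + inner v u)
     ('i *: (inner u ('i *: v) + inner ('i *: v) u)).
  rewrite -e nrmZr nrmZi ger0_norm// => h.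
  have := sumsq u v; have := sumsq u ('i *: v); rewrite nrmZi; lra.
have [x0|x0] := eqVneq (nrm x) 0.
  by rewrite (nrm_eq0 x0) inner0l !nrm0 mul0r mulr0.
have [y0|y0] := eqVneq (nrm y) 0.
  by rewrite (nrm_eq0 y0) inner0r !nrm0 !mulr0.
have xp : 0 < nrm x by rewrite lt_def x0 nrm_ge0.
have yp : 0 < nrm y by rewrite lt_def y0 nrm_ge0.
have := sq ((nrm x)^-1%:C *: x) ((nrm y)^-1%:C *: y).
rewrite innerZlr innerZr !nrmZr !normfV !ger0_norm ?nrm_ge0//.
rewrite !mulVf// => h.
have : nrm x * nrm y * ((nrm x)^-1 * ((nrm y)^-1 * nrm (inner x y))) <=
   nrm x * nrm y * (1 + 1) ^+ 2 by rewrite ler_pM2l// mulr_gt0.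
have -> : nrm x * nrm y * ((nrm x)^-1 * ((nrm y)^-1 * nrm (inner x y))) =
   nrm (inner x y) by field; rewrite x0 y0.
lra.
Qed.

End ModBasics.

(** * Bounded and adjointable operators *)

Section Bounded.
Variables (R : realType).
Definition bop (V W : normedModType R[i]) (T : V -> W) (k : R) : Prop :=
  forall x, nrm (T x) <= k * nrm x.

Section Bop.
Variables (V W : normedModType R[i]).
Implicit Types S T : V -> W.

Lemma bop_le T k l : k <= l -> bop T k -> bop T l.
Proof. by move=> kl Tk x; rewrite (le_trans (Tk x))// ler_wpM2r ?nrm_ge0. Qed.

Lemma bop0 k : 0 <= k -> bop (fun _ : V => 0 : W) k.
Proof. by move=> k0 x; rewrite nrm0 mulr_ge0 ?nrm_ge0. Qed.

Lemma bopD S T k l : bop S k -> bop T l -> bop (fun x => S x + T x) (k + l).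
Proof. by move=> Sk Tl x; rewrite (le_trans (nrmD _ _))// mulrDl lerD. Qed.

Lemma bopN T k : bop T k -> bop (fun x => - T x) k.
Proof. by move=> Tk x; rewrite nrmN. Qed.

Lemma bopB S T k l : bop S k -> bop T l -> bop (fun x => S x - T x) (k + l).
Proof. by move=> Sk Tl; apply: bopD => //; apply: bopN. Qed.

Lemma bopZ (c : R[i]) T k :
  bop T k -> bop (fun x => c *: T x) (complex.Re `|c| * k).
Proof.
move=> Tk x; rewrite nrmZ -mulrA ler_wpM2l//.
by rewrite normc_def sqrtr_ge0.
Qed.

Lemma bopZr (c : R) T k : bop T k -> bop (fun x => c%:C *: T x) (`|c| * k).
Proof. by move=> Tk x; rewrite nrmZr -mulrA ler_wpM2l. Qed.

(* A bound k is only forced to be nonnegative when V is nonzero. *)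
Lemma bop_max T k : bop T k -> exists2 l, 0 <= l & bop T l.
Proof. by exists `|k|; rewrite ?normr_ge0//; apply: bop_le (ler_norm k) _. Qed.

Lemma bop_pos T k : bop T k -> exists2 l, 1 <= l & bop T l.
Proof.
exists (`|k| + 1); first by rewrite lerDr.
by apply: bop_le H; have := ler_norm k; lra.
Qed.

Lemma bop_inf T k : (forall e, 0 < e -> bop T (k + e)) -> bop T k.
Proof.
move=> h x; apply/ler_addgt0Pr => e e0.
have x1 : 0 < nrm x + 1 by rewrite ltr_wpDl ?nrm_ge0.
rewrite (le_trans (h (e / (nrm x + 1)) _ x)) ?divr_gt0//.
rewrite mulrDl lerD2l -mulrA ger_pMr// mulrC ler_pdivrMr//.
by rewrite mul1r; lra.
Qed.

End Bop.

Lemma bop_comp (U V W : normedModType R[i]) (S : V -> W) (T : U -> V) k l :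
  0 <= k -> bop S k -> bop T l -> bop (S \o T) (k * l).
Proof.
by move=> k0 Sk Tl x /=; rewrite (le_trans (Sk _))// -mulrA ler_wpM2l.
Qed.

End Bounded.

Section Adjointable.
Variables (R : realType) (A : cstarAlgType R) (X : hilbertModType A).
Implicit Types S T : X -> X.

Lemma adjoint_sym T T' : adjoint_pair T T' -> adjoint_pair T' T.
Proof. by move=> h x y; rewrite -inner_star -h inner_star. Qed.

Lemma adjoint_lin T T' : adjoint_pair T T' -> linear T.
Proof.
move=> h k x y; apply: inner_inj => z; have h' := adjoint_sym h.
by rewrite innerDr innerZr -!h' innerDr innerZr.
Qed.

Lemma adjoint_ract T T' x a : adjoint_pair T T' -> T (x *< a) = T x *< a.
Proof.
move=> /adjoint_sym h; apply: inner_inj => z.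
by rewrite inner_ract -!h inner_ract.
Qed.

Lemma adjoint_uniq T T1 T2 : adjoint_pair T T1 -> adjoint_pair T T2 -> T1 = T2.
Proof. by move=> h1 h2; apply/funext => y; apply: inner_inj => x; rewrite -h1 h2. Qed.

Lemma adjoint_comp S S' T T' :
  adjoint_pair S S' -> adjoint_pair T T' -> adjoint_pair (S \o T) (T' \o S').
Proof. by move=> hS hT x y /=; rewrite hS hT. Qed.

Lemma adjoint_comb k S S' T T' : adjoint_pair S S' -> adjoint_pair T T' ->
  adjoint_pair (k *: S + T) (k^* *: S' + T').
Proof.
move=> hS hT x y; rewrite innerDl innerDr innerZl innerZr hS hT.
by congr (_ *: _ + _); exact: conjCK.
Qed.

(** An adjoint pair of functions comes with no constant; both bounds are recorded because the
    estimates below start from them. *)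
Definition adjointable T : Prop :=
  exists T', [/\ adjoint_pair T T', exists k, bop T k & exists k, bop T' k].

Lemma adjointable0 : adjointable 0.
Proof.
exists 0; split=> [x y||]; first by rewrite inner0l inner0r.
  by exists 0; apply: bop0.
by exists 0; apply: bop0.
Qed.

Lemma adjointable_comb k S T :
  adjointable S -> adjointable T -> adjointable (k *: S + T).
Proof.
move=> [S' [hS [a Sa] [a' Sa']]] [T' [hT [b Tb] [b' Tb']]].
exists (k^* *: S' + T'); split; first exact: adjoint_comb.
  by eexists; apply: bopD Tb; apply: bopZ Sa.
by eexists; apply: bopD Tb'; apply: bopZ Sa'.
Qed.

Lemma adjointable1 : adjointable id.
Proof. by exists id; split=> //; exists 1 => x; rewrite mul1r. Qed.

Lemma adjointable_comp S T :
  adjointable S -> adjointable T -> adjointable (S \o T).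
Proof.
move=> [S' [hS [a Sa] [a' Sa']]] [T' [hT [b Tb] [b' Tb']]].
exists (T' \o S'); split; first exact: adjoint_comp.
  by have [l l0 Sl] := bop_max Sa; exists (l * b); apply: bop_comp.
by have [l l0 Tl] := bop_max Tb'; exists (l * a'); apply: bop_comp.
Qed.

Definition adj_pred : {pred (X -> X)} := fun T => `[< adjointable T >].

Lemma adj_submod : submod_closed adj_pred.
Proof.
split=> [|k S T /asboolP hS /asboolP hT]; first exact/asboolP/adjointable0.
exact/asboolP/adjointable_comb.
Qed.

HB.instance Definition _ := GRing.isSubmodClosed.Build R[i] (X -> X) adj_pred
  adj_submod.

End Adjointable.

Section Endo.
Variables (R : realType) (A : cstarAlgType R) (X : hilbertModType A).

(** Bundling gives a ring that is also an R[i]-module, so the library lemmas on powers and commuting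
    elements apply. The ring may be zero, as X may be. *)
Record endo := Endo { eop :> X -> X; eopP : @adj_pred R A X eop }.
HB.instance Definition _ := [isSub for eop].
HB.instance Definition _ := [Choice of endo by <:].
HB.instance Definition _ := [SubChoice_isSubLmodule of endo by <:].

Lemma endo_eq (S T : endo) : (forall x, S x = T x) -> S = T.
Proof. by move=> h; apply/val_inj/funext. Qed.

Implicit Types S T : endo.

Definition endo1 := Endo (introT (asboolP _) (@adjointable1 R A X)).
Definition endoM (S T : endo) : endo := Endo (introT (asboolP _)
  (adjointable_comp (elimT (asboolP _) (eopP S)) (elimT (asboolP _) (eopP T)))).

Lemma endo_lin (T : endo) : linear T.
Proof. by have /asboolP[T' [/adjoint_lin]] := eopP T. Qed.

Lemma eaddE (S T : endo) x : (S + T) x = S x + T x. Proof. by []. Qed.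
Lemma eoppE (T : endo) x : (- T) x = - T x. Proof. by []. Qed.
Lemma escaleE k (T : endo) x : (k *: T) x = k *: T x. Proof. by []. Qed.

Fact endoMA : associative endoM. Proof. by move=> S T U; apply: endo_eq. Qed.
Fact endo1M : left_id endo1 endoM. Proof. by move=> S; apply: endo_eq. Qed.
Fact endoM1 : right_id endo1 endoM. Proof. by move=> S; apply: endo_eq. Qed.
Fact endoDl : left_distributive endoM +%R.
Proof. by move=> S T U; apply: endo_eq. Qed.
Fact endoDr : right_distributive endoM +%R.
Proof. by move=> S T U; apply: endo_eq => x; exact: linD (endo_lin S) _ _. Qed.

HB.instance Definition _ := GRing.Zmodule_isPzRing.Build endo
  endoMA endo1M endoM1 endoDl endoDr.

Lemma emulE (S T : endo) x : (S * T) x = S (T x). Proof. by []. Qed.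
Lemma eoneE x : (1 : endo) x = x. Proof. by []. Qed.

Lemma ezAl k (S T : endo) : (k *: S) * T = k *: (S * T).
Proof. by apply: endo_eq. Qed.
Lemma ezAr k (S T : endo) : S * (k *: T) = k *: (S * T).
Proof. by apply: endo_eq => x; exact: linZ (endo_lin S) _ _. Qed.

Lemma endo_adj_ex (T : endo) : exists T' : endo, adjoint_pair T T'.
Proof.
have /asboolP[T' [h b b']] := eopP T.
have hT' : adjointable T' by exists T; split=> //; apply: adjoint_sym.
by exists (Endo (introT (asboolP _) hT')).
Qed.
Definition eadj T := sval (cid (endo_adj_ex T)).
Lemma eadjP T : adjoint_pair T (eadj T). Proof. by rewrite /eadj; case: cid. Qed.

Lemma endo_bounded (T : endo) : exists2 k, 1 <= k & bop T k.
Proof. by have /asboolP[T' [_ [k /bop_pos hk] _]] := eopP T. Qed.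

Definition sa (T : endo) := adjoint_pair T T.

Lemma sa1 : sa 1. Proof. by []. Qed.
Lemma saM S T : sa S -> sa T -> S * T = T * S -> sa (S * T).
Proof. by move=> hS hT c x y; rewrite {1}c /= hT hS. Qed.
Lemma saD S T : sa S -> sa T -> sa (S + T).
Proof. by move=> hS hT x y; rewrite !eaddE innerDl innerDr hS hT. Qed.
Lemma saN T : sa T -> sa (- T).
Proof. by move=> hT x y; rewrite !eoppE innerNl innerNr hT. Qed.
Lemma saB S T : sa S -> sa T -> sa (S - T).
Proof. by move=> hS hT; apply/saD/saN. Qed.
Lemma saZ (c : R) T : sa T -> sa (c%:C *: T).
Proof. by move=> hT x y; rewrite !escaleE innerZlr innerZr hT. Qed.
Lemma saX T n : sa T -> sa (T ^+ n).
Proof.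
move=> hT; elim: n => [|n IH]; first by rewrite expr0.
by rewrite exprS; apply: saM => //; rewrite -exprS exprSr.
Qed.
Lemma sa0 : sa 0.
Proof. by move=> x y;
  rewrite -[(0 : endo) x]/(0 : X) inner0l -[(0 : endo) y]/(0 : X) inner0r. Qed.

Lemma ebop1 : bop (1 : endo) 1. Proof. by move=> x; rewrite mul1r. Qed.
Lemma ebopM (S T : endo) k l : 0 <= k -> bop S k -> bop T l -> bop (S * T) (k * l).
Proof. exact: bop_comp. Qed.
Lemma ebopD (S T : endo) k l : bop S k -> bop T l -> bop (S + T) (k + l).
Proof. exact: bopD. Qed.
Lemma ebopB (S T : endo) k l : bop S k -> bop T l -> bop (S - T) (k + l).
Proof. exact: bopB. Qed.
Lemma ebopZ (S : endo) (c : R) k : bop S k -> bop (c%:C *: S) (`|c| * k).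
Proof. exact: bopZr. Qed.
Lemma ebopC (c : R) : bop (c%:C *: (1 : endo)) `|c|.
Proof. by move=> x; rewrite escaleE nrmZr. Qed.

End Endo.
Arguments endo {R A} X.

(** * Square roots and positivity *)

Section Unitary.
Variables (R : realType) (A : cstarAlgType R) (X : hilbertModType A).

(* T + iV is c times a unitary, and T is its real part. *)
Lemma unitary_bound (T V : X -> X) (c : R) : 0 <= c ->
  adjoint_pair T T -> adjoint_pair V V -> (forall x, T (V x) = V (T x)) ->
  (forall x, T (T x) + V (V x) = (c ^+ 2)%:C *: x) -> bop T c.
Proof.
move=> c0 hT hV TV TTVV x.
(* Used for s = i and s = -i. The cross terms cancel since T and V commute, so both T + sV scale
   norms by [c], and their sum is 2T. *)
have W (s : R[i]) : s^* = - s -> s * s = -1 -> nrm (T x + s *: V x) = c * nrm x.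
  move=> sJ ss; apply/eqP; rewrite -(@eqrXn2 _ 2)// ?mulr_ge0 ?nrm_ge0// exprMn.
  rewrite -!nrm_inner !(innerDl, innerDr, innerZl, innerZr).
  rewrite -[Num.conj s]/(s^*)%C sJ scalerA mulNr ss opprK scale1r !hT !hV TV.
  have -> : inner x (T (T x)) + s *: inner x (V (T x)) +
     (- s *: inner x (V (T x)) + inner x (V (V x))) =
     inner x (T (T x) + V (V x)).
    rewrite innerDr scaleNr; zmod_eq.
  by rewrite TTVV innerZr nrmZr ger0_norm ?exprn_ge0.
have e : 2%:C *: T x = (T x + 'i *: V x) + (T x + (- 'i) *: V x).
  by rewrite scale2 scaleNr; zmod_eq.
have := nrmD (T x + 'i *: V x) (T x + (- 'i) *: V x).
have W1 : nrm (T x + 'i *: V x) = c * nrm x.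
  by apply: W; [exact: conjci|rewrite -expr2 sqr_i].
have W2 : nrm (T x + (- 'i) *: V x) = c * nrm x.
  by apply: W; [rewrite -conjci conjcK conjci opprK|rewrite mulrNN -expr2 sqr_i].
by rewrite -e nrmZr ger0_norm// W1 W2; lra.
Qed.
End Unitary.

Section ScalarRoot.
Variable R : realType.

(* The iteration [kseq] below at the scalar w = 1, which dominates it. *)
Fixpoint kap n : R := if n is m.+1 then (1 + kap m ^+ 2) / 2 else 0.

Lemma kap_bounds n : 0 <= kap n <= 1 /\ kap n <= kap n.+1.
Proof. by elim: n => [|n [/andP[h0 h1] h]] /=; [split; lra|rewrite /= in h;
  split; nra]. Qed.

Definition kinf := sup (range kap).

Lemma kap_has_sup : has_sup (range kap).
Proof.
by split; [exists (kap 0), 0%N|exists 1 => _ [n _ <-]; have [/andP[]] := kap_bounds n].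
Qed.

Lemma kap_le n : kap n <= kinf.
Proof. by apply: ub_le_sup; [have [] := kap_has_sup|exists n]. Qed.

Lemma kinf_le1 : kinf <= 1.
Proof.
apply: ge_sup; first by have [] := kap_has_sup.
by move=> _ [n _ <-]; have [/andP[]] := kap_bounds n.
Qed.

Lemma kap_cvg e : 0 < e -> exists N, kinf - kap N <= e.
Proof.
move=> e0; have [_ [N _ <-] h] := sup_adherent e0 kap_has_sup.
by exists N; rewrite /kinf; lra.
Qed.

End ScalarRoot.

Section Root.
Variables (R : realType) (A : cstarAlgType R) (X : hilbertModType A).
Implicit Types (S T V w k : endo X).

(* The limit k satisfies 2k = w + k^2, that is (1 - k)^2 = 1 - w. *)
Fixpoint kseq w n : endo X :=
  if n is m.+1 then (2^-1)%:C *: (w + kseq w m * kseq w m) else 0.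

Lemma kseqSE w n x :
  kseq w n.+1 x = (2^-1)%:C *: (w x + kseq w n (kseq w n x)).
Proof. by []. Qed.

Lemma half_add (V : lmodType R[i]) (x : V) : (2^-1)%:C *: (x + x) = x.
Proof. by rewrite -scale2 scalerA -rmorphM mulVf// scale1r. Qed.

Lemma kseq_sa w n : sa w -> sa (kseq w n).
Proof. by move=> hw; elim: n => [|n IH] /=; [exact: sa0|apply/saZ/saD/saM]. Qed.

Lemma kseq_bop w n : bop w 1 -> bop (kseq w n) (kap R n).
Proof.
move=> hw; elim: n => [|n IH]; first exact: bop0.
have [/andP[k0 k1] _] := kap_bounds R n.
have := ebopZ 2^-1 (ebopD hw (ebopM k0 IH IH)).
by apply: bop_le; rewrite ger0_norm ?invr_ge0//= mulrC expr2.
Qed.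

(** The next increment is half of k_(n+1) d + d k_n, where d is the present one. The scalar sequence
    obeys the same recursion with equality, so it dominates. *)
Lemma kseq_step w n : bop w 1 ->
  bop (kseq w n.+1 - kseq w n) (kap R n.+1 - kap R n).
Proof.
move=> hw; elim: n => [|n IH].
  by rewrite subr0; have := kseq_bop 1 hw; rewrite [kap R 0]/0 subr0.
have -> : kseq w n.+2 - kseq w n.+1 = (2^-1)%:C *:
    (kseq w n.+1 * (kseq w n.+1 - kseq w n) + (kseq w n.+1 - kseq w n) * kseq w n).
  rewrite [kseq w n.+2]/= [in X in _ - X]/= -scalerBr; congr (_ *: _).
  rewrite -[(2^-1)%:C *: _]/(kseq w n.+1) mulrBr mulrBl; zmod_eq.
have [/andP[k0 _] h] := kap_bounds R n; have [/andP[k0' _] _] := kap_bounds R n.+1.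
have d0 : 0 <= kap R n.+1 - kap R n by rewrite subr_ge0.
have := ebopZ 2^-1 (ebopD (ebopM k0' (kseq_bop n.+1 hw) IH)
  (ebopM d0 IH (kseq_bop n hw))).
apply: bop_le; rewrite ger0_norm ?invr_ge0//.
have -> : kap R n.+2 = (1 + kap R n.+1 ^+ 2) / 2 by [].
have : kap R n.+1 = (1 + kap R n ^+ 2) / 2 by [].
by move: (kap R n.+1) (kap R n) => a b; nra.
Qed.

Lemma kseq_dist w n m : bop w 1 -> (n <= m)%N ->
  bop (kseq w m - kseq w n) (kap R m - kap R n).
Proof.
move=> hw /subnK <-; elim: (m - n)%N => [|j IH].
  by rewrite !subrr; exact: bop0.
have := ebopD (kseq_step (j + n) hw) IH.
by rewrite !addrA !subrK addSn.
Qed.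

(** The increments are dominated by those of a bounded monotone scalar sequence. The rate is part of
    the conclusion because [kseq_intertwine] compares limits through it. *)
Lemma kseq_cvg w : sa w -> bop w 1 ->
  exists k, [/\ sa k, bop k 1, k + k = w + k * k &
    forall n, bop (k - kseq w n) (kinf R - kap R n)].
Proof.
move=> saw hw.
have cv x : exists l, forall n, nrm (l - kseq w n x) <= (kinf R - kap R n) * nrm x.
  apply: (@lim_exists R X (fun n => kseq w n x)) => [n m nm|e e0].
    rewrite (le_trans (kseq_dist hw nm x))// ler_wpM2r ?nrm_ge0//.
    by rewrite lerD2r kap_le.
  have x1 : 0 < nrm x + 1 by rewrite ltr_wpDl ?nrm_ge0.
  have [N hN] := kap_cvg (divr_gt0 e0 x1).
  exists N; rewrite (le_trans (ler_wpM2r (nrm_ge0 _) hN))//.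
  by rewrite -mulrA ger_pMr// mulrC ler_pdivrMr// mul1r; lra.
pose f x := sval (cid (cv x)).
have fP n : bop (fun x => f x - kseq w n x) (kinf R - kap R n).
  by move=> x; rewrite /f; case: cid.
have f1 : bop f (kinf R).
  by move=> x; have := fP 0%N x; rewrite -[kseq w 0 x]/(0 : X) subr0 [kap R 0]/= subr0.
have fsa : adjoint_pair f f.
  move=> x y; apply/eqP; rewrite -subr_eq0; apply/eqP.
  (* The 8 is twice the constant 4 of [weak_cauchy_schwarz]. *)
  apply: (nrm_smallM (C := 8 * (nrm x * nrm y))) => e e0.
  have [N hN] := kap_cvg e0.
  have -> : inner (f x) y - inner x (f y) =
     inner (f x - kseq w N x) y - inner x (f y - kseq w N y).
    by rewrite innerBl innerBr (kseq_sa N saw); zmod_eq.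
  apply: le_trans (nrmB _ _) _.
  have := weak_cauchy_schwarz (f x - kseq w N x) y.
  have := weak_cauchy_schwarz x (f y - kseq w N y).
  have := fP N x; have := fP N y; have := nrm_ge0 x; have := nrm_ge0 y.
  have := nrm_ge0 (f x - kseq w N x); have := nrm_ge0 (f y - kseq w N y).
  move: (nrm (f x - kseq w N x)) (nrm (f y - kseq w N y)) (nrm x) (nrm y) => a b p q.
  move=> b0 a0 q0 p0 bq ap h1 h2.
  have h3 : b <= e * q by rewrite (le_trans bq)// ler_wpM2r.
  have h4 : a <= e * p by rewrite (le_trans ap)// ler_wpM2r.
  have : p * b <= p * (e * q) by rewrite ler_wpM2l.
  have : a * q <= e * p * q by rewrite ler_wpM2r.
  by lra.
have fadj : adjointable f by exists f; split=> //; exists (kinf R).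
pose k : endo X := Endo (introT (asboolP _) fadj).
have kP n : bop (k - kseq w n) (kinf R - kap R n) by exact: fP.
have k1 : bop k 1 by apply: bop_le f1; apply: kinf_le1.
exists k; split=> //; apply: endo_eq => x; apply/eqP; rewrite -subr_eq0; apply/eqP.
apply: (nrm_smallM (C := 4 * nrm x)) => e e0.
have [N hN] := kap_cvg e0.
have hN' : kinf R - kap R N.+1 <= e.
  by apply: le_trans hN; rewrite lerD2l lerN2; case: (kap_bounds R N).
(* The recursion 2 k_(N+1) = w + k_N^2 is subtracted; each of the four remaining terms is at most
   [e] in norm. *)
have E : k + k - (w + k * k) = (k - kseq w N.+1) + (k - kseq w N.+1) -
    (k * (k - kseq w N) + (k - kseq w N) * kseq w N).
  have h : kseq w N.+1 + kseq w N.+1 = w + kseq w N * kseq w N.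
    by rewrite -scale2 /= scalerA -rmorphM mulfV// scale1r.
  rewrite mulrBr mulrBl.
  transitivity (k + k - (kseq w N.+1 + kseq w N.+1) + kseq w N * kseq w N - k * k).
    by rewrite h; zmod_eq.
  by zmod_eq.
rewrite -[(k + k) x - (w + k * k) x]/((k + k - (w + k * k)) x) E.
have [/andP[k0 kN1] _] := kap_bounds R N.
have d0 : 0 <= kinf R - kap R N by rewrite subr_ge0 kap_le.
have h := ebopB (ebopD (kP N.+1) (kP N.+1)) (ebopD (ebopM ler01 k1 (kP N))
  (ebopM d0 (kP N) (kseq_bop N hw))).
apply: le_trans (h x) _; rewrite mulrAC ler_wpM2r ?nrm_ge0//.
have : (kinf R - kap R N) * kap R N <= kinf R - kap R N by rewrite ler_piMr.
by lra.
Qed.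

End Root.

(** The iterates are polynomials in w without constant term, so J intertwines them and then their
    limits. J is only linear and bounded: it is an operator in commutation arguments and a
    homomorphism in [star_hom_inj_unit_ball]. *)
Lemma kseq_intertwine (R : realType) (A B : cstarAlgType R)
    (X : hilbertModType A) (Y : hilbertModType B)
    (w k : endo X) (w' k' : endo Y) (J : X -> Y) (b : R) :
  linear J -> bop J b -> (forall x, J (w x) = w' (J x)) ->
  (forall n, bop (k - kseq w n) (kinf R - kap R n)) ->
  (forall n, bop (k' - kseq w' n) (kinf R - kap R n)) ->
  forall x, J (k x) = k' (J x).
Proof.
move=> lJ Jb Jw kP k'P x.
have JK n z : J (kseq w n z) = kseq w' n (J z).
  elim: n z => [|n IH] z; first exact: lin0 lJ.
  by rewrite !kseqSE (linZ lJ) (linD lJ) Jw !IH.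
apply/eqP; rewrite -subr_eq0; apply/eqP.
have {b Jb} [b b0 Jb] := bop_max Jb.
apply: (nrm_smallM (C := (b + b) * nrm x)) => e e0.
have [N hN] := kap_cvg e0.
have -> : J (k x) - k' (J x) = J ((k - kseq w N) x) - (k' - kseq w' N) (J x).
  by rewrite !eaddE !eoppE (linB lJ) JK; zmod_eq.
apply: le_trans (nrmB _ _) _.
have h1 := Jb ((k - kseq w N) x); have h2 := kP N x.
have h3 := k'P N (J x); have h4 := Jb x; have n0 := nrm_ge0 x.
have n1 := nrm_ge0 (J x).
have e1 : (kinf R - kap R N) * nrm x <= e * nrm x by rewrite ler_wpM2r.
have e2 : (kinf R - kap R N) * nrm (J x) <= e * nrm (J x) by rewrite ler_wpM2r.
have e3 : b * nrm ((k - kseq w N) x) <= b * (e * nrm x).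
  by rewrite ler_wpM2l// (le_trans h2).
have e4 : e * nrm (J x) <= e * (b * nrm x) by rewrite ler_pM2l.
by lra.
Qed.

Section Positive.
Variables (R : realType) (A : cstarAlgType R) (X : hilbertModType A).
Implicit Types (S T V C D : endo X) (c t : R).

Definition esc c : endo X := c%:C *: (1 : endo X).

Lemma escE c T : esc c * T = c%:C *: T.
Proof. by rewrite /esc ezAl mul1r. Qed.
Lemma escEr c T : T * esc c = c%:C *: T.
Proof. by rewrite /esc ezAr mulr1. Qed.
Lemma escD c t : esc (c + t) = esc c + esc t.
Proof. by rewrite /esc rmorphD scalerDl. Qed.
Lemma escN c : esc (- c) = - esc c.
Proof. by rewrite /esc rmorphN scaleNr. Qed.
Lemma escB c t : esc (c - t) = esc c - esc t.
Proof. by rewrite escD escN. Qed.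
Lemma esc1 : esc 1 = 1.
Proof. by rewrite /esc scale1r. Qed.
Lemma esc_bop c : 0 <= c -> bop (esc c) c.
Proof. by move=> c0; have := @ebopC R A X c; rewrite ger0_norm. Qed.
Lemma esc_sa c : sa (esc c).
Proof. exact/saZ. Qed.
Lemma ebopZp S c k : 0 <= c -> bop S k -> bop (c%:C *: S) (c * k).
Proof. by move=> c0 Sk; have := ebopZ c Sk; rewrite ger0_norm. Qed.

Lemma unitary_endo T V c : 0 <= c -> sa T -> sa V -> T * V = V * T ->
  T * T + V * V = esc (c ^+ 2) -> bop T c.
Proof.
move=> c0 hT hV TV h; apply: (unitary_bound c0 hT hV) => x.
  by rewrite -emulE TV.
by rewrite -!emulE -eaddE h.
Qed.

(* Positivity in a form that does not mention spectra. *)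
Definition pos T := sa T /\ exists2 t, 0 < t & bop (esc t - T) t.

(** V = 1 - k with 2k = w + k^2, whence V^2 = 1 - 2k + k^2 = 1 - w. Whatever commutes with w
    commutes with every iterate, hence with V. *)
Lemma root_sub1 w : sa w -> bop w 1 ->
  exists2 V, sa V /\ bop (1 - V) 1 & V * V = 1 - w /\
    forall T, T * w = w * T -> T * V = V * T.
Proof.
move=> hw w1; have [k [ksa k1 kk kP]] := kseq_cvg hw w1.
exists (1 - k); first by split; [apply: saB => //;
  exact: sa1|rewrite opprB addrC subrK].
split.
  rewrite mulrBr mulr1 mulrBl mul1r.
  have -> : 1 - k - (k - k * k) = 1 - (k + k) + k * k by zmod_eq.
  by rewrite kk; zmod_eq.
move=> T Tw; have [b _ Tb] := endo_bounded T.
rewrite mulrBl mulrBr mul1r mulr1; congr (_ - _); apply: endo_eq => x.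
apply: (kseq_intertwine (endo_lin T) Tb _ kP kP) => y.
by rewrite -!emulE Tw.
Qed.

(** With V the root of 1 - S^2, the operator V + iS is unitary, so V and V^2 = 1 - S^2 are
    contractions. *)
Lemma bop1_sub_sqr S : sa S -> bop S 1 -> bop (1 - S * S) 1.
Proof.
move=> hS S1; have hSS : sa (S * S) by apply: saM.
have [|V [hV _] [VV comV]] := root_sub1 hSS.
  by rewrite -[1]mulr1; exact: ebopM.
have V1 : bop V 1.
  apply: (unitary_endo ler01 hV hS); first by rewrite comV// mulrA.
  by rewrite VV subrK expr1n esc1.
by rewrite -VV -[1 : R]mulr1; apply: ebopM.
Qed.

Lemma pos_root T : pos T ->
  exists2 S, sa S & S * S = T /\ forall V, V * T = T * V -> V * S = S * V.
Proof.
move=> [hT [t t0 Tt]]; pose w := (t^-1)%:C *: (esc t - T).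
have tV : t^-1 * t = 1 by rewrite mulVf// gt_eqF.
have hw : sa w by apply/saZ/saB => //; exact: esc_sa.
have w1 : bop w 1 by have := ebopZp (ltW (_ : 0 < t^-1)) Tt; rewrite tV invr_gt0; apply.
have [V [hV _] [VV comV]] := root_sub1 hw w1.
have e : T = t%:C *: (1 - w).
  rewrite scalerBr scalerA -rmorphM mulfV ?gt_eqF// scale1r -/(esc t).
  by zmod_eq.
exists ((Num.sqrt t)%:C *: V); first exact: saZ.
split; first by rewrite ezAl ezAr VV scalerA -rmorphM -expr2 sqr_sqrtr ?ltW.
move=> U UT; rewrite ezAl ezAr comV// /w ezAl ezAr; congr (_ *: _).
by rewrite mulrBl mulrBr escE escEr UT.
Qed.

Lemma pos_sqr S : sa S -> pos (S * S).
Proof.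
move=> hS; split; first exact: saM.
have [b b1 Sb] := endo_bounded S; have b0 : 0 < b by lra.
exists (b ^+ 2); first by rewrite exprn_gt0.
have S1 : bop ((b^-1)%:C *: S) 1.
  by have := ebopZp (ltW (_ : 0 < b^-1)) Sb; rewrite invr_gt0 mulVf ?gt_eqF//; apply.
have := ebopZp (sqr_ge0 b) (bop1_sub_sqr (saZ (b^-1) hS) S1).
rewrite mulr1 scalerBr ezAl ezAr !scalerA -!rmorphM.
have -> : b ^+ 2 * (b^-1 * b^-1) = 1 by field; rewrite gt_eqF.
by rewrite scale1r.
Qed.

Lemma posD S T : pos S -> pos T -> pos (S + T).
Proof.
move=> [hS [s s0 Ss]] [hT [t t0 Tt]]; split; first exact: saD.
exists (s + t); first exact: addr_gt0.
by have := ebopD Ss Tt; rewrite escD; congr bop; congr eop; zmod_eq.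
Qed.

Lemma posZ c T : 0 < c -> pos T -> pos (c%:C *: T).
Proof.
move=> c0 [hT [t t0 Tt]]; split; first exact: saZ.
exists (c * t); first exact: mulr_gt0.
by have := ebopZp (ltW c0) Tt; rewrite scalerBr {1}/esc scalerA -rmorphM.
Qed.

Lemma pos0 : pos 0.
Proof.
by split; [exact: sa0|exists 1 => //; rewrite subr0; exact: esc_bop].
Qed.

(** The roots S of T and V of c - T commute and satisfy S^2 + V^2 = c, so S + iV is sqrt c times a
    unitary. This turns order bounds into norm bounds. *)
Lemma pos_bop T c : 0 <= c -> pos T -> pos (esc c - T) -> bop T c.
Proof.
move=> c0 /pos_root[S hS [SS comS]] /pos_root[V hV [VV comV]].
have Sc : bop S (Num.sqrt c).
  apply: (unitary_endo (sqrtr_ge0 _) hS hV).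
    by apply: comV; rewrite mulrBr mulrBl escE escEr -SS mulrA.
  by rewrite SS VV sqr_sqrtr// addrC subrK.
by rewrite -SS -(sqr_sqrtr c0) expr2; apply: ebopM => //; exact: sqrtr_ge0.
Qed.

Lemma sa_pos T t : sa T -> bop T t -> pos (esc t - T).
Proof.
move=> hT Tt; split; first by apply: saB => //; exact: esc_sa.
(* Nothing is known of the sign of [t], while the witness of [pos] must be positive. *)
exists (`|t| + 1); first by rewrite ltr_wpDl.
have -> : esc (`|t| + 1) - (esc t - T) = esc (`|t| - t + 1) + T.
  by rewrite !escD escN; zmod_eq.
have t0 := ler_norm t.
apply: bop_le (ebopD (esc_bop _) Tt); last by lra.
by lra.
Qed.

(** T + iV is c times a unitary for V the root of c^2 - T^2. The usual proof by Cauchy-Schwarz has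
    to wait for the positivity theory. *)
Lemma bop_sqr T c : 0 <= c -> sa T -> bop (T * T) (c ^+ 2) -> bop T c.
Proof.
move=> c0 hT /(sa_pos (saM hT hT erefl))/pos_root[V hV [VV comV]].
apply: (unitary_endo c0 hT hV).
  by apply: comV; rewrite mulrBr mulrBl escE escEr mulrA.
by rewrite VV addrC subrK.
Qed.

Lemma bop_pow2 T m : sa T -> bop (T ^+ (2 ^ m)) 1 -> bop T 1.
Proof.
move=> hT; elim: m => [|m IH]; first by rewrite expn0 expr1.
move=> h; apply: IH; apply: bop_sqr => //; first exact: saX.
by rewrite expr1n -exprD addnn -mul2n -expnS.
Qed.

(** This takes the place of the spectral radius formula: after division by 1 + e some power 2^m is a
    contraction, by Bernoulli's inequality, and square roots are taken m times. *)
Lemma bop_pow_bounded T K : sa T -> (forall n, bop (T ^+ n) K) -> bop T 1.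
Proof.
move=> hT h; apply: bop_inf => e e0; have r0 : 0 < 1 + e by lra.
have [m hm] : exists m, K <= (1 + e) ^+ (2 ^ m).
  have [n hn] : exists n : nat, `|K| / e <= n%:R.
    exists (Num.truncn (`|K| / e)).+1; rewrite ltW//.
    by rewrite truncnS_gt.
  exists n; apply: le_trans (ler_norm _) _.
  move: hn; rewrite ler_pdivrMr// => /le_trans -> //.
  have bern k : 1 + k%:R * e <= (1 + e) ^+ k.
    elim: k => [|k IH]; first by rewrite mul0r addr0 expr0.
    rewrite exprSr -natr1; have : (1 + k%:R * e) * (1 + e) <= (1 + e) ^+ k * (1 + e).
      by rewrite ler_pM2r.
    have : 0 <= k%:R * e * e by rewrite !mulr_ge0// ltW.
    by lra.
  have := bern (2 ^ n)%N; have : (n%:R : R) * e <= (2 ^ n)%:R * e.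
    by rewrite ler_pM2r// ler_nat ltnW// ltn_expl.
  by lra.
pose S := ((1 + e)^-1)%:C *: T.
have -> : T = (1 + e)%:C *: S.
  by rewrite /S scalerA -rmorphM mulfV ?gt_eqF// scale1r.
rewrite -[1 + e]mulr1 {1}mulr1; apply: ebopZp; first exact: ltW.
apply: (bop_pow2 (m := m)); first exact: saZ.
have -> : S ^+ (2 ^ m) = ((1 + e) ^- (2 ^ m))%:C *: T ^+ (2 ^ m).
  elim: (2 ^ m)%N => [|k IH]; first by rewrite !expr0 invr1 scale1r.
  by rewrite !exprS IH /S ezAl ezAr scalerA -rmorphM invfM.
have i0 : 0 <= (1 + e) ^- (2 ^ m) by rewrite invr_ge0 exprn_ge0// ltW.
apply: bop_le (ebopZp i0 (h _)).
by rewrite mulrC ler_pdivrMr ?exprn_gt0// mul1r.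
Qed.

(** With D' the adjoint, the sum is half of (D + D')^2 + (i(D - D'))^2, a sum of squares of
    self-adjoint operators. *)
Lemma pos_symm D D' : adjoint_pair D D' -> pos (D' * D + D * D').
Proof.
move=> hD; have hD' := adjoint_sym hD.
have sa1 : sa (D + D').
  by move=> x y; rewrite !eaddE innerDl innerDr hD hD' addrC.
have sa2 : sa ('i *: (D - D')).
  move=> x y; rewrite !escaleE innerZl innerZr -[Num.conj 'i]/('i^*)%C conjci.
  by rewrite !eaddE !eoppE innerBl innerBr hD hD' scaleNr -scalerN opprB.
have ii : 'i * 'i = -1 :> R[i] by rewrite -expr2 sqr_i.
have := posZ (_ : 0 < 2^-1) (posD (pos_sqr sa1) (pos_sqr sa2)).
rewrite invr_gt0 ltr0n => /(_ isT); congr pos.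
rewrite ezAl ezAr scalerA ii scaleN1r -[RHS](half_add).
congr (_ *: _); rewrite !mulrDr !mulrDl !mulrN !mulNr; zmod_eq.
Qed.

End Positive.

Section KelleyVaught.
Variables (R : realType) (A : cstarAlgType R) (X : hilbertModType A).
Implicit Types (C D : endo X).

(* With u = 1 - C*C = s^2, v = 1 - CC* and D = C s^n one has
   D*D + DD* = (u^n - u^(n+1)) + (v^n - v^(n+1)), which is positive; summing
   over n bounds all powers of u, hence u itself. *)
Lemma pos_adj_mul_contr C C' : adjoint_pair C C' -> bop C 1 -> bop C' 1 ->
  pos (C' * C).
Proof.
move=> hC C1 C'1; have hC' := adjoint_sym hC.
have saP D D' : adjoint_pair D D' -> sa (D' * D).
  by move=> hD x y; rewrite !emulE (adjoint_sym hD) hD.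
have bP D D' : bop D 1 -> bop D' 1 -> bop (D' * D) 1.
  by move=> D1 D'1; rewrite -[1 : R]mulr1; apply: ebopM.
have [s [hs _] [ss coms]] := root_sub1 (saP _ _ hC) (bP _ _ C1 C'1).
have [r [hr _] [rr _]] := root_sub1 (saP _ _ hC') (bP _ _ C'1 C1).
set u := 1 - C' * C in ss; set v := 1 - C * C' in rr.
have su : s * u = u * s by rewrite -ss mulrA.
have Cu n : C * u ^+ n = v ^+ n * C.
  elim: n => [|n IH]; first by rewrite !expr0 mulr1 mul1r.
  rewrite !exprSr mulrA IH -!mulrA; congr (_ * _).
  by rewrite /u /v mulrBr mulrBl mulr1 mul1r mulrA.
have sC n : s ^+ n * (C' * C) = C' * C * s ^+ n.
  by apply/esym/commrX; rewrite /GRing.comm coms.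
have hD n : adjoint_pair (C * s ^+ n) (s ^+ n * C').
  by move=> x y; rewrite !emulE hC (saX n hs).
have ssn n : s ^+ n * s ^+ n = u ^+ n by rewrite -ss exprMn_comm.
have telescope n : pos (1 + 1 - (u ^+ n + v ^+ n)).
  elim: n => [|n IH]; first by rewrite !expr0 subrr; exact: pos0.
  have := posD IH (pos_symm (hD n)); congr pos.
  have -> : s ^+ n * C' * (C * s ^+ n) = u ^+ n - u ^+ n.+1.
    rewrite -mulrA [C' * _]mulrA -sC mulrA ssn exprSr /u [in RHS]mulrBr mulr1.
    by rewrite opprB addrCA subrr addr0.
  have -> : C * s ^+ n * (s ^+ n * C') = v ^+ n - v ^+ n.+1.
    rewrite -mulrA [s ^+ n * (_ * _)]mulrA ssn mulrA Cu -mulrA exprSr /v.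
    by rewrite [in RHS]mulrBr mulr1 opprB addrCA subrr addr0.
  by zmod_eq.
have posu n : pos (u ^+ n) by rewrite -ssn; apply/pos_sqr/saX.
have posv n : pos (v ^+ n).
  have -> : v ^+ n = r ^+ n * r ^+ n by rewrite -rr exprMn_comm.
  exact/pos_sqr/saX.
have hu : sa u by have [] := posu 1%N; rewrite expr1.
split; first exact: saP.
(* The 2 is the value of u^0 + v^0: telescoping gives u^n + v^n <= 2, and v^n is positive. *)
exists 1 => //; rewrite esc1; apply: (bop_pow_bounded (K := 2)) => // n.
apply: pos_bop => //; have := posD (telescope n) (posv n); congr pos.
by rewrite (natrD R 1 1) escD esc1; zmod_eq.
Qed.

Lemma pos_adj_mul C C' : adjoint_pair C C' -> pos (C' * C).
Proof.
move=> hC; have [b b1 Cb] := endo_bounded C; have [c c1 Cc] := endo_bounded C'.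
(* One common scale for C and its adjoint, as equality of their norms is available only after
   Cauchy-Schwarz. *)
pose d := b + c; have d0 : 0 < d by rewrite /d; lra.
have dV : 0 < d^-1 by rewrite invr_gt0.
have dd : d^-1 * d = 1 by rewrite mulVf ?gt_eqF.
have := posZ (exprn_gt0 2 d0)
  (@pos_adj_mul_contr ((d^-1)%:C *: C) ((d^-1)%:C *: C') _ _ _).
rewrite ezAl ezAr !scalerA -!rmorphM.
have -> : d ^+ 2 * (d^-1 * d^-1) = 1 by field; rewrite gt_eqF.
rewrite scale1r; apply.
- by move=> x y; rewrite !escaleE innerZlr innerZr hC.
- by rewrite -dd; apply: ebopZp (ltW dV) _; apply: bop_le Cb; rewrite /d; lra.
- by rewrite -dd; apply: ebopZp (ltW dV) _; apply: bop_le Cc; rewrite /d; lra.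
Qed.

End KelleyVaught.

(** * Order and norm in a C*-algebra *)

Section Multiplier.
Variables (R : realType) (A : cstarAlgType R).
Implicit Types a b c : A.

Lemma inner_self a b : @inner R A (self_module A) a b = star a ** b.
Proof. by []. Qed.
Lemma ract_self a b : @ract R A (self_module A) a b = a ** b.
Proof. by []. Qed.

Let lfun a : self_module A -> self_module A := fun b => (a ** b : A).

Lemma lfun_adj a : adjoint_pair (lfun a) (lfun (star a)).
Proof. by move=> x y; rewrite !inner_self starM cmulA. Qed.

Lemma lfun_adjointable a : adjointable (lfun a).
Proof.
exists (lfun (star a)); split; first exact: lfun_adj.
  by exists (nrm a) => x; exact: nrm_cmul.
by exists (nrm (star a)) => x; exact: nrm_cmul.
Qed.

(** The left regular representation places A in a unital ring, so that operator results apply to its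
    elements. *)
Definition lmul a : endo (self_module A)
  := Endo (introT (asboolP _) (lfun_adjointable a)).

Lemma lmulE a b : lmul a b = a ** b. Proof. by []. Qed.
Lemma lmul_adj a : adjoint_pair (lmul a) (lmul (star a)).
Proof. exact: lfun_adj. Qed.
Lemma lmulD a b : lmul (a + b) = lmul a + lmul b.
Proof. by apply: endo_eq => x; rewrite eaddE !lmulE cmulDl. Qed.
Lemma lmulM a b : lmul (a ** b) = lmul a * lmul b.
Proof. by apply: endo_eq => x; rewrite emulE !lmulE cmulA. Qed.
Lemma lmulZ k a : lmul (k *: a) = k *: lmul a.
Proof. by apply: endo_eq => x; rewrite escaleE !lmulE cmulZl. Qed.
Lemma lmulN a : lmul (- a) = - lmul a.
Proof. by apply: endo_eq => x; rewrite eoppE !lmulE cmulNl. Qed.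
Lemma lmulB a b : lmul (a - b) = lmul a - lmul b.
Proof. by rewrite lmulD lmulN. Qed.
Lemma lmul_bop a : bop (lmul a) (nrm a).
Proof. by move=> x; exact: nrm_cmul. Qed.
Lemma lmul_sa a : star a = a -> sa (lmul a).
Proof. by move=> h; rewrite /sa -[in X in adjoint_pair _ X]h; exact: lmul_adj. Qed.

(** Testing on [star a] recovers the norm of [a], by the C*-identity; with [lmul_bop], [lmul] is
    isometric. *)
Lemma bop_lmul a k : 0 <= k -> bop (lmul a) k -> nrm a <= k.
Proof.
move=> k0 ak; have [->|a0] := eqVneq (nrm a) 0; first by [].
have ap : 0 < nrm a by rewrite lt_def a0 nrm_ge0.
rewrite -(ler_pM2r ap) -expr2 -nrm_mul_star.
by have := ak (star a : A); rewrite [nrm (star a : self_module A)](nrm_star a).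
Qed.

Lemma cstar_pos_star a : cstar_pos a -> star a = a.
Proof. by case=> c ->; rewrite starM starK. Qed.

Lemma cstar_pos_lmul a : cstar_pos a -> pos (lmul a).
Proof. by case=> c ->; rewrite lmulM; apply: pos_adj_mul; exact: lmul_adj. Qed.

(** With s the sum, |s| - a = (|s| - s) + b + c is positive, so [pos_bop] applies. Three summands
    are what Cauchy-Schwarz produces. *)
Lemma nrm_pos_le a b c : cstar_pos a -> cstar_pos b -> cstar_pos c ->
  nrm a <= nrm (a + b + c).
Proof.
move=> ha hb hc; set s := a + b + c.
have hs : star s = s by rewrite /s !starD !cstar_pos_star.
apply: bop_lmul (nrm_ge0 _) _; apply: pos_bop (nrm_ge0 _) (cstar_pos_lmul ha) _.
have := posD (posD (sa_pos (lmul_sa hs) (lmul_bop s))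
   (cstar_pos_lmul hb)) (cstar_pos_lmul hc).
by congr pos; rewrite /s !lmulD; zmod_eq.
Qed.

(** For V^2 = 1 - a the element is the inner product of [V b] with itself. V is only an operator on
    A, but [V b] lies in A. *)
Lemma cstar_pos_sub1 a b : cstar_pos a -> nrm a <= 1 ->
  cstar_pos (star b ** b - star b ** a ** b).
Proof.
move=> ha a1.
have [V [hV _] [VV _]] := root_sub1 (lmul_sa (cstar_pos_star ha))
  (bop_le a1 (lmul_bop a)).
exists (V b); have := hV b (V b); rewrite inner_self => ->.
by rewrite inner_self -emulE VV eaddE eoppE lmulE cmulBr cmulA.
Qed.

End Multiplier.

Section CauchySchwarz.
Variables (R : realType) (A : cstarAlgType R) (X : hilbertModType A).
Implicit Types x y z : X.

(** For |u| <= 1 and a = <u,v>, <v,v> is the sum of three positive terms: the square of a, its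
    defect a^* (1 - <u,u>) a, and <ua - v, ua - v>. So the first is no larger in norm. *)
Lemma cauchy_schwarz x y : nrm (inner x y) <= nrm x * nrm y.
Proof.
have main (u v : X) : nrm u <= 1 -> nrm (inner u v) <= nrm v.
  move=> u1; set a := inner u v.
  rewrite -(@ler_pXn2r _ 2)// ?nnegrE ?nrm_ge0// -nrm_star_mul -nrm_inner.
  have -> : inner v v = star a ** a + (star a ** a - star a ** inner u u ** a)
      + inner (u *< a - v) (u *< a - v).
    rewrite !(innerBl, innerBr, inner_ract, inner_ractl) -[inner v u]inner_star.
    by rewrite -/a; zmod_eq.
  apply: nrm_pos_le; first by exists a.
    by apply: cstar_pos_sub1 (inner_pos _) _; rewrite nrm_inner exprn_ile1// nrm_ge0.
  exact: inner_pos.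
have [x0|x0] := eqVneq (nrm x) 0.
  by rewrite (nrm_eq0 x0) inner0l !nrm0 mul0r.
have xp : 0 < nrm x by rewrite lt_def x0 nrm_ge0.
have := main ((nrm x)^-1%:C *: x) y.
rewrite innerZlr !nrmZr ger0_norm ?invr_ge0 ?nrm_ge0// mulVf// => /(_ (lexx _)).
by rewrite ler_pdivrMl.
Qed.

Lemma adjoint_bop (T T' : X -> X) k : 0 <= k ->
  adjoint_pair T T' -> bop T k -> bop T' k.
Proof.
move=> k0 h Tk y; have [y0|y0] := eqVneq (nrm (T' y)) 0.
  by rewrite y0 mulr_ge0 ?nrm_ge0.
have yp : 0 < nrm (T' y) by rewrite lt_def y0 nrm_ge0.
rewrite -(ler_pM2r yp) -expr2 -nrm_inner -h mulrAC.
by rewrite (le_trans (cauchy_schwarz _ _))// ler_wpM2r ?nrm_ge0.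
Qed.

(* <z,z> - <Uz,Uz> = a*a + a*(1 - <x,x>)a for U = 1 - theta x x, a = <x,z>. *)
Lemma sub_theta_bop x : nrm x <= 1 -> bop (fun z => z - theta x x z) 1.
Proof.
move=> x1 z; rewrite mul1r /theta; set a := inner x z; set p := inner x x.
have p1 : nrm p <= 1 by rewrite nrm_inner exprn_ile1// nrm_ge0.
rewrite -(@ler_pXn2r _ 2)// ?nnegrE ?nrm_ge0// -!nrm_inner.
have -> : inner z z = inner (z - x *< a) (z - x *< a) + star a ** a
    + (star a ** a - star a ** p ** a).
  rewrite !(innerBl, innerBr, inner_ract, inner_ractl) -[inner z x]inner_star.
  by rewrite -/a -/p cmulBr ?cmulA; zmod_eq.
apply: nrm_pos_le; [exact: inner_pos|by exists a|].
exact: cstar_pos_sub1 (inner_pos _) _.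
Qed.

End CauchySchwarz.

(** * Contractive actions and isometric homomorphisms *)

Section Actions.
Variables (R : realType).

Lemma lmul_inj (A : cstarAlgType R) : injective (@lmul R A).
Proof.
move=> a b h; apply/eqP; rewrite -subr_eq0; apply/eqP/nrm_eq0/eqP.
rewrite eq_le nrm_ge0 andbT; apply: bop_lmul => //.
by rewrite lmulB h subrr; exact: bop0.
Qed.

(** The square root iteration starts at 0 and so stays in A; its limit is an element and not merely
    a multiplier. *)
Fixpoint eseq (A : cstarAlgType R) (w : A) n : A :=
  if n is m.+1 then (2^-1)%:C *: (w + eseq w m ** eseq w m) else 0.

Lemma kseq_lmul (A : cstarAlgType R) (w : A) n : kseq (lmul w) n = lmul (eseq w n).
Proof.
elim: n => [|n IH] /=; last by rewrite IH lmulZ lmulD lmulM.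
by apply: endo_eq => x; rewrite lmulE cmul0l.
Qed.

(* (1 - k)^2 = 1 - h^2 in the unitisation. *)
Lemma elt_root (A : cstarAlgType R) (h : A) : star h = h -> nrm h <= 1 ->
  exists k, [/\ star k = k, k + k = h ** h + k ** k & h ** k = k ** h].
Proof.
move=> hs h1; pose w := h ** h.
have sw : sa (lmul w) by apply: lmul_sa; rewrite /w starM hs.
have bw : bop (lmul w) 1.
  apply: bop_le (lmul_bop w); rewrite (le_trans (nrm_cmul _ _))//.
  by rewrite mulr_ile1 ?nrm_ge0.
have [K [Ksa K1 KK KP]] := kseq_cvg sw bw.
have d0 n : 0 <= kinf R - kap R n by rewrite subr_ge0 kap_le.
have [|e /kap_cvg//|k kP] := @lim_exists R A (eseq w) (fun n => kinf R - kap R n).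
  move=> n m nm; apply: bop_lmul => //; rewrite lmulB -!kseq_lmul.
  by apply: bop_le (kseq_dist bw nm); rewrite lerD2r kap_le.
have E : K = lmul k.
  apply: endo_eq => x; apply/eqP; rewrite -subr_eq0; apply/eqP.
  apply: (nrm_smallM (C := 2 * nrm x)) => e e0; have [N hN] := kap_cvg e0.
  have -> : K x - lmul k x = (K - kseq (lmul w) N) x - lmul (k - eseq w N) x.
    by rewrite lmulB kseq_lmul !eaddE !eoppE; zmod_eq.
  have h2 := KP N x; have h3 := lmul_bop (k - eseq w N) x; have h4 := kP N.
  apply: le_trans (nrmB _ _) _; have n0 := nrm_ge0 x.
  have : (kinf R - kap R N) * nrm x <= e * nrm x by rewrite ler_wpM2r.
  have : nrm (k - eseq w N) * nrm x <= e * nrm x.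
    by rewrite ler_wpM2r// (le_trans h4).
  by lra.
exists k; split.
- apply: lmul_inj; apply: val_inj;
  have h2 : adjoint_pair (lmul k) (lmul k) by rewrite -E; exact: Ksa.
  exact: adjoint_uniq (lmul_adj k) h2.
- by apply: lmul_inj; rewrite !lmulD (lmulM k) -E KK.
- apply: lmul_inj; rewrite !lmulM -E; apply: endo_eq => x.
  apply: (kseq_intertwine (endo_lin (lmul h)) (lmul_bop h) _ KP KP) => y.
  by rewrite -!emulE -!lmulM /w cmulA.
Qed.

Section LeftAction.
Variables (A B : cstarAlgType R) (X : hilbertModType A) (psi : B -> X -> X).
Hypothesis act : left_action psi.

Lemma actD b c x : psi (b + c) x = psi b x + psi c x.
Proof. by have := left_action_linear act 1 b c; rewrite !scale1r => ->. Qed.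
Lemma act_lin : linear psi. Proof. exact: left_action_linear act. Qed.
Lemma actZ k b x : psi (k *: b) x = k *: psi b x.
Proof. by rewrite (linZ act_lin). Qed.
Lemma actM b c x : psi (b ** c) x = psi b (psi c x).
Proof. by rewrite (left_action_mul act). Qed.
Lemma act_adj b : adjoint_pair (psi b) (psi (star b)).
Proof. exact: left_action_adj. Qed.
Lemma act_linx b : linear (psi b). Proof. exact: adjoint_lin (act_adj b). Qed.
Lemma act_ract b x a : psi b (x *< a) = psi b x *< a.
Proof. exact: adjoint_ract (act_adj b). Qed.

(** The relations of [elt_root] are algebraic and survive [psi]: they make psi(h) + i(1 - psi(k))
    unitary. *)
Lemma act_bop_sa h : star h = h -> nrm h <= 1 -> bop (psi h) 1.
Proof.
move=> hs h1; have [k [ks kk hk]] := elt_root hs h1.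
have hh : adjoint_pair (psi h) (psi h)
  by rewrite -[in X in adjoint_pair _ X]hs; exact: act_adj.
have hk' : adjoint_pair (psi k) (psi k)
  by rewrite -[in X in adjoint_pair _ X]ks; exact: act_adj.
apply: (unitary_bound (V := fun x => x - psi k x)) => //.
- by move=> x y; rewrite innerBl innerBr hk'.
- by move=> x; rewrite (linB (act_linx h)) -!actM hk.
move=> x; rewrite expr1n scale1r (linB (act_linx k)) -!actM.
have : psi (k + k) x = psi (h ** h + k ** k) x by rewrite kk.
rewrite !actD => e.
transitivity (psi (h ** h) x + psi (k ** k) x + x - (psi k x + psi k x)).
  by zmod_eq.
by rewrite e; zmod_eq.
Qed.

(** Since |psi(b)x|^2 = |<x, psi(b^* b)x>|, the self-adjoint case is enough. Applied to
    [star_hom_action], this also makes homomorphisms contractive. *)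
Lemma act_bop b : bop (psi b) (nrm b).
Proof.
have sab h : star h = h -> bop (psi h) (nrm h).
  move=> hs; have [h0|h0] := eqVneq (nrm h) 0.
    by rewrite (nrm_eq0 h0) nrm0 (lin0 act_lin); exact: bop0.
  have hp : 0 < nrm h by rewrite lt_def h0 nrm_ge0.
  have := @act_bop_sa ((nrm h)^-1%:C *: h).
  rewrite starZr hs nrmZr ger0_norm ?invr_ge0 ?nrm_ge0// mulVf// => /(_ erefl (lexx _)).
  move=> h1 x; have := h1 x; rewrite actZ nrmZr ger0_norm ?invr_ge0 ?nrm_ge0//.
  by rewrite ler_pdivrMl// mul1r.
move=> x; rewrite -(@ler_pXn2r _ 2)// ?nnegrE ?mulr_ge0 ?nrm_ge0//.
rewrite -nrm_inner act_adj -actM exprMn (le_trans (cauchy_schwarz _ _))//.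
rewrite mulrC [nrm x ^+ 2]expr2 mulrA ler_wpM2r ?nrm_ge0//.
by rewrite -nrm_star_mul; apply: sab; rewrite starM starK.
Qed.

End LeftAction.

Lemma star_hom_action (A B : cstarAlgType R) (f : A -> B) : star_hom f ->
  @left_action R B A (self_module B) (fun a b => f a ** (b : B)).
Proof.
move=> [lf fM fS]; split=> [k b c|b c|b x y].
- by apply/funext => x; rewrite lf cmulDl cmulZl.
- by apply/funext => x /=; rewrite fM cmulA.
- by rewrite !inner_self starM fS cmulA.
Qed.

Lemma star_hom_contr (A B : cstarAlgType R) (f : A -> B) a :
  star_hom f -> nrm (f a) <= nrm a.
Proof.
move=> hf; apply: bop_lmul (nrm_ge0 _) _ => x.
exact: (act_bop (star_hom_action hf)).
Qed.

(* With a = h^2, the element 1 - f(a) is positive, so it is the positive root of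
   its square; hence f maps the positive root of (1 - a)^2 and 1 - a to the same
   element. By injectivity 1 - a is that root, and so is positive. *)
Lemma star_hom_inj_unit_ball (A B : cstarAlgType R) (f : A -> B) h :
  star_hom f -> injective f -> star h = h -> nrm (f h) < 1 -> nrm h <= 1.
Proof.
move=> hf finj hs fh1; pose a := h ** h.
have [lf fM fS] := hf.
have as_ : star a = a by rewrite /a starM hs.
have fas : star (f a) = f a by rewrite -fS as_.
have fan : nrm (f a) < 1.
  rewrite /a fM -{1}hs fS nrm_star_mul.
  by rewrite exprn_ilt1// nrm_ge0.
pose s := 1 + nrm a; have s1 : 1 <= s by rewrite lerDl nrm_ge0.
have s0 : 0 < s by lra.
have sV : 0 < s^-1 by rewrite invr_gt0.
pose v := (s^-1)%:C *: (1 - lmul a) : endo (self_module A).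
pose v' := (s^-1)%:C *: (1 - lmul (f a)) : endo (self_module B).
have hv : sa v by apply/saZ/saB; [exact: sa1|exact: lmul_sa].
have hv' : sa v' by apply/saZ/saB; [exact: sa1|exact: lmul_sa].
have v1 : bop v 1.
  have := ebopZp (ltW sV) (ebopB (@ebop1 _ _ _) (lmul_bop a)).
  by rewrite -/s mulVf ?gt_eqF.
have v'1 : bop v' 1.
  have := ebopZp (ltW sV) (ebopB (@ebop1 _ _ _) (lmul_bop (f a))).
  apply: bop_le; rewrite ler_pdivrMl// mulr1.
  by rewrite lerD2l; exact: star_hom_contr.
have [k [_ k1 kk kP]] := kseq_cvg (saB (@sa1 _ _ _) (saM hv hv erefl))
  (bop1_sub_sqr hv v1).
have [k' [_ k'1 kk' kP']] := kseq_cvg (saB (@sa1 _ _ _) (saM hv' hv' erefl))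
  (bop1_sub_sqr hv' v'1).
have fv x : f (v x) = v' (f x).
  by rewrite !escaleE !eaddE !eoppE !lmulE !eoneE (linZ lf) (linB lf) fM.
have fk x : f (k x) = k' (f x).
  apply: (@kseq_intertwine _ _ _ (self_module A) (self_module B) _ _ _ _ f 1
    lf _ _ kP kP').
    by move=> y; rewrite mul1r; exact: star_hom_contr.
  by move=> y; rewrite !eaddE !eoppE !emulE !eoneE (linB lf) !fv.
have vk' : v' * k' = k' * v'.
  apply: endo_eq => x; rewrite !emulE.
  apply: (kseq_intertwine (endo_lin v') v'1 _ kP' kP') => y.
  by rewrite !eaddE !eoppE !emulE !eoneE (linB (endo_lin v')).
(* From (1 - k')^2 = v'^2 one gets 2D = (k' + (1 - v')) D. Here k' has norm at most 1 and 1 - v'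
   norm strictly less than 1, so D vanishes. *)
pose D := 1 - k' - v'.
have D0 x : D x = 0.
  have DE : D + D = (k' + (1 - v')) * D.
    apply/eqP; rewrite -subr_eq0; apply/eqP.
    transitivity (1 - (k' + k') + k' * k' - v' * v').
      rewrite /D !(mulrBr, mulrBl, mulrDl, mulrDr, mulr1, mul1r) vk'; zmod_eq.
    by rewrite kk'; zmod_eq.
  have q1 : bop (1 - v') (1 - s^-1 * (1 - nrm (f a))).
    have -> : 1 - v' = esc (self_module B) (1 - s^-1) + (s^-1)%:C *: lmul (f a).
      by rewrite /v' scalerBr escB esc1 /esc; zmod_eq.
    have s11 : 0 <= 1 - s^-1 by rewrite subr_ge0 invf_le1.
    have := ebopD (@esc_bop _ _ (self_module B) _ s11) (ebopZp (ltW sV)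
      (lmul_bop (f a))).
    by apply: bop_le; lra.
  have := ebopD k'1 q1 (D x); rewrite -emulE -DE eaddE -scale2 nrmZr ger0_norm// => h2.
  apply: nrm_eq0; apply/eqP; rewrite eq_le nrm_ge0 andbT.
  have c0 : 0 < s^-1 * (1 - nrm (f a)) by rewrite mulr_gt0// subr_gt0.
  rewrite -(pmulr_rle0 _ c0); lra.
have kv : 1 - k = v.
  apply: endo_eq => x; apply: finj; rewrite fv eaddE eoppE eoneE (linB lf) fk.
  by have := D0 (f x); rewrite /D !eaddE !eoppE eoneE => /eqP; rewrite subr_eq0 => /eqP.
have pv : pos v.
  split=> //; exists 1 => //; rewrite esc1 -kv opprB addrC subrK//.
have pa : pos (lmul a) by apply: cstar_pos_lmul; exists h; rewrite hs.
have : bop (lmul a) 1.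
  apply: pos_bop => //; have := posZ s0 pv; congr pos.
  by rewrite /v scalerA -rmorphM mulfV ?gt_eqF// scale1r esc1.
move=> /(bop_lmul ler01); rewrite /a -[X in X ** _]hs nrm_star_mul.
by rewrite expr_le1// nrm_ge0.
Qed.

(** By the C*-identity it is enough to treat h = a^* a. Division by |f(h)| + e supplies the strict
    inequality that [star_hom_inj_unit_ball] asks for. *)
Lemma star_hom_isom (A B : cstarAlgType R) (f : A -> B) a :
  star_hom f -> injective f -> nrm (f a) = nrm a.
Proof.
move=> hf finj; have [lf fM fS] := hf.
apply/eqP; rewrite eq_le star_hom_contr//=.
rewrite -(@ler_pXn2r _ 2)// ?nnegrE ?nrm_ge0// -!nrm_star_mul -fS -fM.
set h := star a ** a; have hs : star h = h by rewrite /h starM starK.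
apply/ler_addgt0Pr => e e0; have r0 : 0 < nrm (f h) + e by rewrite ltr_wpDl ?nrm_ge0.
have rV : 0 <= (nrm (f h) + e)^-1 by rewrite invr_ge0 ltW.
have := @star_hom_inj_unit_ball _ _ f ((nrm (f h) + e)^-1%:C *: h) hf finj.
rewrite starZr hs (linZ lf) !nrmZr !ger0_norm// => /(_ erefl).
by rewrite !ler_pdivrMl// ltr_pdivrMl// mulr1 ltrDl; apply.
Qed.

End Actions.

(** * Approximate units and Cohen factorisation *)

Section GeometricSum.
Variables (R : realType) (A : cstarAlgType R) (X : hilbertModType A).

Lemma nrmMn (V : normedModType R[i]) (v : V) n : nrm (v *+ n) = n%:R * nrm v.
Proof. by rewrite -scaler_nat -(rmorph_nat (@real_complex R)) nrmZr ger0_norm. Qed.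

Lemma posMn (T : endo X) n : pos T -> pos (T *+ n).
Proof.
move=> hT; elim: n => [|n IH]; first by rewrite mulr0n; exact: pos0.
by rewrite mulrS; apply: posD.
Qed.

(* sum_(j <= n) p u^j = 1 - u^(n+1) and the terms decrease. *)
Lemma pos_geometric (u : endo X) n : sa u -> (exists2 s, sa s & s * s = u) ->
  pos (1 - ((1 - u) * u ^+ n) *+ n.+1).
Proof.
move=> hu [s hs ss]; pose p := 1 - u.
have su : s * u = u * s by rewrite -ss mulrA.
have cp : GRing.comm p u by rewrite /GRing.comm /p mulrBr mulrBl mul1r mulr1.
have sp : GRing.comm p s by rewrite /GRing.comm /p mulrBr mulrBl mul1r mulr1 su.
have hp : sa p by apply: saB => //; exact: sa1.
have ssn j : s ^+ j * s ^+ j = u ^+ j by rewrite -ss exprMn_comm.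
have step j : pos (p * u ^+ j - p * u ^+ j.+1).
  have := pos_sqr (saM hp (saX j hs) (commrX j sp)); congr pos.
  transitivity (p * u ^+ j * p).
    by rewrite [X in _ * X = _](commrX j sp) mulrA -[_ * _ * s ^+ j]mulrA ssn.
  have {2}-> : p = 1 - u by [].
  by rewrite mulrBr mulr1 exprSr mulrA.
have main : pos (1 - u ^+ n.+1 - (p * u ^+ n) *+ n.+1).
  elim: n => [|n IH].
    by rewrite expr0 expr1 mulr1 mulr1n subrr; exact: pos0.
  have := posD IH (posMn n.+1 (step n)); congr pos.
  rewrite mulrnBl [(p * u ^+ n.+1) *+ n.+2]mulrS.
  have -> : p * u ^+ n.+1 = u ^+ n.+1 - u ^+ n.+2.
    by rewrite /p mulrBl mul1r -exprS.
  by zmod_eq.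
have pu : pos (u ^+ n.+1) by rewrite -ssn; apply/pos_sqr/saX.
by have := posD main pu; congr pos; rewrite -/p; zmod_eq.
Qed.
End GeometricSum.

Section ThetaIter.
Variables (R : realType) (A : cstarAlgType R) (X : hilbertModType A).

(** With p = <x,x> and u = 1 - p, the n-th iterate is x u^n, tested on elements of A because u is
    only a multiplier. Its squared norm is |p u^(2n)|, at most 1/(2n+1) by [pos_geometric]. *)
Lemma sub_theta_iter (x : X) e : nrm x <= 1 -> 0 < e ->
  exists n, nrm (iter n (fun z => z - theta x x z) x) <= e.
Proof.
move=> x1 e0; set U := (fun z => z - theta x x z); set p := inner x x.
have hp : cstar_pos p := inner_pos x.
have ps : star p = p := cstar_pos_star hp.
have p1 : nrm p <= 1 by rewrite nrm_inner exprn_ile1// nrm_ge0.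
pose u := 1 - lmul p.
have hu : sa u by apply: saB; [exact: sa1|exact: lmul_sa].
have up : 1 - u = lmul p by rewrite /u opprB addrC subrK.
have [s [hs _] [ss _]] := root_sub1 (lmul_sa ps) (bop_le p1 (lmul_bop p)).
have xn n a : iter n U x *< a = x *< ((u ^+ n) a : A).
  elim: n a => [|n IH] a; first by rewrite expr0.
  rewrite iterS {1}/U /theta ractBl -ractM -inner_ract !IH inner_ract -ractBr.
  by rewrite exprS emulE.
have uL n : (u ^+ n * lmul p) = lmul p * u ^+ n.
  by apply/esym/commrX; rewrite /GRing.comm /u mulrBr mulrBl mul1r mulr1.
have inx n : lmul (inner (iter n U x) (iter n U x)) = lmul p * u ^+ (n + n).
  have h1 : lmul (inner x (iter n U x)) = lmul p * u ^+ n.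
    by apply: endo_eq => a; rewrite lmulE -inner_ract xn inner_ract.
  have h2 : lmul (inner (iter n U x) x) = lmul p * u ^+ n.
    apply: val_inj; apply: (@adjoint_uniq _ _ _ (lmul (inner x (iter n U x)))).
      by rewrite -[inner (iter n U x) x]inner_star; exact: lmul_adj.
    rewrite h1; apply: saM; [exact: lmul_sa|exact: saX|exact/esym/uL].
  apply: endo_eq => a; rewrite lmulE -inner_ract xn inner_ract -lmulE h2.
  by rewrite -emulE exprD mulrA.
have bd n : (n + n).+1%:R * nrm (iter n U x) ^+ 2 <= 1.
  rewrite -nrm_inner -nrmMn; apply: bop_lmul => //.
  have E : lmul (inner (iter n U x) (iter n U x) *+ (n + n).+1) =
     ((1 - u) * u ^+ (n + n)) *+ (n + n).+1.
    rewrite up -inx; elim: (n + n).+1 => [|k IH]; last by rewrite !mulrS lmulD IH.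
    by apply: endo_eq => a; rewrite lmulE cmul0l.
  apply: pos_bop => //.
    rewrite E up -inx; apply/posMn/cstar_pos_lmul/inner_pos.
  by rewrite E esc1; apply: pos_geometric => //; exists s.
exists (Num.truncn (e ^- 2)).+1; set n := _.+1.
have hn : e ^- 2 <= n%:R by rewrite ltW// truncnS_gt.
rewrite -(@ler_pXn2r _ 2)// ?nnegrE ?nrm_ge0 ?(ltW e0)//.
have e2 : 0 < e ^+ 2 by rewrite exprn_gt0.
have h0 : 1 <= (n + n).+1%:R * e ^+ 2.
  rewrite -ler_pdivrMr// mul1r (le_trans hn)// ler_nat.
  by rewrite (leq_trans (leq_addr n n)).
have N0 : 0 < (n + n).+1%:R :> R by [].
by rewrite -(ler_pM2l N0) (le_trans (bd n)).
Qed.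

End ThetaIter.

Section Cohen.
Variables (R : realType).

Lemma geometric_vanish (r c e : R) : 0 <= r < 1 -> 0 < e -> exists N, c * r ^+ N <= e.
Proof.
move=> /andP[r0 r1] e0.
have [c0|c0] := lerP c 0.
  by exists 0%N; rewrite expr0 mulr1 (le_trans c0)// ltW.
have h := cvg_expr (_ : `|r| < 1); rewrite ger0_norm// in h.
have /cvgrPdist_lt /(_ (e / c) (divr_gt0 e0 c0))[N _ hN] := h r1.
exists N; have := hN N (leqnn N); rewrite /= sub0r normrN ger0_norm ?exprn_ge0//.
by rewrite ltr_pdivlMr// mulrC => /ltW.
Qed.

Lemma geometric_lim (V : completeNormedModType R[i]) (u : nat -> V) (c r : R) :
  0 <= r < 1 -> (forall n, nrm (u n.+1 - u n) <= c * r ^+ n) ->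
  exists l, forall n, nrm (l - u n) <= c / (1 - r) * r ^+ n.
Proof.
move=> rb h; have /andP[r0 r1] := rb.
have r1' : 0 < 1 - r by rewrite subr_gt0.
have c0 : 0 <= c by have := h 0%N; rewrite expr0 mulr1; apply: le_trans; exact: nrm_ge0.
apply: lim_exists => [n m|e e0]; last first.
  by have [N hN] := geometric_vanish (c / (1 - r)) rb e0; exists N.
move=> /subnK <-; move: (m - n)%N => k.
suff : nrm (u (k + n)%N - u n) <= c / (1 - r) * (r ^+ n - r ^+ (k + n)).
  move/le_trans; apply; rewrite ler_wpM2l ?divr_ge0 ?(ltW r1')//.
  by rewrite gerBl exprn_ge0.
elim: k => [|k IH]; first by rewrite !subrr nrm0 mulr0.
apply: le_trans (nrm_dist _ (u (k + n)%N) _) _.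
have -> : c / (1 - r) * (r ^+ n - r ^+ (k.+1 + n)) =
    c * r ^+ (k + n) + c / (1 - r) * (r ^+ n - r ^+ (k + n)).
  by rewrite addSn exprS; field; rewrite gt_eqF.
by rewrite lerD// addSn.
Qed.

Lemma neumann (V : completeNormedModType R[i]) (G : V -> V) (r : R) v :
  linear G -> 0 <= r < 1 -> bop G r -> exists z, z = v + G z.
Proof.
move=> lG rb Gr; have /andP[r0 r1] := rb.
pose u n := iter n (fun z => v + G z) 0.
have step n : nrm (u n.+1 - u n) <= nrm v * r ^+ n.
  elim: n => [|n IH]; first by rewrite /= (lin0 lG) addr0 subr0 expr0 mulr1.
  have -> : u n.+2 - u n.+1 = G (u n.+1 - u n) by rewrite (linB lG) /=; zmod_eq.
  by rewrite (le_trans (Gr _))// exprS mulrCA ler_wpM2l.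
have [z zP] := geometric_lim rb step.
exists z; apply/eqP; rewrite -subr_eq0; apply/eqP.
apply: (nrm_smallM (C := 2)) => e e0.
have [N hN] := geometric_vanish (nrm v / (1 - r)) rb e0.
have -> : z - (v + G z) = (z - u N.+1) - G (z - u N).
  by rewrite (linB lG) /=; zmod_eq.
apply: le_trans (nrmB _ _) _.
have h1 := zP N.+1; have h2 := zP N; have h3 := Gr (z - u N).
have h4 : r * nrm (z - u N) <= nrm (z - u N) by rewrite ler_piMl ?nrm_ge0// ltW.
have h5 : nrm v / (1 - r) * r ^+ N.+1 <= nrm v / (1 - r) * r ^+ N.
  rewrite ler_wpM2l ?divr_ge0 ?nrm_ge0 ?subr_ge0 ?(ltW r1)//.
  by rewrite exprS ler_piMl ?exprn_ge0// ltW.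
by lra.
Qed.

Variables (A : cstarAlgType R) (X : hilbertModType A).

(** Right multiplication by [a] is no module map on X. Writing <z,z> = d^* d moves the estimate to
    A, where tz - za and td - da have the same inner square. *)
Lemma sub_ract_le (z : X) (a : A) t : 0 <= t -> star a = a ->
  bop (esc (self_module A) t - lmul a) t -> nrm (t%:C *: z - z *< a) <= t * nrm z.
Proof.
move=> t0 sa_ ta; have [d dd] := inner_pos z.
have nd : nrm d = nrm z.
  apply/eqP; rewrite -(@eqrXn2 _ 2)// ?nrm_ge0//.
  by rewrite -nrm_star_mul -dd nrm_inner.
rewrite -(@ler_pXn2r _ 2)// ?nnegrE ?mulr_ge0 ?nrm_ge0// -nrm_inner.
have -> : inner (t%:C *: z - z *< a) (t%:C *: z - z *< a) =
  star (t%:C *: d - d ** a) ** (t%:C *: d - d ** a).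
  rewrite !(innerBl, innerBr, innerZlr, innerZr, inner_ract, inner_ractl) dd.
  rewrite starB starZr starM sa_.
  by rewrite !(cmulBl, cmulBr, cmulZl, cmulZr) !cmulA.
rewrite nrm_star_mul ler_pXn2r// ?nnegrE ?mulr_ge0 ?nrm_ge0// -nd.
have := ta (star d : A); rewrite eaddE eoppE lmulE escaleE eoneE.
have -> : t%:C *: (star d : self_module A) - a ** star d = star (t%:C *: d - d ** a).
  by rewrite starB starZr starM sa_.
by rewrite [nrm (star _ : self_module A)]nrm_star [nrm (star d
  : self_module A)]nrm_star.
Qed.

(** Adding tz to both sides gives a fixed-point equation whose linear part has norm at most t/(t+l)
    < 1. The same equation bounds z. *)
Lemma ract_resolvent (a : A) (l : R) (y : X) : 0 < l -> star a = a -> pos (lmul a) ->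
  exists2 z, l%:C *: z + z *< a = l%:C *: y & nrm z <= nrm y.
Proof.
move=> l0 sa_ [_ [t t0 ta]]; have tl : 0 < t + l by rewrite addr_gt0.
have tlV : 0 < (t + l)^-1 by rewrite invr_gt0.
pose G (z : X) := (t + l)^-1%:C *: (t%:C *: z - z *< a).
have lG : linear G.
  move=> k u w; rewrite /G ractDl ractZl !scalerDr !scalerN !scalerDr !scalerA.
  by rewrite ![k * _]mulrC ?mulrA; zmod_eq.
have Gr : bop G (t / (t + l)).
  move=> z; rewrite /G nrmZr ger0_norm ?(ltW tlV)// mulrAC mulrC ler_pM2r//.
  exact: sub_ract_le (ltW t0) sa_ ta.
have rb : 0 <= t / (t + l) < 1.
  by rewrite divr_ge0 ?ltW//= ltr_pdivrMr// mul1r; lra.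
have [z zE] := neumann (((t + l)^-1 * l)%:C *: y) lG rb Gr; exists z.
  have : (t + l)%:C *: z = l%:C *: y + (t%:C *: z - z *< a).
    rewrite {1}zE scalerDr /G !scalerA -!rmorphM.
    by rewrite !mulrA mulfV ?gt_eqF// mul1r scale1r.
  rewrite rmorphD scalerDl => e.
  transitivity (t%:C *: z + l%:C *: z - (t%:C *: z - z *< a)); first by zmod_eq.
  by rewrite e; zmod_eq.
have h : nrm z <= (t + l)^-1 * l * nrm y + t / (t + l) * nrm z.
  rewrite {1}zE (le_trans (nrmD _ _))// lerD// nrmZr ger0_norm//.
  by rewrite mulr_ge0// ltW.
have e1 : nrm z - t / (t + l) * nrm z = (t + l)^-1 * l * nrm z.
  by field; rewrite gt_eqF.
have : (t + l)^-1 * l * nrm z <= (t + l)^-1 * l * nrm y by rewrite -e1; lra.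
by rewrite ler_pM2l// mulr_gt0.
Qed.

(** For p = <x,x>, |x - xu|^2 is at most twice |p - pu|; hence the tolerance e^2/2 in A. *)
Lemma approx_unit (x : X) e : sigma_unital A -> 0 < e ->
  exists u : A, [/\ cstar_pos u, nrm u <= 1 & nrm (x - x *< u) <= e].
Proof.
move=> [u [up _ _ ur]] e0; set p := inner x x.
have e2 : 0 < e ^+ 2 / 2 by rewrite divr_gt0// exprn_gt0.
have [N hN] := cvg_nrm (ur p) e2; have [hu un] := up N.
have u1 : nrm (u N) <= 1 by rewrite -(@lecR R) -nrmE.
exists (u N); split=> //.
rewrite -(@ler_pXn2r _ 2)// ?nnegrE ?nrm_ge0 ?(ltW e0)// -nrm_inner.
have -> : inner (x - x *< u N) (x - x *< u N) =
   (p - p ** u N) - u N ** (p - p ** u N).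
  rewrite !(innerBl, innerBr, inner_ract, inner_ractl) -/p cstar_pos_star//.
  by rewrite cmulBr !cmulA; zmod_eq.
have h1 := hN N (leqnn N); rewrite nrmBC in h1.
apply: le_trans (nrmB _ _) _.
have h2 : nrm (u N ** (p - p ** u N)) <= nrm (p - p ** u N).
  by rewrite (le_trans (nrm_cmul _ _))// ler_piMl ?nrm_ge0.
by lra.
Qed.

(* Cohen factorisation: z_n b_n = x with b_n = 2^-n + a_n, a_n a positive
   combination of approximate units chosen so that z_n converges. *)
Lemma cohen_factorization (x : X) : sigma_unital A -> exists z a, x = z *< a.
Proof.
move=> su; pose q n : R := 2^-1 ^+ n.
have q0 n : 0 < q n by rewrite exprn_gt0.
have qS n : q n = q n.+1 + q n.+1 by rewrite /q exprS; lra.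
pose I n (s : X * A) :=
  [/\ (q n)%:C *: s.1 + s.1 *< s.2 = x, star s.2 = s.2 & pos (lmul s.2)].
have step n s : exists s', I n s -> [/\ I n.+1 s', nrm (s'.1 - s.1) <= q n &
    nrm (s'.2 - s.2) <= q n].
  (* States outside the invariant are sent to themselves, so that [choice] yields a total step
     function. *)
  have [[zx sa_ pa]|nI] := pselect (I n s); last by exists s.
  have [u [hu u1 hz]] := approx_unit s.1 su (q0 n).
  pose a' := s.2 + (q n.+1)%:C *: u.
  have sa' : star a' = a' by rewrite starD starZr sa_ cstar_pos_star.
  have pa' : pos (lmul a').
    by rewrite lmulD lmulZ; apply: posD => //; apply: posZ => //; apply: cstar_pos_lmul.
  (* Replacing half of the scalar q_n by q_(n+1) u spoils the equation by q_(n+1) (s.1 - s.1 u). The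
     correction [z] repairs exactly this, and is as small as s.1 - s.1 u. *)
  have [z hz' zn] := ract_resolvent (s.1 - s.1 *< u) (q0 n.+1) sa' pa'.
  exists (s.1 + z, a') => _; split; [split=> //=| |] => /=.
  - rewrite scalerDr ractDl.
    transitivity ((q n.+1)%:C *: s.1 + s.1 *< a' + ((q n.+1)%:C *: z + z *< a')).
      by zmod_eq.
    rewrite hz' /a' ractDr ractZr scalerBr -zx (qS n) rmorphD scalerDl.
    by zmod_eq.
  - by rewrite addrC addKr (le_trans zn).
  - rewrite addrC addKr nrmZr ger0_norm ?(ltW (q0 _))//.
    have := q0 n.+1; have := qS n; have := ler_piMr (ltW (q0 n.+1)) u1; lra.
have [f fP] := choice (fun ns : nat * (X * A) => step ns.1 ns.2).
pose s := fix s n := if n is m.+1 then f (m, s m) else (x, 0 : A).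
have Is n : I n (s n).
  elim: n => [|n IH]; last by have [] := fP (n, s n) IH.
  split=> /=; first by rewrite ract0r addr0 /q expr0 scale1r.
    exact: star0.
  have -> : lmul (0 : A) = 0 by apply: endo_eq => y; rewrite lmulE cmul0l.
  exact: pos0.
have hr : 0 <= (2^-1 : R) < 1 by apply/andP; split; lra.
have [z zP] : exists l, forall n, nrm (l - (s n).1) <= 1 / (1 - 2^-1) * q n.
  by apply: geometric_lim => // n; rewrite mul1r; have [] := fP (n, s n) (Is n).
have [a aP] : exists l, forall n, nrm (l - (s n).2) <= 1 / (1 - 2^-1) * q n.
  by apply: geometric_lim => // n; rewrite mul1r; have [] := fP (n, s n) (Is n).
have c2 : 1 / (1 - 2^-1) = 2 :> R by field.
rewrite c2 in zP aP.
exists z, a; apply/eqP; rewrite -subr_eq0; apply/eqP.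
apply: (nrm_smallM (C := 1)) => e e0; rewrite mul1r.
pose C := (nrm z + 2) * 3 + 2 * nrm a.
have [N hN] := geometric_vanish C hr e0.
have [hx _ _] := Is N.
have -> : x - z *< a =
  (q N)%:C *: (s N).1 - (z - (s N).1) *< a - (s N).1 *< (a - (s N).2).
  by rewrite -{1}hx ractBl ractBr; zmod_eq.
have n1 : nrm (s N).1 <= nrm z + 2 * q N.
  have := nrm_dist (s N).1 z 0; rewrite !subr0 nrmBC => /le_trans; apply.
  by rewrite addrC lerD2l.
have qN1 : q N <= 1 by rewrite exprn_ile1//; lra.
have m1 := nrm_ract (z - (s N).1) a; have m2 := nrm_ract (s N).1 (a - (s N).2).
have m3 := nrmZr (q N) (s N).1; rewrite ger0_norm ?(ltW (q0 N))// in m3.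
have m4 := nrmB ((q N)%:C *: (s N).1 - (z - (s N).1) *< a) ((s N).1 *< (a - (s N).2)).
have m5 := nrmB ((q N)%:C *: (s N).1) ((z - (s N).1) *< a).
have k1 : nrm (z - (s N).1) * nrm a <= 2 * q N * nrm a by rewrite ler_wpM2r ?nrm_ge0.
have n1' : nrm (s N).1 <= nrm z + 2 by lra.
have k2 : nrm (s N).1 * nrm (a - (s N).2) <= (nrm z + 2) * (2 * q N).
  by apply: ler_pM => //; exact: nrm_ge0.
have k3 : q N * nrm (s N).1 <= q N * (nrm z + 2) by rewrite ler_pM2l.
move: hN; rewrite /C -/(q N); lra.
Qed.

End Cohen.

(** * The map induced on compact operators *)

Section Theta.
Variables (R : realType) (A : cstarAlgType R) (X : hilbertModType A).
Implicit Types (x y z : X) (T S : X -> X).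

Lemma theta_adj x y : adjoint_pair (theta x y) (theta y x).
Proof.
by move=> z w; rewrite /theta inner_ract inner_ractl inner_star.
Qed.

Lemma theta_bop x y : bop (theta x y) (nrm x * nrm y).
Proof.
move=> z; rewrite (le_trans (nrm_ract _ _))// -mulrA ler_wpM2l ?nrm_ge0//.
exact: cauchy_schwarz.
Qed.

Lemma op_boundedE T (k : R) : op_bounded T k%:C <-> bop T k.
Proof. by split=> h x; have := h x; rewrite !nrmE -rmorphM lecR. Qed.

Lemma gt0_complexE (e : R[i]) : 0 < e -> e = (complex.Re e)%:C /\ 0 < complex.Re e.
Proof.
move=> e0; split; first by rewrite RRe_real// gtr0_real.
by move: e0; rewrite ltcE /= => /andP[].
Qed.

Lemma compactP T : compact_op T <-> forall e : R, 0 < e ->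
  exists2 S, ispan [set theta x y | x in setT & y in setT] S & bop (T - S) e.
Proof.
split=> h e e0.
  have [|S /spanP sS bS] := h e%:C; first by rewrite (@ltcR R 0).
  by exists S => //; apply/op_boundedE.
have [-> re0] := gt0_complexE e0.
by have [S sS bS] := h _ re0; exists S; [apply/spanP|apply/op_boundedE].
Qed.

End Theta.

(** A correspondence morphism without left actions: the data on which beta^(1) depends. *)
Record mod_morphism (R : realType) (A B : cstarAlgType R) (X : hilbertModType A)
    (Y : hilbertModType B) (alpha : A -> B) (beta : X -> Y) : Prop := ModMorphism {
  mm_hom : star_hom alpha;
  mm_lin : linear beta;
  mm_inner : forall x y, inner (beta x) (beta y) = alpha (inner x y);
  mm_ract : forall x a, beta (x *< a) = beta x *< alpha a
}.

(* Pairs (S, beta^(1) S) with S of finite rank. *)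
Inductive frpair (R : realType) (A B : cstarAlgType R) (X : hilbertModType A)
    (Y : hilbertModType B) (beta : X -> Y) : (X -> X) -> (Y -> Y) -> Prop :=
| frpair0 : frpair beta 0 0
| frpairS x y S S' : frpair beta S S' ->
    frpair beta (theta x y + S) (theta (beta x) (beta y) + S').

(* The graph of beta^(1), as the norm closure of [frpair beta]. *)
Definition cpair (R : realType) (A B : cstarAlgType R) (X : hilbertModType A)
    (Y : hilbertModType B) (beta : X -> Y) (T : X -> X) (T' : Y -> Y) : Prop :=
  forall e : R, 0 < e -> exists S S',
    [/\ frpair beta S S', bop (T - S) e & bop (T' - S') e].

Section Pairs.
Variables (R : realType) (A B : cstarAlgType R) (X : hilbertModType A)
  (Y : hilbertModType B) (alpha : A -> B) (beta : X -> Y).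
Hypothesis mm : mod_morphism alpha beta.
Implicit Types (S T V P : X -> X).

Let lb : linear beta := mm_lin mm.
Let ra := mm_ract mm.

Lemma mm_contr x : nrm (beta x) <= nrm x.
Proof.
rewrite -(@ler_pXn2r _ 2)// ?nnegrE ?nrm_ge0// -!nrm_inner (mm_inner mm).
exact: star_hom_contr (mm_hom mm).
Qed.

Lemma frpair_mem x y : frpair beta (theta x y) (theta (beta x) (beta y)).
Proof. by rewrite -[theta x y]addr0 -[theta (beta x) _]addr0; right; left. Qed.

Lemma frpairD S (S' : Y -> Y) T (T' : Y -> Y) :
  frpair beta S S' -> frpair beta T T' -> frpair beta (S + T) (S' + T').
Proof.
by move=> + h; elim=> [|x y ? ? _ IH]; rewrite ?add0r// -!addrA; right.
Qed.

Lemma frpairZ k S (S' : Y -> Y) : frpair beta S S' -> frpair beta (k *: S) (k *: S').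
Proof.
elim=> [|x y ? ? _ IH]; first by rewrite !scaler0; left.
rewrite !scalerDr; have thZ (C : cstarAlgType R) (Z : hilbertModType C) (u v : Z) :
    k *: theta u v = theta (k *: u) v.
  by apply/funext => z; rewrite /theta ractZl.
by rewrite !thZ -(linZ lb); right.
Qed.

Lemma frpairB S (S' : Y -> Y) T (T' : Y -> Y) :
  frpair beta S S' -> frpair beta T T' -> frpair beta (S - T) (S' - T').
Proof.
by move=> hS /(frpairZ (-1)) hT; rewrite -[- T]scaleN1r -[- T']scaleN1r; apply: frpairD.
Qed.

Lemma frpair_adj S (S' : Y -> Y) : frpair beta S S' -> exists V (V' : Y -> Y),
  [/\ frpair beta V V', adjoint_pair S V & adjoint_pair S' V'].
Proof.
elim=> [|x y {}S {}S' _ [V [V' [h h1 h2]]]].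
  by exists 0, 0; split; [left| |] => u v; rewrite inner0l inner0r.
exists (theta y x + V), (theta (beta y) (beta x) + V'); split; first by right.
  by move=> u v; rewrite innerDl innerDr theta_adj h1.
by move=> u v; rewrite innerDl innerDr theta_adj h2.
Qed.

Lemma frpair_left P P0 (P' P0' : Y -> Y) S (S' : Y -> Y) :
  adjoint_pair P P0 -> adjoint_pair P' P0' -> (forall x, P' (beta x) = beta (P x)) ->
  frpair beta S S' -> frpair beta (P \o S) (P' \o S').
Proof.
move=> hP hP' PP; elim=> [|x y {}S {}S' _ IH].
  have -> : P \o (0 : X -> X) = (0 : X -> X) by apply/funext => z;
    exact: lin0 (adjoint_lin hP).
  have -> : P' \o (0 : Y -> Y) = (0 : Y -> Y) by apply/funext => z;
    exact: lin0 (adjoint_lin hP').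
  by left.
have -> : P \o (theta x y + S) = theta (P x) y + (P \o S).
  by apply/funext => z /=; rewrite (linD (adjoint_lin hP)) (adjoint_ract _ _ hP).
have -> : P' \o (theta (beta x) (beta y) + S') =
    theta (beta (P x)) (beta y) + (P' \o S').
  by apply/funext => z /=; rewrite (linD (adjoint_lin hP')) (adjoint_ract _ _ hP') PP.
by right.
Qed.

Lemma frpair_right P P0 (P' P0' : Y -> Y) S (S' : Y -> Y) :
  adjoint_pair P P0 -> adjoint_pair P' P0' ->
  (forall x, P0' (beta x) = beta (P0 x)) ->
  frpair beta S S' -> frpair beta (S \o P) (S' \o P').
Proof.
move=> hP hP' PP; elim=> [|x y {}S {}S' _ IH]; first by left.
have -> : (theta x y + S) \o P = theta x (P0 y) + (S \o P).
  by apply/funext => z; rewrite -[LHS]/(x *< inner y (P z) + S (P z)) -(adjoint_sym hP).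
have -> : (theta (beta x) (beta y) + S') \o P' =
    theta (beta x) (beta (P0 y)) + (S' \o P').
  apply/funext => z; rewrite -PP -[RHS]/(beta x *< inner (P0' (beta y)) z + S' (P' z)).
  by rewrite (adjoint_sym hP').
by right.
Qed.

Lemma frpair_intertwine S (S' : Y -> Y) x : frpair beta S S' ->
  S' (beta x) = beta (S x).
Proof.
elim=> [|u v {}S {}S' _ IH]; first by rewrite [RHS](lin0 lb).
by rewrite [RHS](linD lb) -IH ra -(mm_inner mm).
Qed.

Lemma frpair_comp S (S' : Y -> Y) T (T' : Y -> Y) :
  frpair beta S S' -> frpair beta T T' -> frpair beta (S \o T) (S' \o T').
Proof.
move=> hS; have [V [V' [_ hV hV']]] := frpair_adj hS.
by apply: frpair_left hV hV' _ => x; apply: frpair_intertwine.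
Qed.

Lemma frpair_bounded S (S' : Y -> Y) : frpair beta S S' ->
  (exists2 k, 0 <= k & bop S k) /\ (exists2 k, 0 <= k & bop S' k).
Proof.
elim=> [|x y {}S {}S' _ [[k k0 kS] [l l0 lS]]].
  by split; exists 0 => //; apply: bop0.
split; [exists (nrm x * nrm y + k)|exists (nrm (beta x) * nrm (beta y) + l)].
- by rewrite addr_ge0 ?mulr_ge0 ?nrm_ge0.
- exact: bopD (theta_bop x y) kS.
- by rewrite addr_ge0 ?mulr_ge0 ?nrm_ge0.
- exact: bopD (theta_bop _ _) lS.
Qed.

(** P' meets S' only through vectors beta(x), where it acts as P. So a bound for P alone is enough,
    with a constant depending only on S; this permits P to run through powers. *)
Lemma frpair_growth S (S' : Y -> Y) : frpair beta S S' -> exists2 C, 0 <= C &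
  forall P (P' P0' : Y -> Y) c, 0 <= c -> adjoint_pair P' P0' ->
    (forall x, P' (beta x) = beta (P x)) -> bop P c ->
    forall z, nrm (P' (S' z)) <= C * c * nrm z.
Proof.
elim=> [|x y {}S {}S' _ [C C0 IH]].
  exists 0 => // P P' P0' c c0 hP' PP Pc z.
  by rewrite [P' _](lin0 (adjoint_lin hP')) nrm0 !mul0r.
exists (nrm x * nrm y + C); first by rewrite addr_ge0 ?mulr_ge0 ?nrm_ge0.
move=> P P' P0' c c0 hP' PP Pc z.
rewrite [P' _](linD (adjoint_lin hP')) (adjoint_ract _ _ hP') PP.
apply: le_trans (nrmD _ _) _; rewrite !mulrDl lerD//; last exact: IH hP' PP Pc z.
apply: le_trans (nrm_ract _ _) _.
have -> : nrm x * nrm y * c * nrm z = (c * nrm x) * (nrm y * nrm z) by ring.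
apply: ler_pM; rewrite ?nrm_ge0//; first exact: le_trans (mm_contr _) (Pc x).
apply: le_trans (cauchy_schwarz _ _) _.
by rewrite ler_wpM2r ?nrm_ge0// mm_contr.
Qed.

(* For Q = S*S the powers of Q' grow no faster than those of Q, up to a
   constant; as Q' is self-adjoint this bounds Q', hence S'. *)
Lemma frpair_bop S (S' : Y -> Y) k : frpair beta S S' -> 0 <= k -> bop S k -> bop S' k.
Proof.
move=> hS k0 Sk; apply: bop_inf => e e0.
have {}Sk : bop S (k + e) by apply: bop_le Sk; rewrite lerDl ltW.
move: (k + e) (ltr_wpDl k0 e0) Sk => {k k0 e0} k k0 Sk.
have [V [V' [hV SV SV']]] := frpair_adj hS.
pose Q := V \o S; pose Q' := V' \o S'.
have hQ : frpair beta Q Q' by apply: frpair_comp.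
have k2 : 0 < k ^+ 2 by rewrite exprn_gt0.
have Qk : bop Q (k ^+ 2).
  by rewrite expr2; exact: bop_comp (ltW k0) (adjoint_bop (ltW k0) SV Sk) Sk.
have saQ' : adjoint_pair Q' Q' by exact: adjoint_comp (adjoint_sym SV') SV'.
have [_ [l _ lQ']] := frpair_bounded hQ.
have aQ' : adjointable Q' by exists Q'; split=> //; exists l.
pose E : endo Y := Endo (introT (asboolP _) aQ').
have saE : sa E := saQ'.
have [C C0 hC] := frpair_growth hQ.
pose F := (k ^- 2)%:C *: E.
have kV : 0 < k ^- 2 by rewrite invr_gt0.
have FE n : F ^+ n = ((k ^- 2) ^+ n)%:C *: E ^+ n.
  elim: n => [|n IH]; first by rewrite !expr0 scale1r.
  by rewrite [LHS]exprS IH /F ezAl ezAr scalerA -rmorphM -!exprS.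
have QE n x : (E ^+ n) (beta x) = beta (iter n Q x).
  elim: n => [|n IH]; first by rewrite expr0.
  by rewrite exprS emulE IH iterS -(frpair_intertwine _ hQ).
have Qn n : bop (iter n Q) ((k ^+ 2) ^+ n).
  elim: n => [|n IH] x; first by rewrite expr0 mul1r.
  rewrite iterS (le_trans (Qk _))//; move: (k ^+ 2) (IH x) k2 => q IHx q0.
  by rewrite exprS -mulrA ler_pM2l.
have F1 : bop F 1.
  (* The 1 covers the power 0. In the power n+1 one factor plays the part of S' in [frpair_growth],
     the other n that of P'. *)
  apply: (bop_pow_bounded (K := 1 + C * k ^- 2)); first exact: saZ.
  have c0 : 0 <= C * k ^- 2 by rewrite mulr_ge0// ltW.
  case=> [|n] x.
    rewrite expr0 eoneE ler_peMl ?nrm_ge0//; lra.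
  rewrite FE escaleE nrmZr ger0_norm ?exprn_ge0 ?(ltW kV)// [E ^+ n.+1]exprSr emulE.
  have := hC (iter n Q) (E ^+ n) (eadj (E ^+ n)) ((k ^+ 2) ^+ n)
    (exprn_ge0 n (ltW k2)) (eadjP _) (QE n) (Qn n) x.
  rewrite -(ler_pM2l (_ : 0 < (k ^- 2) ^+ n.+1)) ?exprn_gt0// => /le_trans; apply.
  have -> : (k ^- 2) ^+ n.+1 * (C * (k ^+ 2) ^+ n * nrm x) = C * k ^- 2 * nrm x.
    rewrite exprSr; have : (k ^- 2) ^+ n * (k ^+ 2) ^+ n = 1.
      by rewrite -exprMn mulVf ?gt_eqF// expr1n.
    by move: (k ^- 2 ^+ n) (k ^+ 2 ^+ n) => p q pq; rewrite -[RHS]mul1r -pq; ring.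
  by rewrite ler_wpM2r ?nrm_ge0// lerDr.
move=> z; rewrite -(@ler_pXn2r _ 2)// ?nnegrE ?mulr_ge0 ?nrm_ge0 ?(ltW k0)//.
rewrite -nrm_inner SV' (le_trans (cauchy_schwarz _ _))//.
have := F1 z; rewrite escaleE nrmZr ger0_norm ?(ltW kV)// mul1r ler_pdivrMl// => h.
by rewrite exprMn mulrC [nrm z ^+ 2]expr2 mulrA ler_wpM2r ?nrm_ge0.
Qed.

End Pairs.

Section CPair.
Variables (R : realType) (A B : cstarAlgType R) (X : hilbertModType A)
  (Y : hilbertModType B) (alpha : A -> B) (beta : X -> Y).
Hypothesis mm : mod_morphism alpha beta.
Implicit Types (S T V P : X -> X).

Lemma frpair_ispan S (S' : Y -> Y) : frpair beta S S' ->
  ispan [set theta x y | x in setT & y in setT] S /\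
  ispan [set theta x y | x in setT & y in setT] S'.
Proof.
elim=> [|x y {}S {}S' _ [IH IH']]; first by split; left.
split; apply: ispan_add => //; apply: ispan_mem.
  by exists x => //; exists y.
by exists (beta x) => //; exists (beta y).
Qed.

Lemma ispan_frpair S : ispan [set theta x y | x in setT & y in setT] S ->
  exists S' : Y -> Y, frpair beta S S'.
Proof.
elim=> [|k s v [x _ [y _ <-]] _ [S' hS']]; first by exists 0; left.
exists (k *: theta (beta x) (beta y) + S'); apply: frpairD => //.
by apply: (frpairZ mm); apply: frpair_mem.
Qed.

Lemma frpair_cpair S (S' : Y -> Y) : frpair beta S S' -> cpair beta S S'.
Proof.
by move=> h e e0; exists S, S'; split; rewrite ?subrr//; apply: bop0; exact: ltW.
Qed.

Lemma cpair_compact T (T' : Y -> Y) : cpair beta T T' -> compact_op T /\ compact_op T'.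
Proof.
move=> h; split; apply/compactP => e e0; have [S [S' [hS b b']]] := h e e0;
  have [s s'] := frpair_ispan hS; by [exists S|exists S'].
Qed.

(** By [frpair_bop], Cauchy sequences of finite-rank operators on X have Cauchy images, which
    converge pointwise with a uniform rate. *)
Lemma compact_cpair T : compact_op T -> exists T' : Y -> Y, cpair beta T T'.
Proof.
move=> /compactP hT; pose d n : R := n.+1%:R^-1.
have d0 n : 0 < d n := invS_gt0 R n.
have dh n m : (n <= m)%N -> d m <= d n := @invS_le R n m.
have ex n : exists SS : (X -> X) * (Y ->
  Y), frpair beta SS.1 SS.2 /\ bop (T - SS.1) (d n).
  have [S sS bS] := hT (d n) (d0 n); have [S' hS] := ispan_frpair sS.
  by exists (S, S').
have [F FP] := choice ex.
have FD n m : (n <= m)%N -> bop ((F m).2 - (F n).2) (2 * d n).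
  move=> nm; apply: (frpair_bop mm (S := (F m).1 - (F n).1)).
  - by apply: (frpairB mm); [case: (FP m)|case: (FP n)].
  - by rewrite mulr_ge0// ltW.
  have h := bopB (FP n).2 (FP m).2.
  have : d n + d m <= 2 * d n by have := dh _ _ nm; lra.
  move=> /bop_le; apply => x; have := h x; congr (nrm _ <= _).
  by rewrite -![(_ - _) x]/(_ x - _ x); zmod_eq.
have dv e : 0 < e -> exists N, d N <= e := @invS_small R e.
have cv x : exists l, forall n, nrm (l - (F n).2 x) <= 2 * d n * nrm x.
  apply: (@lim_exists R Y (fun n => (F n).2 x)) => [n m nm|e e0];
    first exact: (FD _ _ nm x).
  have x1 : 0 < nrm x + 1 by rewrite ltr_wpDl ?nrm_ge0.
  have [N hN] := dv (e / (2 * (nrm x + 1))) ltac:(by rewrite divr_gt0// mulr_gt0).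
  exists N; have n0 := nrm_ge0 x.
  have : d N * (2 * (nrm x + 1)) <= e by rewrite -ler_pdivlMr// mulr_gt0.
  by have := d0 N; nra.
pose T' x := sval (cid (cv x)).
have T'P n : bop (T' - (F n).2) (2 * d n) by move=> x; exact: (svalP (cid (cv x)) n).
exists T' => e e0; have [N hN] := dv (e / 2) (pos_half e0).
exists (F N).1, (F N).2; have [h1 h2] := FP N; split=> //.
  by apply: bop_le h2; lra.
by apply: bop_le (T'P N); lra.
Qed.

Lemma cpair_comb k S (S' : Y -> Y) T (T' : Y -> Y) :
  cpair beta S S' -> cpair beta T T' -> cpair beta (k *: S + T) (k *: S' + T').
Proof.
move=> hS hT e e0; pose c := complex.Re `|k| + 1.
have k0 : 0 <= complex.Re `|k| by rewrite normc_def sqrtr_ge0.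
have c0 : 0 < c by rewrite /c ltr_wpDl.
have [S1 [S1' [h1 b1 b1']]] := hS (e / 2 / c) (divr_gt0 (pos_half e0) c0).
have [T1 [T1' [h2 b2 b2']]] := hT (e / 2) (pos_half e0).
have le : complex.Re `|k| * (e / 2 / c) + e / 2 <= e.
  suff : complex.Re `|k| * (e / 2 / c) <= e / 2 by lra.
  have -> : complex.Re `|k| * (e / 2 / c) = e / 2 * (complex.Re `|k| / c) by ring.
  by rewrite ger_pMr ?pos_half// ler_pdivrMr// mul1r /c lerDl.
exists (k *: S1 + T1), (k *: S1' + T1'); split.
- by apply: frpairD => //; apply: (frpairZ mm).
- apply: bop_le le _ => x; have := bopD (bopZ k b1) b2 x; congr (nrm _ <= _).
  rewrite -[(_ - (k *: S1 + T1)) x]/(k *: S x + T x - (k *: S1 x + T1 x)).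
  by rewrite -![(_ - _) x]/(_ x - _ x) scalerBr; zmod_eq.
- apply: bop_le le _ => x; have := bopD (bopZ k b1') b2' x; congr (nrm _ <= _).
  rewrite -[(_ - (k *: S1' + T1')) x]/(k *: S' x + T' x - (k *: S1' x + T1' x)).
  by rewrite -![(_ - _) x]/(_ x - _ x) scalerBr; zmod_eq.
Qed.

Lemma cpair0 : cpair beta 0 0.
Proof. by apply: frpair_cpair; left. Qed.

Lemma cpairB S (S' : Y -> Y) T (T' : Y -> Y) :
  cpair beta S S' -> cpair beta T T' -> cpair beta (S - T) (S' - T').
Proof.
move=> hS hT; have := cpair_comb (-1) hT hS.
by rewrite !scaleN1r [- T + S]addrC [- T' + S']addrC.
Qed.

Lemma cpairD S (S' : Y -> Y) T (T' : Y -> Y) :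
  cpair beta S S' -> cpair beta T T' -> cpair beta (S + T) (S' + T').
Proof. by move=> hS hT; have := cpair_comb 1 hS hT; rewrite !scale1r. Qed.

Lemma cpair_bop T (T' : Y -> Y) k : 0 <= k -> cpair beta T T' -> bop T k -> bop T' k.
Proof.
move=> k0 hT Tk; apply: bop_inf => e e0.
have [S [S' [hS b b']]] := hT (e / 2) (pos_half e0).
have Sk : bop S (k + e / 2).
  move=> x; have := bopB Tk b x; congr (nrm _ <= _).
  by rewrite -[(T - S) x]/(T x - S x); zmod_eq.
have ke : 0 <= k + e / 2 by rewrite addr_ge0// ltW// divr_gt0.
have h := frpair_bop mm hS ke Sk.
have -> : k + e = k + e / 2 + e / 2 by lra.
move=> x; have := bopD h b' x; congr (nrm _ <= _).
by rewrite -[(T' - S') x]/(T' x - S' x); zmod_eq.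
Qed.

(** The relation is linear and contractive, hence single-valued: the graph of beta^(1). *)
Lemma cpair_uniq T (T1 T2 : Y -> Y) : cpair beta T T1 -> cpair beta T T2 -> T1 = T2.
Proof.
move=> h1 h2; have := cpairB h1 h2; rewrite subrr => h.
have := cpair_bop (lexx 0) h (bop0 _ (lexx 0)) => h0; apply/funext => x.
apply/eqP; rewrite -subr_eq0; apply/eqP/nrm_eq0/eqP; rewrite eq_le nrm_ge0 andbT.
by have := h0 x; rewrite mul0r.
Qed.

Lemma cpair_intertwine T (T' : Y -> Y) x : cpair beta T T' -> T' (beta x) = beta (T x).
Proof.
move=> hT; apply/eqP; rewrite -subr_eq0; apply/eqP.
apply: (nrm_smallM (C := 2 * nrm x)) => e e0.
have [S [S' [hS b b']]] := hT e e0.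
have -> : T' (beta x) - beta (T x) = (T' - S') (beta x) - beta ((T - S) x).
  rewrite -[(T' - S') _]/(T' _ - S' _) -[(T - S) _]/(T _ - S _).
  by rewrite (linB (mm_lin mm)) (frpair_intertwine mm _ hS); zmod_eq.
apply: le_trans (nrmB _ _) _.
have h1 := b' (beta x); have h2 := mm_contr mm ((T - S) x); have h3 := b x.
have : e * nrm (beta x) <= e * nrm x by rewrite ler_pM2l// (mm_contr mm).
by lra.
Qed.

Lemma cpair_bounded T (T' : Y -> Y) : cpair beta T T' ->
  (exists2 k, 0 <= k & bop T k) /\ (exists2 k, 0 <= k & bop T' k).
Proof.
move=> /(_ 1 ltr01)[S [S' [hS b b']]]; have [[k k0 Sk] [l l0 Sl]] := frpair_bounded hS.
split; [exists (1 + k)|exists (1 + l)]; rewrite ?addr_ge0// => x.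
  have := bopD b Sk x; congr (nrm _ <= _).
  by rewrite -[(T - S) x]/(T x - S x) subrK.
have := bopD b' Sl x; congr (nrm _ <= _).
by rewrite -[(T' - S') x]/(T' x - S' x) subrK.
Qed.

(** Finite-rank pairs have explicit adjoints. The error V - W is the adjoint of T - S, so it has the
    same bound, and [cpair_bop] carries this bound to Y. *)
Lemma cpair_adj T (T' : Y -> Y) V (V' : Y -> Y) : cpair beta T T' -> cpair beta V V' ->
  adjoint_pair T V -> adjoint_pair T' V'.
Proof.
move=> hT hV TV x y; apply/eqP; rewrite -subr_eq0; apply/eqP.
apply: (nrm_smallM (C := 2 * (nrm x * nrm y))) => e e0.
have [S [S' [hS b b']]] := hT e e0.
have [W [W' [hW SW SW']]] := frpair_adj hS.
have VW : bop (V - W) e.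
  apply: (adjoint_bop (ltW e0) _ b) => u v.
  rewrite -[(T - S) u]/(T u - S u) -[(V - W) v]/(V v - W v).
  by rewrite innerBl innerBr TV SW.
have VW' : bop (V' - W') e.
  exact: cpair_bop (ltW e0) (cpairB hV (frpair_cpair hW)) VW.
have -> : inner (T' x) y - inner x (V' y) =
   inner ((T' - S') x) y - inner x ((V' - W') y).
  rewrite -[(T' - S') _]/(T' _ - S' _) -[(V' - W') _]/(V' _ - W' _).
  by rewrite innerBl innerBr SW'; zmod_eq.
apply: le_trans (nrmB _ _) _.
have h1 := cauchy_schwarz ((T' - S') x) y; have h2 := cauchy_schwarz x ((V' - W') y).
have h3 : nrm ((T' - S') x) * nrm y <= e * nrm x * nrm y by rewrite ler_wpM2r ?nrm_ge0.
have h4 : nrm x * nrm ((V' - W') y) <= nrm x * (e * nrm y)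
  by rewrite ler_wpM2l ?nrm_ge0.
by lra.
Qed.

Lemma cpair_adj_ex T (T' : Y -> Y) V : cpair beta T T' -> adjoint_pair T V ->
  exists2 V' : Y -> Y, cpair beta V V' & adjoint_pair T' V'.
Proof.
move=> hT TV; have cV : compact_op V.
  apply/compactP => e e0; have [S [S' [hS b _]]] := hT e e0.
  have [W [W' [hW SW _]]] := frpair_adj hS; exists W; first by case: (frpair_ispan hW).
  apply: (adjoint_bop (ltW e0) _ b) => u v.
  rewrite -[(T - S) u]/(T u - S u) -[(V - W) v]/(V v - W v).
  by rewrite innerBl innerBr TV SW.
by have [V' hV] := compact_cpair cV; exists V' => //; exact: cpair_adj hT hV TV.
Qed.

Lemma cpair_left P P0 (P' P0' : Y -> Y) T (T' : Y -> Y) k k' : bop P k -> bop P' k' ->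
  adjoint_pair P P0 -> adjoint_pair P' P0' -> (forall x, P' (beta x) = beta (P x)) ->
  cpair beta T T' -> cpair beta (P \o T) (P' \o T').
Proof.
move=> /bop_pos[l l1 Pl] /bop_pos[l' l1' Pl'] hP hP' PP hT e e0.
have c0 : 0 < l + l' by lra.
have [S [S' [hS b b']]] := hT (e / (l + l')) (divr_gt0 e0 c0).
exists (P \o S), (P' \o S'); split; first exact: frpair_left hP hP' PP hS.
- have le : l * (e / (l + l')) <= e.
    by rewrite mulrC -mulrA ger_pMr// mulrC ler_pdivrMr// mul1r; lra.
  move=> x; have h := bop_comp (ltW (lt_le_trans ltr01 l1)) Pl b x.
  rewrite -[_ x]/(P (T x) - P (S x)) -(linB (adjoint_lin hP)).
  by rewrite (le_trans h)// ler_wpM2r ?nrm_ge0.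
- have le : l' * (e / (l + l')) <= e.
    by rewrite mulrC -mulrA ger_pMr// mulrC ler_pdivrMr// mul1r; lra.
  move=> x; have h := bop_comp (ltW (lt_le_trans ltr01 l1')) Pl' b' x.
  rewrite -[_ x]/(P' (T' x) - P' (S' x)) -(linB (adjoint_lin hP')).
  by rewrite (le_trans h)// ler_wpM2r ?nrm_ge0.
Qed.

Lemma cpair_linear T (T' : Y -> Y) : cpair beta T T' -> linear T'.
Proof.
move=> hT k x y; apply/eqP; rewrite -subr_eq0; apply/eqP.
set v := _ - _.
pose C := nrm (k *: x + y) + complex.Re `|k| * nrm x + nrm y.
apply: (nrm_smallM (C := C)) => e e0.
have [S [S' [hS _ b]]] := hT e e0; have [_ [V' [_ _ SV]]] := frpair_adj hS.
have -> : v = (T' - S') (k *: x + y) - (k *: (T' - S') x + (T' - S') y).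
  rewrite -![(T' - S') _]/(T' _ - S' _) (adjoint_lin SV) scalerBr /v; zmod_eq.
apply: le_trans (nrmB _ _) _; rewrite /C.
have h1 := nrmD (k *: (T' - S') x) ((T' - S') y).
have h2 := nrmZ k ((T' - S') x); have h3 := b x; have h4 := b y.
have h5 := b (k *: x + y).
have k0 : 0 <= complex.Re `|k| by rewrite normc_def sqrtr_ge0.
have : complex.Re `|k| * nrm ((T' - S') x) <= complex.Re `|k| * (e * nrm x)
  by rewrite ler_wpM2l.
lra.
Qed.

Lemma cpair_ract T (T' : Y -> Y) y b : cpair beta T T' -> T' (y *< b) = T' y *< b.
Proof.
move=> hT; apply/eqP; rewrite -subr_eq0; apply/eqP.
apply: (nrm_smallM (C := nrm (y *< b) + nrm y * nrm b)) => e e0.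
have [S [S' [hS _ bS]]] := hT e e0; have [_ [V' [_ _ SV]]] := frpair_adj hS.
have -> : T' (y *< b) - T' y *< b = (T' - S') (y *< b) - (T' - S') y *< b.
  rewrite -![(T' - S') _]/(T' _ - S' _) (adjoint_ract _ _ SV) ractBl; zmod_eq.
apply: le_trans (nrmB _ _) _.
have h1 := bS (y *< b); have h2 := nrm_ract ((T' - S') y) b; have h3 := bS y.
have : nrm ((T' - S') y) * nrm b <= e * nrm y * nrm b by rewrite ler_wpM2r ?nrm_ge0.
lra.
Qed.

Lemma cpair_comp S (S' : Y -> Y) T (T' : Y -> Y) :
  cpair beta S S' -> cpair beta T T' -> cpair beta (S \o T) (S' \o T').
Proof.
move=> hS hT e e0; have [[l l0 Tl] [l' l0' Tl']] := cpair_bounded hT.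
have c0 : 0 < l + l' + 1 by lra.
have e2 : 0 < e / 2 by rewrite divr_gt0.
have [S1 [S1' [hS1 b b']]] := hS (e / 2 / (l + l' + 1)) (divr_gt0 e2 c0).
have [V [V' [_ SV SV']]] := frpair_adj hS1.
have [[k k0 Sk] [k' k0' Sk']] := frpair_bounded hS1.
have [T1 [T1' [hT1 c c']]] := cpair_left Sk Sk' SV SV'
  (fun x => frpair_intertwine mm x hS1) hT e2.
exists T1, T1'; split=> //.
- have le : e / 2 / (l + l' + 1) * l <= e / 2.
    by rewrite -mulrA ger_pMr// mulrC ler_pdivrMr// mul1r; lra.
  have -> : e = e / 2 + e / 2 by lra.
  move=> x; have h := bop_comp (ltW (divr_gt0 e2 c0)) b Tl.
  have := bopD (bop_le le h) c x; congr (nrm _ <= _).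
  rewrite -[((S1 \o T) - T1) x]/(S1 (T x) - T1 x) -[((S - S1) \o T) x]/(S (T
    x) - S1 (T x)).
  by rewrite -[((S \o T) - T1) x]/(S (T x) - T1 x); zmod_eq.
- have le : e / 2 / (l + l' + 1) * l' <= e / 2.
    by rewrite -mulrA ger_pMr// mulrC ler_pdivrMr// mul1r; lra.
  have -> : e = e / 2 + e / 2 by lra.
  move=> x; have h := bop_comp (ltW (divr_gt0 e2 c0)) b' Tl'.
  have := bopD (bop_le le h) c' x; congr (nrm _ <= _).
  rewrite -[((S1' \o T') - T1') x]/(S1' (T' x) - T1' x).
  rewrite -[((S' - S1') \o T') x]/(S' (T' x) - S1' (T' x)).
  by rewrite -[((S' \o T') - T1') x]/(S' (T' x) - T1' x); zmod_eq.
Qed.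

Lemma induced_exists : exists b1, induced_on_compacts beta b1 /\
  forall T (T' : Y -> Y), cpair beta T T' -> b1 T = T'.
Proof.
have ex T : exists T' : Y -> Y, compact_op T -> cpair beta T T'.
  have [/compact_cpair[T' hT]|nT] := pselect (compact_op T); first by exists T'.
  by exists 0.
have [b1 b1P] := choice ex.
have b1E T (T' : Y -> Y) : cpair beta T T' -> b1 T = T'.
  move=> hT; have [cT _] := cpair_compact hT; exact: cpair_uniq (b1P T cT) hT.
exists b1; split=> //; split.
- by move=> T cT; case: (cpair_compact (b1P T cT)).
- by move=> k S T cS cT; apply: b1E; apply: cpair_comb; apply: b1P.
- by move=> S T cS cT; apply: b1E; apply: cpair_comp; apply: b1P.
- by move=> T V cT cV; apply: cpair_adj; apply: b1P.
- move=> T k cT k0 Tk; have [kE k0'] : k = (complex.Re k)%:C /\ 0 <= complex.Re k.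
    split; first by rewrite RRe_real// ger0_real.
    by move: k0; rewrite lecE /= => /andP[].
  rewrite kE; apply/op_boundedE; apply: (cpair_bop k0' (b1P T cT)).
  by apply/op_boundedE; rewrite -kE.
- by move=> x y; apply: b1E; apply: frpair_cpair; apply: frpair_mem.
Qed.

(** Linearity and the values on [theta] determine b1 at finite rank; the norm bound does the rest.
    Hence any b1 supplied by a covariance hypothesis can be traded for the graph. *)
Lemma induced_cpair b1 T : induced_on_compacts beta b1 -> compact_op T ->
  cpair beta T (b1 T).
Proof.
move=> hb cT e e0; have /compactP/(_ e e0)[S sS bS] := cT.
have cS (U : X -> X) : ispan [set theta x y | x in setT & y in setT] U -> compact_op U.
  by move=> sU; apply/compactP => d d0; exists U; rewrite // subrr; apply/bop0/ltW.
have b0 : b1 0 = 0.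
  have := induced_linear hb (-1) (cS 0 (ispan0 _)) (cS 0 (ispan0 _)).
  by rewrite scaler0 addr0 scaleN1r addNr.
have fr : frpair beta S (b1 S).
  elim: sS => [|k s v ms sv IH]; first by rewrite b0; left.
  rewrite (induced_linear hb)//; [|exact/cS/ispan_mem|exact: cS].
  apply: frpairD => //; apply: (frpairZ mm).
  by case: ms => x _ [y _ <-]; rewrite (induced_theta hb); exact: frpair_mem.
exists S, (b1 S); split=> //.
have cTS : compact_op (T - S).
  apply/compactP => d d0; have /compactP/(_ d d0)[W sW bW] := cT.
  exists (W - S); first by rewrite addrC -scaleN1r; apply: ispan_lin.
  by move=> x; have := bW x; congr (nrm _ <= _); rewrite -[LHS]/(T x - W x)
    -[RHS]/(T x - S x - (W x - S x)); zmod_eq.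
have -> : b1 T - b1 S = b1 (T - S).
  have := induced_linear hb (-1) (cS S sS) cT.
  by rewrite !scaleN1r ![- _ + _]addrC => ->.
have e0' : 0 <= e%:C by rewrite (@lecR R 0) ltW.
by apply/op_boundedE; apply: (induced_bounded hb cTS e0'); apply/op_boundedE.
Qed.

End CPair.

Section CPairTrans.
Variables (R : realType) (A B C : cstarAlgType R) (X : hilbertModType A)
  (Y : hilbertModType B) (Z : hilbertModType C) (a1 : A -> B) (b1 : X -> Y)
  (a2 : B -> C) (b2 : Y -> Z).
Hypotheses (m1 : mod_morphism a1 b1) (m2 : mod_morphism a2 b2).

Lemma mod_morphism_comp : mod_morphism (a2 \o a1) (b2 \o b1).
Proof.
have [[l1 M1 s1] lb1 i1 r1] := m1; have [[l2 M2 s2] lb2 i2 r2] := m2.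
split; first split.
- by move=> k x y /=; rewrite l1 l2.
- by move=> x y /=; rewrite M1 M2.
- by move=> x /=; rewrite s1 s2.
- by move=> k x y /=; rewrite lb1 lb2.
- by move=> x y /=; rewrite i2 i1.
- by move=> x a /=; rewrite r1 r2.
Qed.

(** Finite-rank pairs compose term by term, and [cpair_bop] for the second morphism carries the
    estimate to Z. *)
Lemma cpair_trans (T : X -> X) (T' : Y -> Y) (T'' : Z -> Z) :
  cpair b1 T T' -> cpair b2 T' T'' -> cpair (b2 \o b1) T T''.
Proof.
move=> h1 h2 e e0; have [S [S' [hS b b']]] := h1 e e0.
have [S'' hS' hS''] : exists2 S'' : Z -> Z, frpair b2 S' S'' & frpair (b2 \o b1) S S''.
  elim: hS => [|x y U U' _ [U'' IH IH']]; first by exists 0; left.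
  by exists (theta (b2 (b1 x)) (b2 (b1 y)) + U''); right.
exists S, S''; split=> //.
have h := cpairB m2 h2 (frpair_cpair hS').
exact: (cpair_bop m2 (ltW e0) h b').
Qed.

End CPairTrans.

(** * Density arguments and finite-rank approximate units *)

Section Dense.
Variables (R : realType).

Lemma dense_approx (V : normedModType R[i]) (S : set V) x e :
  closed_span S = setT -> 0 < e -> exists2 y, ispan S y & nrm (x - y) <= e.
Proof.
move=> dS e0; have : closed_span S x by rewrite dS.
by move=> /closureP/(_ e e0)[y /spanP sy xy]; exists y.
Qed.

Lemma dense_eq (V W : normedModType R[i]) (S : set V) (F G : V -> W) k l :
  closed_span S = setT -> linear F -> linear G -> bop F k -> bop G l ->
  (forall s, S s -> F s = G s) -> forall x, F x = G x.
Proof.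
move=> dS lF lG Fk Gl h x; apply/eqP; rewrite -subr_eq0; apply/eqP.
have [{}k k0 {}Fk] := bop_max Fk; have [{}l l0 {}Gl] := bop_max Gl.
apply: (nrm_smallM (C := k + l)) => e e0.
have [y sy xy] := dense_approx x dS e0.
have e1 : F y = G y.
  elim: sy => [|c s v Ss _ IH]; first by rewrite (lin0 lF) (lin0 lG).
  by rewrite lF lG IH h.
have -> : F x - G x = F (x - y) - G (x - y).
  by rewrite (linB lF) (linB lG) e1; zmod_eq.
apply: le_trans (nrmB _ _) _; rewrite mulrDl lerD//.
  by rewrite (le_trans (Fk _))// ler_wpM2l.
by rewrite (le_trans (Gl _))// ler_wpM2l.
Qed.

Lemma star_hom_ext (O C : cstarAlgType R) (S : set O) (f g : O -> C) :
  cstar_generated S -> star_hom f -> star_hom g -> (forall s, S s -> f s = g s) ->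
  forall x, f x = g x.
Proof.
move=> gS hf hg h x; have [lf fM fS] := hf; have [lg gM gS'] := hg.
suff : [set y | f y = g y] = setT by move=> E;
  have : [set y | f y = g y] x by rewrite E.
apply: gS => [|y /closureP cy|s /h//]; first split.
- by rewrite /= (lin0 lf) (lin0 lg).
- by move=> k a b /= ea eb; rewrite lf lg ea eb.
- by move=> a b /= ea eb; rewrite fM gM ea eb.
- by move=> a /= ea; rewrite fS gS' ea.
apply/eqP; rewrite -subr_eq0; apply/eqP.
apply: (nrm_smallM (C := 2)) => e e0; have [z zE yz] := cy e e0.
have -> : f y - g y = f (y - z) - g (y - z).
  by rewrite (linB lf) (linB lg) zE; zmod_eq.
apply: le_trans (nrmB _ _) _.
have := star_hom_contr (y - z) hf; have := star_hom_contr (y - z) hg; lra.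
Qed.

End Dense.

Section ApproximateUnit.
Variables (R : realType) (A B : cstarAlgType R) (X : hilbertModType A)
  (Y : hilbertModType B) (alpha : A -> B) (beta : X -> Y).
Hypothesis mm : mod_morphism alpha beta.

(** Contractivity is asked of 1 - E' and not of E', because it is the factors 1 - E' that get
    multiplied. *)
Definition frunit (E : X -> X) (E' : Y -> Y) :=
  frpair beta E E' /\ bop (fun y => y - E' y) 1.

Lemma frpair_lin (E : X -> X) (E' : Y -> Y) : frpair beta E E' -> linear E /\ linear E'.
Proof.
by move=> /frpair_adj[V [V' [_ /adjoint_lin l /adjoint_lin l']]].
Qed.

Lemma frunit0 : frunit 0 0.
Proof. by split; [left|move=> y; rewrite -[(0 : Y -> Y) y]/(0 : Y) subr0 mul1r]. Qed.

(** G is defined by 1 - G = (1 - F)(1 - E). What E has made small stays small, and F can be chosen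
    for the remainder. *)
Lemma frunit_comp (E F : X -> X) (E' F' : Y -> Y) : frunit E E' -> frunit F F' ->
  exists G G', [/\ frunit G G',
    forall x, x - G x = (x - E x) - F (x - E x) &
    forall y, y - G' y = (y - E' y) - F' (y - E' y)].
Proof.
move=> [hE E1] [hF F1]; have [lF lF'] := frpair_lin hF.
exists (E + F - (F \o E)), (E' + F' - (F' \o E')).
have h x : x - (E' + F' - (F' \o E')) x = (x - E' x) - F' (x - E' x).
  by rewrite (linB lF') -[(_ - _) x]/(E' x + F' x - F' (E' x)); zmod_eq.
split=> //.
- split; first by apply: (frpairB mm); [exact: frpairD|exact: (frpair_comp mm)].
  move=> y; rewrite h mul1r; have := F1 (y - E' y); have := E1 y; rewrite !mul1r.
  by move=> h1 h2; rewrite (le_trans h2).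
- by move=> x; rewrite (linB lF) -[(_ - _) x]/(E x + F x - F (E x)); zmod_eq.
Qed.

(* E = 1 - (1 - theta x x)^n, with x scaled into the unit ball. *)
Lemma frunit_vec (x : X) e : 0 < e ->
  exists E E', frunit E E' /\ nrm (x - E x) <= e.
Proof.
have main (u : X) d : nrm u <= 1 -> 0 < d ->
  exists E E', frunit E E' /\ nrm (u - E u) <= d.
  move=> u1 d0; have [n hn] := sub_theta_iter u1 d0.
  have [E [E' [hE EE]]] : exists E E', frunit E E' /\
      forall x, x - E x = iter n (fun z => z - theta u u z) x.
    elim: n {hn} => [|n [E [E' [hE IH]]]].
      by exists 0, 0; split; [exact: frunit0|move=> z;
        rewrite -[(0 : X -> X) z]/(0 : X) subr0].
    have hT : frunit (theta u u) (theta (beta u) (beta u)).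
      split; first exact: frpair_mem.
      by apply: sub_theta_bop; rewrite (le_trans (mm_contr mm _)).
    have [G [G' [hG GE _]]] := frunit_comp hE hT.
    by exists G, G'; split=> // z; rewrite GE IH iterS.
  by exists E, E'; split=> //; rewrite EE.
move=> e0; pose c := (nrm x + 1)^-1;
  have x1 : 0 < nrm x + 1 by rewrite ltr_wpDl ?nrm_ge0.
have c0 : 0 < c by rewrite invr_gt0.
have [|E [E' [hE h]]] := main (c%:C *: x) (c * e) _ (mulr_gt0 c0 e0).
  by rewrite nrmZr ger0_norm ?(ltW c0)// /c ler_pdivrMl// mulr1 lerDl.
have [lE _] := frpair_lin hE.1.
exists E, E'; split=> //; move: h; rewrite (linZ lE) -scalerBr nrmZr.
by rewrite ger0_norm ?(ltW c0)// ler_pM2l.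
Qed.

End ApproximateUnit.

(** * The map beta *)

Section InSplitBeta.
Variables (R : realType) (A : cstarAlgType R) (X : hilbertModType A)
  (phi : A -> X -> X) (B : cstarAlgType R) (alpha : A -> B) (psi : B -> X -> X)
  (Y : hilbertModType B) (tens : X -> B -> Y) (rho : B -> Y -> Y).
Hypotheses (su : sigma_unital A)
  (isp : in_split phi alpha psi) (tp : tensor_product alpha tens)
  (ao : in_split_action_on psi tens rho).

Let halpha : star_hom alpha := in_split_hom isp.
Let alpha_lin : linear alpha := star_hom_linear halpha.
Let apsi : left_action psi := in_split_action isp.
Let arho : left_action rho := ao.1.
Let rho_tens c x b : rho c (tens x b) = tens (psi c x) b := ao.2 c x b.

Lemma tens_inner_ract z a z' a' :
  inner (tens z (alpha a)) (tens z' (alpha a')) = alpha (inner (z *< a) (z' *< a')).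
Proof.
rewrite (tensor_inner tp) inner_ract inner_ractl.
by rewrite !(star_hom_mul halpha) (star_hom_star halpha).
Qed.

(** The inner products of the tensors z (x) alpha(a) depend only on the products za, so two
    factorisations of one vector give tensors at distance 0. *)
Lemma beta_exists : exists beta : X -> Y,
  forall z a, beta (z *< a) = tens z (alpha a).
Proof.
have ex x : exists za : X * A, x = za.1 *< za.2.
  by have [z [a ->]] := cohen_factorization x su; exists (z, a).
have [f fP] := choice ex; exists (fun x => tens (f x).1 (alpha (f x).2)) => z a.
apply/eqP; rewrite -subr_eq0; apply/eqP/inner_eq0.
rewrite !(innerBl, innerBr) !tens_inner_ract -(fP (z *< a)); zmod_eq.
Qed.

Variable beta : X -> Y.
Hypothesis betaE : forall z a, beta (z *< a) = tens z (alpha a).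

Lemma beta_inner x y : inner (beta x) (beta y) = alpha (inner x y).
Proof.
have [z [a ->]] := cohen_factorization x su;
  have [w [b ->]] := cohen_factorization y su.
by rewrite !betaE tens_inner_ract.
Qed.

(** Preserving inner products forces linearity: the defect is orthogonal to beta(X) and is a
    combination of vectors in it. *)
Lemma beta_linear : linear beta.
Proof.
move=> k x y; apply/eqP; rewrite -subr_eq0; apply/eqP; set v := _ - _.
have h w : inner (beta w) v = 0.
  rewrite /v innerBr innerDr innerZr !beta_inner innerDr innerZr alpha_lin.
  by rewrite subrr.
by apply: inner_eq0; rewrite {1}/v innerBl innerDl innerZl !h scaler0; zmod_eq.
Qed.

Lemma beta_tens x b : beta x *< b = tens x b.
Proof.
have [z [a ->]] := cohen_factorization x su.
by rewrite betaE (tensor_right tp) (tensor_balanced tp).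
Qed.

Lemma beta_ract x a : beta (x *< a) = beta x *< alpha a.
Proof. by rewrite betaE beta_tens. Qed.

Lemma beta_mm : mod_morphism alpha beta.
Proof. by split=> //; [exact: beta_linear|exact: beta_inner|exact: beta_ract]. Qed.

Lemma beta_isom x : nrm (beta x) = nrm x.
Proof.
apply/eqP; rewrite -(@eqrXn2 _ 2)// ?nrm_ge0// -!nrm_inner beta_inner.
by rewrite (star_hom_isom _ halpha (in_split_inj isp)).
Qed.

Lemma beta_inj : injective beta.
Proof.
move=> x y h; apply/eqP; rewrite -subr_eq0; apply/eqP/nrm_eq0.
by rewrite -beta_isom (linB beta_linear) h subrr nrm0.
Qed.

Lemma rho_beta c x : rho c (beta x) = beta (psi c x).
Proof.
have [z [a ->]] := cohen_factorization x su.
by rewrite (act_ract apsi) !betaE rho_tens.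
Qed.

Lemma tens_dense_eq (W : normedModType R[i]) (F G : Y -> W) k l :
  linear F -> linear G -> bop F k -> bop G l ->
  (forall x b, F (tens x b) = G (tens x b)) -> forall y, F y = G y.
Proof.
move=> lF lG Fk Gl h; apply: (dense_eq (tensor_dense tp) lF lG Fk Gl).
by move=> _ [x _ [b _ <-]].
Qed.

Lemma ker_rho c : rho c = 0 <-> psi c = 0.
Proof.
split=> h; apply/funext.
  move=> x; apply: beta_inj; rewrite -rho_beta h.
  by rewrite [RHS](lin0 beta_linear).
apply: (tens_dense_eq (k := nrm c) (l := 0)) => [||||x b].
- exact: act_linx arho c.
- by move=> k x y; rewrite -![(0 : Y -> Y) _]/(0 : Y) scaler0 addr0.
- exact: act_bop arho c.
- exact: bop0.
- by rewrite rho_tens h -beta_tens [beta _](lin0 beta_linear) ract0l.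
Qed.

(** Both operators commute with the right action and agree on beta(X); the vectors beta(x)b are the
    elementary tensors, whose span is dense. *)
Lemma cpair_psi_rho c : compact_op (psi c) -> cpair beta (psi c) (rho c).
Proof.
move=> /(compact_cpair beta_mm)[T' hT]; suff -> : rho c = T' by [].
have [_ [k _ Tk]] := cpair_bounded hT.
apply/funext; apply: (tens_dense_eq _ _ (act_bop arho c) Tk).
- exact: act_linx arho c.
- exact: cpair_linear hT.
move=> x b; rewrite -beta_tens (cpair_ract _ _ hT) (cpair_intertwine beta_mm _ hT).
by rewrite -rho_beta (act_ract arho).
Qed.

(** Once E nearly fixes the earlier tensors, F is chosen for x - E x. Dividing by c + 1 instead of c
    allows a zero coefficient. *)
Lemma frunit_tens (u : Y) e : ispan [set tens x b | x in setT & b in setT] u ->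
  0 < e -> exists E E', frunit beta E E' /\ nrm (u - E' u) <= e.
Proof.
move=> su_; elim: su_ e => [|k s v [x _ [b _ <-]] _ IH] e e0.
  exists 0, 0; split; first exact: frunit0.
  by rewrite -[(0 : Y -> Y) _]/(0 : Y) subrr nrm0 ltW.
have [E [E' [hE Ev]]] := IH _ (pos_half e0).
pose c := complex.Re `|k| * nrm b.
have k0 : 0 <= complex.Re `|k| by rewrite normc_def sqrtr_ge0.
have c0 : 0 <= c by rewrite mulr_ge0 ?nrm_ge0.
have c1 : 0 < c + 1 by lra.
have [F [F' [hF Fw]]] := frunit_vec beta_mm (x - E x) (divr_gt0 (pos_half e0) c1).
have [G [G' [hG _ GE]]] := frunit_comp beta_mm hE hF.
exists G, G'; split=> //; rewrite GE.
have [lE lE'] := frpair_lin hE.1; have [lF lF'] := frpair_lin hF.1.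
have ract' (D : X -> X) (D' : Y -> Y) z : frpair beta D D' ->
    tens z b - D' (tens z b) = tens (z - D z) b.
  move=> hD; have [V [V' [_ _ hV]]] := frpair_adj hD.
  rewrite -!beta_tens (adjoint_ract _ _ hV) -ractBl (frpair_intertwine beta_mm _ hD).
  by rewrite (linB beta_linear).
have -> : k *: tens x b + v - E' (k *: tens x b + v) =
    k *: tens (x - E x) b + (v - E' v).
  by rewrite (linD lE') (linZ lE') -(ract' _ _ _ hE.1) scalerBr; zmod_eq.
set w := x - E x in Fw *; set q := v - E' v in Ev *.
have -> : k *: tens w b + q - F' (k *: tens w b + q) =
    k *: tens (w - F w) b + (q - F' q).
  by rewrite (linD lF') (linZ lF') -(ract' _ _ _ hF.1) scalerBr; zmod_eq.
apply: le_trans (nrmD _ _) _.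
have h1 := hF.2 q; rewrite mul1r in h1.
have h2 : nrm (k *: tens (w - F w) b) <= e / 2.
  rewrite nrmZ -beta_tens.
  have := nrm_ract (beta (w - F w)) b; rewrite beta_isom => h3.
  have h4 : nrm (w - F w) * nrm b <= e / 2 / (c + 1) * nrm b
    by rewrite ler_wpM2r ?nrm_ge0.
  have h5 := ler_wpM2l k0 (le_trans h3 h4); apply: le_trans h5 _.
  have -> : complex.Re `|k| * (e / 2 / (c + 1) * nrm b) = e / 2 * (c / (c + 1)).
    by rewrite /c; ring.
  by rewrite ger_pMr ?pos_half// ler_pdivrMr// mul1r lerDl.
by lra.
Qed.

Lemma frunit_elt (u : Y) e : 0 < e ->
  exists E E', frunit beta E E' /\ nrm (u - E' u) <= e.
Proof.
move=> e0; have [v sv uv] := dense_approx u (tensor_dense tp) (pos_half e0).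
have [E [E' [hE Ev]]] := frunit_tens sv (pos_half e0).
exists E, E'; split=> //; have [_ lE'] := frpair_lin hE.1.
have -> : u - E' u = (u - v - E' (u - v)) + (v - E' v) by rewrite (linB lE'); zmod_eq.
apply: le_trans (nrmD _ _) _; have := hE.2 (u - v); rewrite mul1r; lra.
Qed.

(** It is the left vectors u of the summands theta u v that have to be nearly fixed; the right ones
    enter through |v| in the tolerance. *)
Lemma frunit_compact (S : Y -> Y) e : ispan [set theta x y | x in setT & y in setT] S ->
  0 < e -> exists E E', frunit beta E E' /\ bop (fun y => S y - E' (S y)) e.
Proof.
move=> sS; elim: sS e => [|k s S' [u _ [v _ <-]] _ IH] e e0.
  exists 0, 0; split; first exact: frunit0.
  by move=> y; rewrite -![(0 : Y -> Y) _]/(0 : Y) subrr nrm0 mulr_ge0 ?nrm_ge0// ltW.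
have [E [E' [hE ES]]] := IH _ (pos_half e0).
pose c := complex.Re `|k| * nrm v.
have k0 : 0 <= complex.Re `|k| by rewrite normc_def sqrtr_ge0.
have c0 : 0 <= c by rewrite mulr_ge0 ?nrm_ge0.
have c1 : 0 < c + 1 by lra.
have [F [F' [hF Fu]]] := frunit_elt (u - E' u) (divr_gt0 (pos_half e0) c1).
have [G [G' [hG _ GE]]] := frunit_comp beta_mm hE hF.
exists G, G'; split=> // y; rewrite GE.
have [_ lE'] := frpair_lin hE.1; have [_ lF'] := frpair_lin hF.1.
have [_ [V' [_ _ hV]]] := frpair_adj hE.1; have [_ [W' [_ _ hW]]] := frpair_adj hF.1.
rewrite -[(k *: theta u v + S') y]/(k *: (u *< inner v y) + S' y).
set a := inner v y.
have -> : k *: (u *< a) + S' y - E' (k *: (u *< a) + S' y) =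
    k *: ((u - E' u) *< a) + (S' y - E' (S' y)).
  by rewrite (linD lE') (linZ lE') (adjoint_ract _ _ hV) ractBl scalerBr; zmod_eq.
set w := u - E' u in Fu *; set q := S' y - E' (S' y).
have -> : k *: (w *< a) + q - F' (k *: (w *< a) + q) =
    k *: ((w - F' w) *< a) + (q - F' q).
  by rewrite (linD lF') (linZ lF') (adjoint_ract _ _ hW) ractBl scalerBr; zmod_eq.
apply: le_trans (nrmD _ _) _.
have h1 := hF.2 q; rewrite mul1r in h1; have h1' := ES y; rewrite -/q in h1'.
have h2 : nrm (k *: ((w - F' w) *< a)) <= e / 2 * nrm y.
  rewrite nrmZ; have h3 := nrm_ract (w - F' w) a.
  have h4 : nrm (w - F' w) * nrm a <= e / 2 / (c + 1) * (nrm v * nrm y).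
    by apply: ler_pM; rewrite ?nrm_ge0//; exact: cauchy_schwarz.
  have h5 := ler_wpM2l k0 (le_trans h3 h4); apply: le_trans h5 _.
  have -> : complex.Re `|k| * (e / 2 / (c + 1) * (nrm v * nrm y)) =
     e / 2 * (c / (c + 1)) * nrm y by rewrite /c; ring.
  rewrite ler_wpM2r ?nrm_ge0//.
  by rewrite ger_pMr ?pos_half// ler_pdivrMr// mul1r lerDl.
by lra.
Qed.

(** The composite of E with psi(c) has finite rank. Its distance to psi(c) is measured after
    applying the isometry beta, where it is (1 - E') rho(c), small since rho(c) is close to S. *)
Lemma compact_rho_psi c : compact_op (rho c) -> compact_op (psi c).
Proof.
move=> /compactP hc; apply/compactP => e e0; have [S sS bS] := hc _ (pos_half e0).
have [E [E' [hE ES]]] := frunit_compact sS (pos_half e0).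
have [lE lE'] := frpair_lin hE.1.
exists (E \o psi c).
  have hr := frpair_right (act_adj apsi c) (act_adj arho c) _ hE.1.
  by have [|//] := frpair_ispan (hr _) => x; exact: rho_beta.
move=> x; rewrite -[(_ - _) x]/(psi c x - E (psi c x)) -beta_isom (linB beta_linear).
rewrite -(frpair_intertwine beta_mm _ hE.1) -rho_beta -[X in e * X]beta_isom.
set y := beta x.
have -> : rho c y - E' (rho c y) =
   ((rho c - S) y - E' ((rho c - S) y)) + (S y - E' (S y)).
  by rewrite -![(rho c - S) y]/(rho c y - S y) (linB lE'); zmod_eq.
apply: le_trans (nrmD _ _) _.
have := hE.2 ((rho c - S) y); have := bS y; have := ES y; rewrite mul1r; lra.
Qed.

Lemma covariance_ideal_rho c : covariance_ideal rho c <-> covariance_ideal psi c.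
Proof.
split=> [[hc ann]|[hc ann]]; split.
- exact: compact_rho_psi.
- by move=> d /ker_rho; exact: ann.
- by have [_] := cpair_compact (cpair_psi_rho hc).
- by move=> d /ker_rho; exact: ann.
Qed.

End InSplitBeta.

(** * Covariance through the graph, and the covariance ideal *)

Section Covariant.
Variables (R : realType).

Lemma covariant_cpair (A B : cstarAlgType R) (X : hilbertModType A) (phiX : A -> X -> X)
    (Y : hilbertModType B) (phiY : B -> Y -> Y) (a : A -> B) (b : X -> Y) :
  covariant_morphism phiX phiY a b ->
  mod_morphism a b /\ forall c, covariance_ideal phiX c ->
    cpair b (phiX c) (phiY (a c)).
Proof.
move=> [[h l i r _] [b1 hb cov]]; have mm : mod_morphism a b by split.
by split=> // c hc; rewrite -cov//; exact: (induced_cpair mm hb hc.1).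
Qed.

Lemma cpair_covariant (A B : cstarAlgType R) (X : hilbertModType A) (phiX : A -> X -> X)
    (Y : hilbertModType B) (phiY : B -> Y -> Y) (a : A -> B) (b : X -> Y) :
  mod_morphism a b -> (forall c x, b (phiX c x) = phiY (a c) (b x)) ->
  (forall c, covariance_ideal phiX c -> cpair b (phiX c) (phiY (a c))) ->
  covariant_morphism phiX phiY a b.
Proof.
move=> mm left_ cov; have [h l i r] := mm; split; first by split.
by have [b1 [hb b1E]] := induced_exists mm; exists b1 => // c /cov/b1E.
Qed.

(** Each [theta x y] is left multiplication by x y^*, and [lmul] is isometric, so norm limits are
    again left multiplications. *)
Lemma compact_self (C : cstarAlgType R) (T : self_module C -> self_module C) :
  compact_op T -> exists c : C, T = lmul c.
Proof.
move=> /compactP hT.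
have sp S : ispan [set theta x y | x in [set: self_module C] & y in [set:
  self_module C]] S ->
    exists c : C, S = lmul c.
  elim=> [|k s v [x _ [y _ <-]] _ [c ->]].
    by exists 0; apply/funext => x; rewrite lmulE cmul0l.
  exists (k *: (x ** star y : C) + c); apply/funext => z.
  rewrite lmulD lmulZ eaddE escaleE -[LHS]/(k *: theta x y z + lmul c z).
  by rewrite /theta ract_self inner_self lmulE cmulA.
pose d n : R := n.+1%:R^-1.
have d0 n : 0 < d n := invS_gt0 R n.
have dh n m : (n <= m)%N -> d m <= d n := @invS_le R n m.
have dv e : 0 < e -> exists N, d N <= e := @invS_small R e.
have ex n : exists c : C, bop (T - lmul c) (d n).
  by have [S /sp[c ->] b] := hT _ (d0 n); exists c.
have [f fP] := choice ex.
have fD n m : (n <= m)%N -> nrm (f m - f n) <= 2 * d n.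
  move=> nm; apply: bop_lmul; first by rewrite mulr_ge0// ltW.
  have le : d n + d m <= 2 * d n by have := dh _ _ nm; lra.
  move=> x; have := bop_le le (bopB (fP n) (fP m)) x; congr (nrm _ <= _).
  by rewrite lmulB eaddE eoppE -![(T - _) x]/(T x - _ x); zmod_eq.
have [e e0|c cP] := @lim_exists R C f (fun n => 2 * d n) fD.
  by have [N hN] := dv (e / 2) (pos_half e0); exists N; lra.
exists c; apply/funext => x; apply/eqP; rewrite -subr_eq0; apply/eqP.
apply: (nrm_smallM (C := 3 * nrm x)) => e e0; have [N hN] := dv _ e0.
have -> : T x - lmul c x = (T - lmul (f N)) x - lmul (c - f N) x.
  by rewrite lmulB eaddE eoppE -[(T - _) x]/(T x - lmul (f N) x); zmod_eq.
apply: le_trans (nrmB _ _) _.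
have h1 := fP N x; have h2 := lmul_bop (c - f N) x; have n0 := nrm_ge0 x.
have h3 : d N * nrm x <= e * nrm x by rewrite ler_wpM2r.
have h4 : nrm (c - f N) * nrm x <= 2 * d N * nrm x by rewrite ler_wpM2r.
by lra.
Qed.

(** For the identity morphism the graph is equality on compact operators, so the [cpair] lemmas give
    the closure properties of the compacts. *)
Lemma mm_id (A : cstarAlgType R) (X : hilbertModType A) :
  mod_morphism (@id A) (@id X).
Proof. by []. Qed.

Section Ideal.
Variables (A B : cstarAlgType R) (X : hilbertModType A) (psi : B -> X -> X).
Hypothesis act : left_action psi.
Let J := covariance_ideal psi.

Let mmX : mod_morphism (@id A) (@id X) := mm_id X.

Lemma compact_comb k (S T : X -> X) :
  compact_op S -> compact_op T -> compact_op (k *: S + T).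
Proof.
move=> /(compact_cpair mmX)[S' hS] /(compact_cpair mmX)[T' hT].
by have [] := cpair_compact (cpair_comb mmX k hS hT).
Qed.

Lemma ideal0 : J 0.
Proof.
split; last by move=> c _; exact: cmul0l.
by rewrite (lin0 (act_lin act)); case: (cpair_compact (cpair0 (@id X))).
Qed.

Lemma ideal_comb k b c : J b -> J c -> J (k *: b + c).
Proof.
move=> [hb ab] [hc ac]; split.
  by rewrite (left_action_linear act); exact: compact_comb.
by move=> d hd; rewrite cmulDl cmulZl ab// ac// scaler0 addr0.
Qed.

Lemma idealB b c : J b -> J c -> J (b - c).
Proof. by move=> hb hc; rewrite addrC -scaleN1r; exact: ideal_comb. Qed.

Lemma idealD b c : J b -> J c -> J (b + c).
Proof. by move=> hb hc; rewrite -[b]scale1r; exact: ideal_comb. Qed.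

Lemma ideal_mull b c : J c -> J (b ** c).
Proof.
move=> [hc ac]; split; last by move=> d hd; rewrite -cmulA ac// cmul0r.
rewrite (left_action_mul act); have [T' hT] := compact_cpair mmX hc.
have e : psi c = T' by apply/funext => x; rewrite [RHS](cpair_intertwine mmX x hT).
rewrite -e in hT.
have := cpair_left (act_bop act b) (act_bop act b) (act_adj act b) (act_adj act b)
  (fun x => erefl) hT.
by case/cpair_compact.
Qed.

(** The annihilator condition has c on the left. The C*-identity for c^* d brings c in front of c^*
    d, which lies in the kernel along with d. *)
Lemma ideal_star c : J c -> J (star c).
Proof.
move=> [hc ac]; split.
  have [T' hT] := compact_cpair mmX hc.
  have [V' hV _] := cpair_adj_ex mmX hT (act_adj act c).
  by case: (cpair_compact hV).
move=> d hd; apply: nrm_eq0; apply/eqP; rewrite -sqrf_eq0 -nrm_star_mul.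
rewrite starM starK -cmulA [X in _ ** X]ac ?cmul0r ?nrm0//.
rewrite (left_action_mul act) hd; apply/funext => x.
exact: lin0 (act_linx act _).
Qed.

Lemma ideal_mulr b c : J c -> J (c ** b).
Proof.
by move=> hc; rewrite -[c ** b]starK starM; apply/ideal_star/ideal_mull/ideal_star.
Qed.

End Ideal.

(** A relation is used in place of a function on a subspace: contractivity gives well-definedness
    and the extension to the closure at once. *)
Lemma extend_by_density (V : normedModType R[i]) (W : completeNormedModType R[i])
    (G : V -> W -> Prop) :
  (forall k v w v' w', G v w -> G v' w' -> G (k *: v + v') (k *: w + w')) ->
  (forall v w, G v w -> nrm w <= nrm v) ->
  (forall v e, 0 < e -> exists v' w', G v' w' /\ nrm (v - v') <= e) ->
  exists f : V -> W, [/\ linear f, bop f 1 & forall v w, G v w -> f v = w].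
Proof.
move=> Glin Gc Gd.
have G00 : G 0 0.
  have [v [w [h _]]] := Gd 0 1 ltr01.
  by have := Glin (-1) _ _ _ _ h h; rewrite !scaleN1r !addNr.
have GB v w v' w' : G v w -> G v' w' -> G (v - v') (w - w').
  by move=> h h'; have := Glin (-1) _ _ _ _ h' h; rewrite !scaleN1r ![- _ + _]addrC.
pose d n : R := n.+1%:R^-1.
have d0 n : 0 < d n := invS_gt0 R n.
have dh n m : (n <= m)%N -> d m <= d n := @invS_le R n m.
have dv e : 0 < e -> exists N, d N <= e := @invS_small R e.
pose clG v l := forall e : R, 0 < e -> exists v' w',
  [/\ G v' w', nrm (v - v') <= e & nrm (l - w') <= e].
have ex v : exists l, clG v l.
  have ex n : exists vw : V * W, G vw.1 vw.2 /\ nrm (v - vw.1) <= d n.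
    by have [v' [w' h]] := Gd v _ (d0 n); exists (v', w').
  have [f fP] := choice ex.
  have fD n m : (n <= m)%N -> nrm ((f m).2 - (f n).2) <= 2 * d n.
    move=> nm; rewrite (le_trans (Gc _ _ (GB _ _ _ _ (fP m).1 (fP n).1)))//.
    rewrite (le_trans (nrm_dist _ v _))//; have := (fP m).2; rewrite nrmBC.
    by have := (fP n).2; have := dh _ _ nm; lra.
  have [e e0|l lP] := lim_exists fD.
    by have [N hN] := dv (e / 2) (pos_half e0); exists N; lra.
  exists l => e e0; have [N hN] := dv (e / 2) (pos_half e0).
  exists (f N).1, (f N).2; have [h1 h2] := fP N; split=> //.
    by have := d0 N; lra.
  by have := lP N; lra.
have clc v l : clG v l -> nrm l <= nrm v.
  move=> h; apply/ler_addgt0Pr => e e0; have [v' [w' [h1 h2 h3]]] := h _ (pos_half e0).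
  have := nrm_dist l w' 0; rewrite !subr0; have := Gc _ _ h1.
  have := nrm_dist v' v 0; rewrite !subr0 nrmBC; lra.
have cll k v l v' l' : clG v l -> clG v' l' -> clG (k *: v + v') (k *: l + l').
  move=> h h' e e0; pose c := complex.Re `|k| + 1.
  have k0 : 0 <= complex.Re `|k| by rewrite normc_def sqrtr_ge0.
  have c0 : 0 < c by rewrite /c ltr_wpDl.
  have [u [w [h1 h2 h3]]] := h _ (divr_gt0 (pos_half e0) c0).
  have [u' [w' [h1' h2' h3']]] := h' _ (pos_half e0).
  exists (k *: u + u'), (k *: w + w'); split; first exact: Glin.
    have -> : k *: v + v' - (k *: u + u') = k *: (v - u) + (v' - u').
      by rewrite scalerBr; zmod_eq.
    rewrite (le_trans (nrmD _ _))// nrmZ; have := ler_wpM2l k0 h2.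
    have -> : complex.Re `|k| * (e / 2 / c) = e / 2 * (complex.Re `|k| / c) by ring.
    suff : e / 2 * (complex.Re `|k| / c) <= e / 2 by lra.
    by rewrite ger_pMr ?pos_half// ler_pdivrMr// mul1r /c lerDl.
  have -> : k *: l + l' - (k *: w + w') = k *: (l - w) + (l' - w').
    by rewrite scalerBr; zmod_eq.
  rewrite (le_trans (nrmD _ _))// nrmZ; have := ler_wpM2l k0 h3.
  have -> : complex.Re `|k| * (e / 2 / c) = e / 2 * (complex.Re `|k| / c) by ring.
  suff : e / 2 * (complex.Re `|k| / c) <= e / 2 by lra.
  by rewrite ger_pMr ?pos_half// ler_pdivrMr// mul1r /c lerDl.
have clu v l l' : clG v l -> clG v l' -> l = l'.
  move=> h h'; have := cll (-1) _ _ _ _ h' h; rewrite !scaleN1r addNr => /clc.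
  rewrite nrm0 => h0; apply/eqP; rewrite -subr_eq0; apply/eqP/nrm_eq0/eqP.
  by rewrite eq_le nrm_ge0 andbT addrC.
have [f fP] := choice ex; exists f; split.
- by move=> k x y; apply: clu (fP _) _; apply: cll.
- by move=> v; rewrite mul1r; exact: clc.
- move=> v w h; apply: clu (fP v) _ => e e0; exists v, w.
  by rewrite !subrr !nrm0 ltW.
Qed.

End Covariant.

(** * Extending a covariant representation from A to B *)

Section ExtendRepresentation.
Variables (R : realType) (A : cstarAlgType R) (X : hilbertModType A)
  (phi : A -> X -> X) (B : cstarAlgType R) (alpha : A -> B) (psi : B -> X -> X)
  (O : cstarAlgType R) (iA : A -> O) (iX : X -> self_module O).
Hypotheses (aphi : left_action phi) (isp : in_split phi alpha psi)
  (rep : covariant_rep phi iA iX).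

Let halpha : star_hom alpha := in_split_hom isp.
Let apsi : left_action psi := in_split_action isp.
Let mmX : mod_morphism iA iX := (covariant_cpair rep).1.
Let Jphi := covariance_ideal phi.
Let Jpsi := covariance_ideal psi.

Lemma rep_cov c : Jphi c -> cpair iX (phi c) (lmul (iA c)).
Proof. exact: (covariant_cpair rep).2. Qed.

Lemma rep_left a x : iA a ** iX x = iX (phi a x).
Proof. by rewrite (corr_morphism_left rep.1). Qed.

(** By [compact_self] the value of iX^(1) is left multiplication by an element of O, unique by
    [lift_uniq]. *)
Lemma lift_compact T : compact_op T -> exists o : O, cpair iX T (lmul o).
Proof.
move=> /(compact_cpair mmX)[T' hT]; have [_ cT'] := cpair_compact hT;
  have [c cE] := compact_self cT'.
by exists c; rewrite -cE.
Qed.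

Lemma lift_uniq T (o o' : O) : cpair iX T (lmul o) -> cpair iX T (lmul o') -> o = o'.
Proof. by move=> h h'; apply/lmul_inj/val_inj/(cpair_uniq mmX h h'). Qed.

Lemma lift_left a j k : Jpsi j -> cpair iX (psi j) (lmul k) ->
  cpair iX (psi (alpha a ** j)) (lmul (iA a ** k)).
Proof.
move=> hj hk; rewrite (left_action_mul apsi) lmulM (in_split_comp isp).
apply: (cpair_left (act_bop aphi a) (lmul_bop (iA a)) (act_adj aphi a)
  (lmul_adj _) _ hk).
by move=> x; rewrite -rep_left.
Qed.

Lemma lift_star j k : Jpsi j -> cpair iX (psi j) (lmul k) ->
  cpair iX (psi (star j)) (lmul (star k)).
Proof.
move=> hj hk; have [V hV adjV] := cpair_adj_ex mmX hk (act_adj apsi j).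
by rewrite (adjoint_uniq (lmul_adj k) adjV).
Qed.

(* pi (alpha a + j) = iA a + iX^(1) (psi j) for j in the covariance ideal. *)
Definition pi_graph (b : B) (o : O) := exists a j k,
  [/\ b = alpha a + j, Jpsi j, cpair iX (psi j) (lmul k) & o = iA a + k].

(** If alpha(a) is in J_psi, the cosets of a and 0 have the same image, so injectivity on quotients
    identifies them. *)
Lemma alpha_reflects_ideal a : Jpsi (alpha a) -> Jphi a.
Proof.
have [la _ _] := halpha; have [_ qinj _] := in_split_quotient isp.
move=> ha; have inq c : coset Jphi c \in quotient Jphi by apply/mem_set; exists c.
suff e : coset Jphi a = coset Jphi 0.
  have : coset Jphi a a by rewrite /coset /= subrr; exact: ideal0.
  by rewrite e /coset /= subr0.
apply: qinj; rewrite ?inq//; apply/seteqP; split=> b [c hc hb].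
  exists 0; first by rewrite /coset /= subrr; exact: ideal0.
  rewrite -[coset _ _ _]/(Jpsi (b - alpha 0)).
  have -> : b - alpha 0 = (b - alpha c) + (alpha (c - a) + alpha a).
    by rewrite (linB la) (lin0 la); zmod_eq.
  apply: idealD => //; apply: idealD => //.
  by apply: (in_split_ideal isp); exists (c - a).
exists a; first by rewrite /coset /= subrr; exact: ideal0.
rewrite -[coset _ _ _]/(Jpsi (b - alpha a)).
have -> : b - alpha a = (b - alpha c) + (alpha (c - 0) - alpha a).
  by rewrite (linB la) (lin0 la); zmod_eq.
apply: idealD => //; apply: idealB => //.
by apply: (in_split_ideal isp); exists (c - 0).
Qed.

Lemma in_split_decomp b : exists a j, b = alpha a + j /\ Jpsi j.
Proof.
have [_ _ qsurj] := in_split_quotient isp.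
have [_ [a0 _ <-]] : [set quotient_map Jpsi alpha K | K in quotient Jphi]
  (coset Jpsi b).
  by apply: qsurj; exists b.
move=> e; have : coset Jpsi b b by rewrite /coset /= subrr; exact: ideal0.
rewrite -e => -[a _ ha]; exists a, (b - alpha a); split=> //.
by rewrite addrC subrK.
Qed.

(** Two decompositions differ by alpha(a - a') = j' - j in J_psi, so a - a' is in J_phi. Covariance
    of (iA, iX) at a - a' is then exactly the equality needed. *)
Lemma pi_graph_fun b o o' : pi_graph b o -> pi_graph b o' -> o = o'.
Proof.
move=> [a [j [k [-> hj hk ->]]]] [a' [j' [k' [e hj' hk' ->]]]].
have [la _ _] := halpha; have [li _ _] := mm_hom mmX.
have eq1 : alpha (a - a') = j' - j.
  rewrite (linB la); transitivity (alpha a + j - j - alpha a'); first by zmod_eq.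
  by rewrite e; zmod_eq.
have ha : Jphi (a - a') by apply: alpha_reflects_ideal; rewrite eq1; exact: idealB.
have := cpairB mmX hk' hk; have -> : psi j' - psi j = phi (a - a').
  by rewrite -(in_split_comp isp) eq1 (linB (act_lin apsi)).
rewrite -[X in cpair _ _ X -> _]/(eop (lmul k' - lmul k)) -lmulB => h.
have := lift_uniq h (rep_cov ha); rewrite (linB li) => e2.
transitivity (iA a' + (iA a - iA a') + k); first by zmod_eq.
by rewrite -e2; zmod_eq.
Qed.

Lemma pi_graph_ex b : exists o, pi_graph b o.
Proof.
have [a [j [-> hj]]] := in_split_decomp b; have [k hk] := lift_compact hj.1.
by exists (iA a + k), a, j, k.
Qed.

Lemma pi_graph_lin (s : R[i]) b o b' o' : pi_graph b o -> pi_graph b' o' ->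
  pi_graph (s *: b + b') (s *: o + o').
Proof.
move=> [a [j [k [-> hj hk ->]]]] [a' [j' [k' [-> hj' hk' ->]]]].
have [la _ _] := halpha; have [li _ _] := mm_hom mmX.
exists (s *: a + a'), (s *: j + j'), (s *: k + k'); split.
- by rewrite la scalerDr; zmod_eq.
- exact: ideal_comb.
- by rewrite (left_action_linear apsi) lmulD lmulZ; exact: (cpair_comb mmX).
- by rewrite li scalerDr; zmod_eq.
Qed.

Lemma pi_graph_star b o : pi_graph b o -> pi_graph (star b) (star o).
Proof.
move=> [a [j [k [-> hj hk ->]]]]; have [_ _ sa_] := halpha; have [_ _ si] := mm_hom mmX.
exists (star a), (star j), (star k); split.
- by rewrite starD sa_.
- exact: ideal_star.
- exact: lift_star.
- by rewrite starD si.
Qed.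

Lemma pi_graph_mul b o b' o' : pi_graph b o -> pi_graph b' o' ->
  pi_graph (b ** b') (o ** o').
Proof.
move=> [a [j [k [-> hj hk ->]]]] [a' [j' [k' [-> hj' hk' ->]]]].
have [_ Ma sa_] := halpha; have [_ Mi si] := mm_hom mmX.
exists (a ** a'), (alpha a ** j' + j ** alpha a' + j ** j'),
  (iA a ** k' + k ** iA a' + k ** k'); split.
- by rewrite Ma !(cmulDl, cmulDr); zmod_eq.
- apply: idealD => //; last exact: ideal_mull.
  by apply: idealD => //; [exact: ideal_mull|exact: ideal_mulr].
- rewrite !(linD (act_lin apsi)) !lmulD; apply: (cpairD mmX).
    apply: (cpairD mmX); first exact: lift_left.
    have := lift_star (ideal_mull apsi _ (ideal_star apsi hj))
      (lift_left (star a') (ideal_star apsi hj) (lift_star hj hk)).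
    by rewrite sa_ si !starM !starK.
  by rewrite (left_action_mul apsi) lmulM; exact: (cpair_comp mmX).
- by rewrite Mi !(cmulDl, cmulDr); zmod_eq.
Qed.

Lemma pi_exists : exists pi : B -> O, [/\ star_hom pi,
  forall a, pi (alpha a) = iA a,
  forall j, Jpsi j -> cpair iX (psi j) (lmul (pi j)) &
  forall c x, pi c ** iX x = iX (psi c x)].
Proof.
have [pi piP] := choice pi_graph_ex; have [li _ _] := mm_hom mmX.
have [la _ _] := halpha.
have piE b o : pi_graph b o -> pi b = o by exact: pi_graph_fun.
exists pi; split.
- split=> [k b c|b c|b]; apply: piE.
  + exact: pi_graph_lin.
  + exact: pi_graph_mul.
  + exact: pi_graph_star.
- move=> a; apply: piE; exists a, 0, 0; rewrite !addr0; split=> //; first exact: ideal0.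
  have -> : lmul (0 : O) = 0 by apply: endo_eq => x; rewrite lmulE cmul0l.
  by rewrite (lin0 (act_lin apsi)); exact: cpair0.
- move=> j hj; have [k hk] := lift_compact hj.1; rewrite (piE j k)//.
  by exists 0, j, k; rewrite (lin0 la) (lin0 li) !add0r.
move=> c x; have [a [j [k [-> hj hk ->]]]] := piP c.
have h := cpair_intertwine mmX x hk; rewrite lmulE in h.
by rewrite cmulDl rep_left h (actD apsi) (in_split_comp isp) (linD (mm_lin mmX)).
Qed.

Variables (Y : hilbertModType B) (tens : X -> B -> Y) (rho : B -> Y -> Y).
Hypotheses (tp : tensor_product alpha tens) (ao : in_split_action_on psi tens rho).
Variable pi : B -> O.
Hypotheses (hpi : star_hom pi) (pi_alpha : forall a, pi (alpha a) = iA a)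
  (pi_left : forall c x, pi c ** iX x = iX (psi c x)).

(** Spanning the pairs inside Y * O gives a linear relation. The inner product formula [Sin] makes
    it contractive, so no choice of representation as a sum of tensors matters. *)
Lemma t_exists : exists t : Y -> self_module O,
  [/\ linear t, bop t 1 & forall x b, t (tens x b) = iX x ** pi b].
Proof.
have [lpi Mpi spi] := hpi.
pose S : set (Y * O) := [set p | exists x b, p = (tens x b, iX x ** pi b)].
have Sin p q : ispan S p -> ispan S q -> star p.2 ** q.2 = pi (inner p.1 q.1).
  have base x b y c : star (iX x ** pi b) ** (iX y ** pi c) =
      pi (inner (tens x b) (tens y c)).
    rewrite (tensor_inner tp) !Mpi spi starM pi_alpha -(mm_inner mmX) inner_self.
    by rewrite !cmulA.
  have half x b q0 : ispan S q0 ->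
    star (iX x ** pi b) ** q0.2 = pi (inner (tens x b) q0.1).
    elim=> [|k s v [y [c ->]] _ IH]; first by rewrite cmul0r inner0r (lin0 lpi).
    by rewrite /= cmulDr cmulZr innerDr innerZr lpi base IH.
  move=> hp hq; elim: hp => [|k s v [y [c ->]] _ IH].
    by rewrite /= star0 cmul0l inner0l (lin0 lpi).
  by rewrite /= starD starZ cmulDl cmulZl innerDl innerZl lpi half// IH.
have [f [lf f1 fE]] : exists f : Y -> O, [/\ linear f, bop f 1 &
    forall v w, ispan S (v, w) -> f v = w].
  apply: extend_by_density => [k v w v' w' h h'|v w h|v e e0].
  - exact: ispan_lin h h'.
  - rewrite -(@ler_pXn2r _ 2)// ?nnegrE ?nrm_ge0// -nrm_star_mul -nrm_inner.
    by rewrite (Sin _ _ h h); exact: star_hom_contr.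
  have [u su uv] := dense_approx v (tensor_dense tp) e0.
  have [w hw] : exists w, ispan S (u, w).
    elim: su => [|k s v0 [x _ [b _ <-]] _ [w hw]]; first by exists 0; left.
    exists (k *: (iX x ** pi b : O) + w).
    by apply: (@ispanD _ _ S k (tens x b, iX x ** pi b) (v0, w)) => //; exists x, b.
  by exists u, w.
exists f; split=> // x b; apply: fE; apply: ispan_mem; by exists x, b.
Qed.

Variable t : Y -> self_module O.
Hypotheses (t_lin : linear t) (t_bop : bop t 1)
  (t_tens : forall x b, t (tens x b) = iX x ** pi b).

Let deq := @tens_dense_eq R A X B alpha Y tens tp.

(** Density is used in the second variable with an elementary tensor in the first, and once more
    after exchanging the two by the involution. *)
Lemma t_inner y y' : inner (t y) (t y') = pi (inner y y').
Proof.
have [lpi Mpi spi] := hpi.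
have pc b : nrm (pi b) <= nrm b := star_hom_contr b hpi.
have bnd u : bop (fun v => inner (t u) (t v) : O) (nrm u).
  move=> v; rewrite (le_trans (cauchy_schwarz _ _))//.
  by apply: ler_pM; rewrite ?nrm_ge0// -[leRHS]mul1r; exact: t_bop.
have bnd' (u : Y) : bop (fun v => pi (inner u v)) (nrm u).
  by move=> v; rewrite (le_trans (pc _))//; exact: cauchy_schwarz.
have lin1 u : linear (fun v => inner (t u) (t v) : O).
  by move=> k v w; rewrite t_lin innerDr innerZr.
have lin2 (u : Y) : linear (fun v => pi (inner u v)).
  by move=> k v w; rewrite innerDr innerZr lpi.
have half x b v : inner (t (tens x b)) (t v) = pi (inner (tens x b) v).
  have := deq (lin1 (tens x b)) (lin2 (tens x b)) (bnd (tens x b)) (bnd' (tens x b)).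
  apply=> x' b'.
  rewrite !t_tens inner_self (tensor_inner tp) !Mpi spi starM pi_alpha.
  by rewrite -(mm_inner mmX) inner_self !cmulA.
have := deq (lin1 y) (lin2 y) (bnd y) (bnd' y).
apply=> x b.
by rewrite -[LHS]inner_star half -spi inner_star.
Qed.

Lemma t_ract y b : t (y *< b) = t y *< pi b.
Proof.
have pc c : nrm (pi c) <= nrm c := star_hom_contr c hpi.
move: y; apply: (deq (k := nrm b) (l := nrm b)) => [k u v|k u v|y|y|x c].
- by rewrite ractDl ractZl t_lin.
- by rewrite t_lin ractDl ractZl.
- by have := t_bop (y *< b); rewrite mul1r mulrC => /le_trans; apply; exact: nrm_ract.
- rewrite (le_trans (nrm_ract _ _))// mulrC; apply: ler_pM; rewrite ?nrm_ge0//.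
  by rewrite -[leRHS]mul1r; exact: t_bop.
- by rewrite (tensor_right tp) !t_tens ract_self (star_hom_mul hpi) cmulA.
Qed.

Lemma t_mm : mod_morphism pi t.
Proof. by split=> //; [exact: t_inner|exact: t_ract]. Qed.

Lemma t_left c y : t (rho c y) = pi c ** t y.
Proof.
have [arho rho_tens] := ao.
have pc b : nrm (pi b) <= nrm b := star_hom_contr b hpi.
move: y; apply: (deq (k := nrm c) (l := nrm c)) => [k u v|k u v|y|y|x b].
- by rewrite (act_linx arho) t_lin.
- by rewrite t_lin cmulDr cmulZr.
- by have := t_bop (rho c y); rewrite mul1r => /le_trans; apply; exact: act_bop.
- rewrite (le_trans (nrm_cmul _ _))//; apply: ler_pM; rewrite ?nrm_ge0//.
  by have := t_bop y; rewrite mul1r.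
- by rewrite rho_tens !t_tens cmulA pi_left.
Qed.

End ExtendRepresentation.

(** * Transport along homomorphisms, and the isomorphism *)

Section StarHom.
Variables (R : realType).

Lemma star_hom_comp (A B C : cstarAlgType R) (g : B -> C) (f : A -> B) :
  star_hom g -> star_hom f -> star_hom (g \o f).
Proof.
by move=> [lg Mg sg] [lf Mf sf]; split=> [k x y|x y|x] /=;
  rewrite ?(lf, Mf, sf) ?(lg, Mg, sg).
Qed.

Lemma star_hom_id (A : cstarAlgType R) : star_hom (@id A).
Proof. by []. Qed.

Lemma cpair_star_hom (A O C : cstarAlgType R) (X : hilbertModType A)
    (b : X -> self_module O) (h : O -> C) (T : X -> X) (k : O) :
  star_hom h -> cpair b T (lmul k) ->
  cpair ((h : self_module O -> self_module C) \o b) T (lmul (h k)).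
Proof.
move=> hh hT e e0; have [S [S' [hS bS bS']]] := hT e e0; have [lh Mh sh] := hh.
have thE (D : cstarAlgType R) (u v : D) :
    theta (u : self_module D) v = lmul (u ** star v).
  by apply/funext => z; rewrite /theta ract_self inner_self lmulE cmulA.
have l0 (D : cstarAlgType R) : lmul (0 : D) = 0 :> endo (self_module D).
  by apply: endo_eq => x; rewrite lmulE cmul0l.
have [s S'E hS'] : exists2 s : O, S' = lmul s &
    frpair ((h : self_module O -> self_module C) \o b) S (lmul (h s)).
  elim: hS => [|x y U U' _ [s -> IH]].
    by exists 0; rewrite ?(lin0 lh) l0//; left.
  exists (b x ** star (b y) + s); first by rewrite lmulD thE.
  have -> : eop (lmul (h (b x ** star (b y) + s))) =
      theta (((h : self_module O -> self_module C) \o b) x)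
            (((h : self_module O -> self_module C) \o b) y) + lmul (h s).
    by rewrite (linD lh) Mh sh lmulD thE.
  by right.
exists S, (lmul (h s)); split=> //.
rewrite -[_ - _]/(eop (lmul (h k) - lmul (h s))) -lmulB -(linB lh).
apply: bop_le (lmul_bop _); rewrite (le_trans (star_hom_contr _ hh))//.
by apply: bop_lmul (ltW e0) _; rewrite lmulB; move: bS'; rewrite S'E.
Qed.

End StarHom.

Theorem theorem4p24 (R : realType)
  (A : cstarAlgType R) (X : hilbertModType A) (phi : A -> X -> X)
  (B : cstarAlgType R) (alpha : A -> B) (psi : B -> X -> X)
  (Y : hilbertModType B) (tens : X -> B -> Y) (rho : B -> Y -> Y)
  (OX : cstarAlgType R) (iA : A -> OX) (iX : X -> self_module OX)
  (gX : R[i] -> OX -> OX)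
  (OY : cstarAlgType R) (iB : B -> OY) (iY : Y -> self_module OY)
  (gY : R[i] -> OY -> OY) :
  sigma_unital A ->
  left_action phi -> nondegenerate_action phi -> countably_generated X ->
  in_split phi alpha psi ->
  tensor_product alpha tens -> in_split_action_on psi tens rho ->
  cuntz_pimsner phi iA iX -> gauge_action iA iX gX ->
  cuntz_pimsner rho iB iY -> gauge_action iB iY gY ->
  exists beta : X -> Y,
    [/\ unique (fun b : X -> Y =>
          linear b /\ forall x a, b (x *< a) = tens x (alpha a)) beta,
        injective beta,
        covariant_morphism phi rho alpha beta
      & exists h : OX -> OY,
          [/\ unique (induced_hom alpha beta iA iX iB iY) h,
              star_iso h
            & forall z : R[i], `|z| = 1 ->
                forall t, h (gX z t) = gY z (h t)]].
Proof.
move=> su aphi _ _ isp tp ao cpX gaX cpY gaY.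
have [beta betaE] := beta_exists su isp tp.
have mmb := beta_mm su isp tp betaE.
have rhob := rho_beta su isp ao betaE.
have Jrho := covariance_ideal_rho su isp tp ao betaE.
have psirho := cpair_psi_rho su isp tp ao betaE.
have covb c : covariance_ideal phi c -> cpair beta (phi c) (rho (alpha c)).
  by move=> [hc _]; rewrite -(in_split_comp isp); apply: psirho;
    rewrite (in_split_comp isp).
have leftb c x : beta (phi c x) = rho (alpha c) (beta x).
  by rewrite rhob (in_split_comp isp).
have [mmX _] := covariant_cpair (cp_rep cpX).
have [mmY covY] := covariant_cpair (cp_rep cpY).
have leftY b y : iY (rho b y) = iB b ** iY y := corr_morphism_left (cp_rep cpY).1 b y.
exists beta; split.
- split; first by split; [exact: mm_lin mmb|].
  move=> b' [_ bE]; apply/funext => x; have [z [a ->]] := cohen_factorization x su.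
  by rewrite betaE bE.
- exact: (beta_inj su isp tp betaE).
- exact: cpair_covariant.
have mmbY := mod_morphism_comp mmb mmY.
have [h [hh hA hX]] : exists h : OX -> OY, [/\ star_hom h,
    forall a, h (iA a) = iB (alpha a) & forall x, h (iX x) = iY (beta x)].
  apply: (cp_universal cpX (pi := iB \o alpha) (t := iY \o beta)).
  apply: (cpair_covariant mmbY) => [c x|c hc]; first by rewrite /= leftb leftY.
  apply: (cpair_trans mmY (covb c hc)); apply: covY.
  by apply/Jrho/(in_split_ideal isp); exists c.
have [pi [hpi pi_alpha pi_J pi_left]] := pi_exists aphi isp (cp_rep cpX).
have [t [t_lin t_bop t_tens]] := t_exists (cp_rep cpX) tp hpi pi_alpha.
have mmt := t_mm (cp_rep cpX) tp hpi pi_alpha t_lin t_bop t_tens.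
have t_beta x : t (beta x) = iX x.
  have [z [a ->]] := cohen_factorization x su.
  by rewrite betaE t_tens pi_alpha (mm_ract mmX) ract_self.
have t_betaE : t \o beta = iX by apply/funext => x; exact: t_beta.
(* As iX = t o beta, the value of iX^(1) at psi(c) is t^(1)(rho(c)). For c in J_rho, which is J_psi,
   the former is pi(c). *)
have rept : covariant_rep rho pi t.
  apply: (cpair_covariant mmt) => [c y|c hc].
    exact: (t_left tp ao hpi pi_left t_lin t_bop t_tens).
  have [T hT] := compact_cpair mmt hc.1; move: hc => /Jrho hc.
  have := cpair_trans mmt (psirho c hc.1) hT; rewrite t_betaE => hT'.
  by rewrite -[id_action _]/(eop (lmul (pi c))) (cpair_uniq mmX (pi_J c hc) hT').
have [h' [hh' hB' hY']] := cp_universal cpY rept.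
have h_iXE : h \o iX = iY \o beta by apply/funext => x; exact: hX.
(* On alpha(A) this is the defining property of h. On J_psi both sides are the image of psi(j) under
   the map induced by iY o beta. *)
have h_pi b : h (pi b) = iB b.
  have [a [j [-> hj]]] := in_split_decomp isp b.
  rewrite (linD (star_hom_linear hpi)) (linD (star_hom_linear hh)) pi_alpha hA.
  rewrite (linD (star_hom_linear (mm_hom mmY))); congr (_ + _).
  have := cpair_star_hom hh (pi_J j hj); rewrite h_iXE => h1.
  have h2 := cpair_trans mmY (psirho j hj.1) (covY j ((Jrho j).2 hj)).
  by apply: lmul_inj; apply: val_inj; exact: (cpair_uniq mmbY h1 h2).
have h_t y : h (t y) = iY y.
  have lh := star_hom_linear hh.
  apply: (tens_dense_eq tp (F := h \o t) (k := 1) (l := 1)) => [k u v||u|u|x b].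
  - by rewrite /= t_lin lh.
  - exact: mm_lin mmY.
  - exact: (le_trans (star_hom_contr _ hh) (t_bop u)).
  - by rewrite mul1r; exact: (mm_contr mmY).
  rewrite /= t_tens (star_hom_mul hh) hX h_pi -(beta_tens su tp betaE).
  by rewrite (mm_ract mmY).
have hK : cancel h h'.
  apply: (star_hom_ext (f := h' \o h) (cp_generated cpX)).
  - exact: star_hom_comp.
  - exact: star_hom_id.
  by move=> _ [[a _ <-]|[x _ <-]] /=; rewrite ?hA ?hX ?hB' ?hY'.
have h'K : cancel h' h.
  apply: (star_hom_ext (f := h \o h') (cp_generated cpY)).
  - exact: star_hom_comp.
  - exact: star_hom_id.
  by move=> _ [[b _ <-]|[y _ <-]] /=; rewrite ?hB' ?hY'.
exists h; split.
- split=> // g [hg gA gX']; apply/funext;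
  apply: (star_hom_ext (cp_generated cpX)) => //.
  by move=> _ [[a _ <-]|[x _ <-]]; rewrite ?gA ?gX' ?hA ?hX.
- by split=> //; exists h'.
move=> z z1; have [[hgX _] gXA gXX] := gaX z z1; have [[hgY _] gYB gYY] := gaY z z1.
apply: (star_hom_ext (f := h \o gX z) (g := gY z \o h) (cp_generated cpX)).
- exact: star_hom_comp.
- exact: star_hom_comp.
move=> _ [[a _ <-]|[x _ <-]] /=; first by rewrite gXA hA gYB.
by rewrite gXX hX gYY (linZ (star_hom_linear hh)) hX.
Qed.
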